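(* Consider the type-2 solution $(y,z,u)$ with parameters $(\varphi,\delta,\hat u)$ described in the context. Denote $$i\,\Theta_{01}\equiv\hat\gamma=1-\Theta_0-\Theta_1\quad\text{and}\quad i\,\omega_2\equiv\nu_2=1-\Theta_\infty+4\varphi .$$ Assume that $\Theta_{01}$ and $\omega_2$, as well as the coefficients $\hat\alpha$ and $\hat\beta$ of the fifth Painlevé equation (given in the context), are real and $$\Big(\frac{\omega_2-\Theta_{01}}2\Big)^2>-2\hat\alpha .$$ Then the type-2 solution is real for pure imaginary values of $t$, namely, $y(t)\equiv\tilde y(\tau)$, $t=i\tau$, $\tilde y(\tau)\in\mathbb R$ for $\tau\in\mathbb R$, and its asymptotics as $t\to\infty$ and $\arg t\to\epsilon\pi/2$ $(\epsilon=\pm1)$ can be rewritten as follows: $$\frac1{\tilde y(\tau)}\underset{\tau\to\epsilon\infty}=-\frac1\tau\left(\frac{\omega_2-\Theta_{01}}2+\sqrt{\Big(\frac{\omega_2-\Theta_{01}}2\Big)^2+2\hat\alpha}\;\sin\big(\tau-\omega_2\ln|\tau|+\arg\delta\big)+\mathcal O\Big(\frac{\ln\tau}{\tau}\Big)\right),$$ where $\delta$ is the parameter of the type-2 solution. For real solutions with these asymptotics, $|\delta|$ is given by the relation $$\frac{2e^{-\frac{\epsilon\pi\omega_2}2}}{|\delta|}=\sqrt{\Big(\frac{\omega_2-\Theta_{01}}2\Big)^2+2\hat\alpha}\;>\;0 .$$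
   Context: Let $\Theta_0,\Theta_1,\Theta_\infty\in\mathbb C$. The function $y$ satisfies the fifth Painlevé equation $$y''=\Big(\frac1{2y}+\frac1{y-1}\Big)(y')^2-\frac{y'}t+\frac{(y-1)^2}{t^2}\Big(\hat\alpha y+\frac{\hat\beta}y\Big)+\hat\gamma\frac yt-\frac12\,\frac{y(y+1)}{y-1},$$ $$\hat\alpha=\tfrac12\Big(\tfrac{\Theta_0-\Theta_1+\Theta_\infty}2\Big)^2,\quad\hat\beta=-\tfrac12\Big(\tfrac{\Theta_0-\Theta_1-\Theta_\infty}2\Big)^2,\quad\hat\gamma=1-\Theta_0-\Theta_1,$$ as a consequence of the isomonodromy deformation system \begin{align*} t\frac{dy}{dt}&=ty-2z(y-1)^2-(y-1)\Big(\tfrac{\Theta_0-\Theta_1+\Theta_\infty}2y-\tfrac{3\Theta_0+\Theta_1+\Theta_\infty}2\Big),\\ t\frac{dz}{dt}&=yz\Big(z+\tfrac{\Theta_0-\Theta_1+\Theta_\infty}2\Big)-\frac1y(z+\Theta_0)\Big(z+\tfrac{\Theta_0+\Theta_1+\Theta_\infty}2\Big),\\ t\frac{d}{dt}\log u&=-2z-\Theta_0+y\Big(z+\tfrac{\Theta_0-\Theta_1+\Theta_\infty}2\Big)+\frac1y\Big(z+\tfrac{\Theta_0+\Theta_1+\Theta_\infty}2\Big). \end{align*} **Type-2 solution.** Let $\varphi\in\mathbb C$ with $\varphi\mp\frac{\Theta_0}2,\ \varphi-\frac{\Theta_\infty}2\mp\frac{\Theta_1}2\ne0,-1,-2,\ldots$,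 let $\delta,\hat u\in\mathbb C\setminus\{0\}$, $\nu_2=1-\Theta_\infty+4\varphi$, $-\frac12<\Re\nu_2<1$, and $R_2(t;\vartheta)=1-(\varphi+\vartheta)\delta t^{-\nu_2}e^t$. For each sign $\pm$, the type-2 solution is the unique solution of the system with, as $t\to\infty$, $\arg t\to\pm\frac\pi2$, $t\in\mathcal D^2$, \begin{align*} \tfrac ty&=\frac{R_2(t;\frac{\Theta_0}2)R_2(t;\frac{\Theta_1-\Theta_\infty}2)}{\delta t^{-\nu_2}e^t}+\mathcal O(t^{-3\nu_2-1}\ln t)+\mathcal O(t^{\nu_2-1}\ln t),\\ z&=-(\varphi+\tfrac{\Theta_0}2)R_2(t;\tfrac{\Theta_1-\Theta_\infty}2)+\mathcal O(t^{-1})+\mathcal O(t^{-3\nu_2-1}\ln t),\\ u&=\frac{\hat u}\delta t^{2\varphi}\big(1+\mathcal O(t^{-1}\ln t)+\mathcal O(t^{-2\nu_2-1}\ln t)\big)\big(R_2(t;\tfrac{\Theta_1-\Theta_\infty}2)+\mathcal O(t^{-\nu_2-1}\ln t)+\mathcal O(t^{-3\nu_2-1}\ln t)\big). \end{align*} Here $\mathcal D^2=\{|\Re t|\le r_1,\ -\pi<\arg t<\pi,\ |t-t_n|\ge r_2|t|^{\varepsilon-1}\}$ with arbitrary $r_1,r_2>0$, $0<\varepsilon\le1$, where $t_n$ runs over the infinite sequences (if they exist) of zeros in $|\Re t|<r_1$ of $R_2(t;\frac{\Theta_0}2)$ and $R_2(t;\frac{\Theta_1-\Theta_\infty}2)$.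 The power $t^\nu$ equals $e^{\pm i\pi\nu/2}|t|^\nu$ for $t\in\pm i\mathbb R_{>0}$ and is extended by analytic continuation.
   Formalization: Reality and the asymptotics are proved when |δ| satisfies the stated relation (for other |δ| the solution is not real; reality implying the relation is also proved), and on the ray ετ>0 away from poles, since t=0 is a branch point. *)

(* Defs.v *)
(* Stdlib reals with Coquelicot's complex numbers. *)
From Stdlib Require Import Reals.
From Coquelicot Require Import Coquelicot.
Open Scope R_scope.

(* Principal argument, with values in (-PI, PI] for z <> 0. *)
Definition Carg (z : C) : R :=
  if Rle_dec 0 (Im z) then acos (Re z / Cmod z) else - acos (Re z / Cmod z).

Definition Cexp (z : C) : C := (exp (Re z) * cos (Im z), exp (Re z) * sin (Im z)).

Definition Cln (z : C) : C := (ln (Cmod z), Carg z).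

(* Principal branch: t^nu = e^(i PI nu / 2) |t|^nu on the positive imaginary axis
   and e^(- i PI nu / 2) |t|^nu on the negative one, continued analytically to
   -PI < arg t < PI. *)
Definition cpow (t nu : C) : C := Cexp (nu * Cln t)%C.

Definition holomorphic_at (f : C -> C) (p : C) : Prop :=
  locally p (fun s => @ex_derive C_AbsRing C_NormedModule f s).

(* (s - p)^n f(s) extends holomorphically across p for some n.  The value of f
   at a pole is arbitrary: everything below that is evaluated at a point of a
   solution is guarded by [holomorphic_at]. *)
Definition meromorphic_at (f : C -> C) (p : C) : Prop :=
  exists (n : nat) (g : C -> C), holomorphic_at g p /\
    locally p (fun s => s <> p -> f s = (g s / (s - p) ^ n)%C).

Record theta := Theta { Th0 : C; Th1 : C; Thinf : C }.

Definition alpha5 (th : theta) : C :=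
  (1 / 2 * ((Th0 th - Th1 th + Thinf th) / 2) ^ 2)%C.
Definition beta5 (th : theta) : C :=
  (- (1 / 2 * ((Th0 th - Th1 th - Thinf th) / 2) ^ 2))%C.
Definition gamma5 (th : theta) : C := (1 - Th0 th - Th1 th)%C.

Definition eq_y (th : theta) (y z : C -> C) (t : C) : Prop :=
  (t * C_derive y t =
   t * y t - 2 * z t * (y t - 1) ^ 2
   - (y t - 1) * ((Th0 th - Th1 th + Thinf th) / 2 * y t
                  - (3 * Th0 th + Th1 th + Thinf th) / 2))%C.

Definition eq_z (th : theta) (y z : C -> C) (t : C) : Prop :=
  (t * C_derive z t =
   y t * z t * (z t + (Th0 th - Th1 th + Thinf th) / 2)
   - 1 / y t * (z t + Th0 th) * (z t + (Th0 th + Th1 th + Thinf th) / 2))%C.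

Definition eq_u (th : theta) (y z u : C -> C) (t : C) : Prop :=
  (t * (C_derive u t / u t) =
   - (2 * z t) - Th0 th + y t * (z t + (Th0 th - Th1 th + Thinf th) / 2)
   + 1 / y t * (z t + (Th0 th + Th1 th + Thinf th) / 2))%C.

(* eps = 1: upper half-plane, eps = -1: lower half-plane.  Solutions of the
   system are meromorphic on the universal cover of C \ {0}; each half-plane is
   simply connected, so restricting to it loses nothing, and it contains the
   ray arg t = eps PI / 2 together with the part of the cut plane that matters
   for t -> oo, arg t -> eps PI / 2. *)
Definition half_plane (eps : R) (t : C) : Prop := 0 < eps * Im t.

Definition is_solution (eps : R) (th : theta) (y z u : C -> C) : Prop :=
  forall t, half_plane eps t ->
    (meromorphic_at y t /\ meromorphic_at z t /\ meromorphic_at u t) /\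
    (holomorphic_at y t -> holomorphic_at z t -> eq_y th y z t) /\
    (holomorphic_at y t -> holomorphic_at z t -> y t <> 0 -> eq_z th y z t) /\
    (holomorphic_at y t -> holomorphic_at z t -> holomorphic_at u t ->
     y t <> 0 -> u t <> 0 -> eq_u th y z u t).

Definition nu2 (th : theta) (phi : C) : C := (1 - Thinf th + 4 * phi)%C.

(* delta t^(-nu_2) e^t *)
Definition X2 (th : theta) (phi delta t : C) : C :=
  (delta * cpow t (- nu2 th phi) * Cexp t)%C.

Definition R2 (th : theta) (phi delta t vartheta : C) : C :=
  (1 - (phi + vartheta) * X2 th phi delta t)%C.

Definition cut_plane (t : C) : Prop := t <> 0 /\ - PI < Carg t < PI.

(* Discs around all zeros in the strip are removed; when there are only finitely
   many of them this does not affect the behaviour as t -> oo. *)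
Definition D2 (th : theta) (phi delta : C) (r1 r2 e : R) (t : C) : Prop :=
  cut_plane t /\ Rabs (Re t) <= r1 /\
  forall s, cut_plane s -> Rabs (Re s) < r1 ->
    R2 th phi delta s (Th0 th / 2)%C = 0 \/
    R2 th phi delta s ((Th1 th - Thinf th) / 2)%C = 0 ->
    r2 * Rpower (Cmod t) (e - 1) <= Cmod (t - s)%C.

(* P holds eventually as t -> oo, arg t -> eps PI / 2. *)
Definition near_infty (eps : R) (P : C -> Prop) : Prop :=
  exists T eta : R, 0 < eta /\
    forall t, T < Cmod t -> Rabs (Carg t - eps * PI / 2) < eta -> P t.

(* E = O(g1) + O(g2) as t -> oo, arg t -> eps PI / 2, t in D *)
Definition bigO2 (eps : R) (D : C -> Prop) (E g1 g2 : C -> C) : Prop :=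
  exists K : R, near_infty eps (fun t => D t ->
    Cmod (E t) <= K * (Cmod (g1 t) + Cmod (g2 t))).

Definition type2_parameters (th : theta) (phi delta uh : C) : Prop :=
  (forall n : nat,
     (phi - Th0 th / 2)%C <> RtoC (- INR n) /\
     (phi + Th0 th / 2)%C <> RtoC (- INR n) /\
     (phi - Thinf th / 2 - Th1 th / 2)%C <> RtoC (- INR n) /\
     (phi - Thinf th / 2 + Th1 th / 2)%C <> RtoC (- INR n)) /\
  delta <> 0 /\ uh <> 0 /\ - (1 / 2) < Re (nu2 th phi) < 1.

Definition type2_asymptotics (eps : R) (th : theta) (phi delta uh : C)
    (y z u : C -> C) : Prop :=
  let nu := nu2 th phi in
  let Ra t := R2 th phi delta t (Th0 th / 2)%C in
  let Rb t := R2 th phi delta t ((Th1 th - Thinf th) / 2)%C in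
  forall r1 r2 e : R, 0 < r1 -> 0 < r2 -> 0 < e <= 1 ->
  let D := D2 th phi delta r1 r2 e in
  bigO2 eps D (fun t => t / y t - Ra t * Rb t / X2 th phi delta t)%C
    (fun t => cpow t (- (3 * nu) - 1) * Cln t)%C
    (fun t => cpow t (nu - 1) * Cln t)%C /\
  bigO2 eps D (fun t => z t - - ((phi + Th0 th / 2) * Rb t))%C
    (fun t => cpow t (-1)%R)
    (fun t => cpow t (- (3 * nu) - 1) * Cln t)%C /\
  exists E1 E2 : C -> C,
    bigO2 eps D E1
      (fun t => cpow t (-1)%R * Cln t)%C
      (fun t => cpow t (- (2 * nu) - 1) * Cln t)%C /\
    bigO2 eps D E2
      (fun t => cpow t (- nu - 1) * Cln t)%C
      (fun t => cpow t (- (3 * nu) - 1) * Cln t)%C /\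
    near_infty eps (fun t => D t ->
      u t = uh / delta * cpow t (2 * phi) * (1 + E1 t) * (Rb t + E2 t))%C.

Definition agree (eps : R) (f g : C -> C) : Prop :=
  forall t, half_plane eps t -> holomorphic_at f t -> holomorphic_at g t -> f t = g t.

(* (y, z, u) is the unique solution with the type-2 asymptotics. *)
Definition type2_solution (eps : R) (th : theta) (phi delta uh : C)
    (y z u : C -> C) : Prop :=
  is_solution eps th y z u /\
  type2_asymptotics eps th phi delta uh y z u /\
  forall y1 z1 u1, is_solution eps th y1 z1 u1 ->
    type2_asymptotics eps th phi delta uh y1 z1 u1 ->
    agree eps y y1 /\ agree eps z z1 /\ agree eps u u1.

(* y(i tau) = yt(tau), real, at every point of the ray arg t = eps PI / 2 that
   is not a pole of y. *)
Definition real_on_ray (eps : R) (y : C -> C) (yt : R -> R) : Prop :=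
  forall tau : R, 0 < eps * tau -> holomorphic_at y (Ci * tau)%C ->
    y (Ci * tau)%C = RtoC (yt tau).

(* Main.v *)
(** Put w = t / y. In the variables v = y z (z + a) / t and P = v - z, with
    a = (Theta_0 - Theta_1 + Theta_oo) / 2, the system has the form P' = O(1/t),
    v' = v + O(1/t) and is regular at the poles of y. Hence the type-2 asymptotics,
    assumed only outside of discs around the zeros of R_2, propagate horizontally
    from a line Re t = x1 without such zeros to a whole strip around the imaginary
    axis, where v ~ p q X, P ~ p and w ~ 1/X - (p + q) + p q X with
    X = delta t^(-nu_2) e^t, p = phi + Theta_0 / 2, q = phi + (Theta_1 - Theta_oo) / 2.
    On the ray t = i tau this is the claimed formula when |X|^2 = - 1 / (p q), and
    it is purely imaginary to leading order only in that case.

    For reality, y^(t) = conj (y (- conj t)) solves the same system with a suitable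
    z^, and under the condition on |delta| it has the same asymptotics. The slow
    variables of two solutions with the same asymptotics differ by N with N' = O(N / t^2)
    after removal of oscillating terms, whence y^ = y for large t in the strip. The identity
    theorem carries y^ = y down the ray across the poles; it is derived from Goursat's
    theorem for squares, applied to G / (t - q)^n for a function G vanishing near q. *)

Require Import Defs.
From Stdlib Require Import Reals Lra Lia Classical ClassicalEpsilon.
From Coquelicot Require Import Coquelicot.
Open Scope R_scope.

(** * Continuity and complex derivatives *)

(** Why the discs matter: when a is real one has |p| = |q|, and under the condition on |delta|
    infinitely many zeros of R_2 lie on the ray itself. The assumed asymptotics are then silent
    exactly around the points of the ray where the leading term of 1/y vanishes and y may have
    poles. The cure is to start far to the right, where |X| grows like exp (Re t) and exceeds 1/|p|
    and 1/|q|, and to travel left in variables that do not see the poles: z' = v + O(1/t^2), and in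
    v' the terms quadratic in y cancel. Why |delta| is forced: X(t) conj (X(- conj t)) is the
    constant |delta|^2 exp (eps PI omega_2). Reflection thus acts on the leading terms as X -> const
    / X, which fixes the leading term of t / y exactly when the constant is -1 / (p q); the radicand
    being positive means p q < 0. Complex analysis is needed in a crude form only: squares instead
    of general contours, and maximum estimates with a constant 4, because the identity theorem beats
    any constant by a factor 2^n. *)

Definition ccont (f : C -> C) (s : C) : Prop :=
  forall eps : R, 0 < eps -> exists d : R, 0 < d /\
    forall x, Cmod (x - s) < d -> Cmod (f x - f s) < eps.

(** Neighbourhoods are discs of [Cmod], whereas [locally] on C is built from product balls;
    [locally_near] reconciles the two. *)
Definition near (s : C) (P : C -> Prop) : Prop :=
  exists d : R, 0 < d /\ forall x, Cmod (x - s) < d -> P x.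

Lemma Cmod_minus_sym (x y : C) : Cmod (x - y) = Cmod (y - x).
Proof. rewrite <- Cmod_opp. f_equal. ring. Qed.

Lemma Cmod_pos (x : C) : x <> RtoC 0 -> 0 < Cmod x.
Proof. apply Cmod_gt_0. Qed.

Lemma Cmod_pos_neq_0 (x : C) : 0 < Cmod x -> x <> RtoC 0.
Proof. apply Cmod_gt_0. Qed.

Lemma Cmod_self (s : C) : Cmod (s - s) = 0.
Proof. replace (s - s)%C with (RtoC 0) by ring. apply Cmod_0. Qed.

Lemma near_and s P Q : near s P -> near s Q -> near s (fun x => P x /\ Q x).
Proof.
  intros [d [Hd H]] [e [He G]]. exists (Rmin d e). split.
  - now apply Rmin_glb_lt.
  - intros x Hx. pose proof (Rmin_l d e). pose proof (Rmin_r d e).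
    split; [apply H | apply G]; lra.
Qed.

Lemma near_mono s (P Q : C -> Prop) : (forall x, P x -> Q x) -> near s P -> near s Q.
Proof. intros H [d [Hd G]]. exists d. firstorder. Qed.

Lemma near_self s (P : C -> Prop) : near s P -> P s.
Proof. intros [d [Hd H]]. apply H. now rewrite Cmod_self. Qed.

Lemma near_open s P : near s P -> near s (fun x => near x P).
Proof.
  intros [d [Hd H]]. exists d. split; [easy|]. intros x Hx.
  exists (d - Cmod (x - s)). split; [lra|]. intros y Hy. apply H.
  replace (y - s)%C with ((y - x) + (x - s))%C by ring.
  pose proof (Cmod_triangle (y - x) (x - s)). lra.
Qed.

Lemma ccont_ext f g s : near s (fun x => f x = g x) -> ccont f s -> ccont g s.
Proof.
  intros [d [Hd H]] Hf eps Heps. destruct (Hf eps Heps) as [e [He G]].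
  exists (Rmin d e). split; [now apply Rmin_glb_lt|]. intros x Hx.
  pose proof (Rmin_l d e). pose proof (Rmin_r d e).
  rewrite <- !H; [apply G; lra| rewrite Cmod_self; lra | lra].
Qed.

Lemma ccont_const c s : ccont (fun _ => c) s.
Proof. intros e He. exists 1. split; [lra|]. intros. now rewrite Cmod_self. Qed.

Lemma ccont_id s : ccont (fun x => x) s.
Proof. intros e He. exists e. auto. Qed.

Lemma ccont_plus f g s : ccont f s -> ccont g s -> ccont (fun x => f x + g x)%C s.
Proof.
  intros Hf Hg e He. destruct (Hf (e/2)) as [d [Hd H]]; [lra|].
  destruct (Hg (e/2)) as [d' [Hd' H']]; [lra|].
  exists (Rmin d d'). split; [now apply Rmin_glb_lt|]. intros x Hx.
  pose proof (Rmin_l d d'). pose proof (Rmin_r d d').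
  specialize (H x ltac:(lra)). specialize (H' x ltac:(lra)).
  replace (f x + g x - (f s + g s))%C with ((f x - f s) + (g x - g s))%C by ring.
  pose proof (Cmod_triangle (f x - f s) (g x - g s)). lra.
Qed.

Lemma ccont_mult f g s : ccont f s -> ccont g s -> ccont (fun x => f x * g x)%C s.
Proof.
  intros Hf Hg e He.
  set (F := Cmod (f s)). set (G := Cmod (g s)).
  assert (HF : 0 <= F) by apply Cmod_ge_0. assert (HG : 0 <= G) by apply Cmod_ge_0.
  set (e1 := Rmin 1 (e / (2 * (F + G + 1)))).
  assert (He1 : 0 < e1).
  { apply Rmin_glb_lt; [lra|]. apply Rdiv_lt_0_compat; lra. }
  assert (H1 : e1 <= 1) by apply Rmin_l.
  assert (H2 : e1 * (F + G + 1) <= e / 2).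
  { apply Rle_trans with (e / (2 * (F + G + 1)) * (F + G + 1)).
    - apply Rmult_le_compat_r; [lra|]. apply Rmin_r.
    - right. field. lra. }
  destruct (Hf e1 He1) as [d [Hd H]]. destruct (Hg e1 He1) as [d' [Hd' H']].
  exists (Rmin d d'). split; [now apply Rmin_glb_lt|]. intros x Hx.
  pose proof (Rmin_l d d'). pose proof (Rmin_r d d').
  specialize (H x ltac:(lra)). specialize (H' x ltac:(lra)).
  replace (f x * g x - f s * g s)%C
    with ((f x - f s) * (g x - g s) + (f s * (g x - g s) + (f x - f s) * g s))%C by ring.
  eapply Rle_lt_trans; [apply Cmod_triangle|].
  eapply Rle_lt_trans; [apply Rplus_le_compat_l, Cmod_triangle|].
  rewrite !Cmod_mult. fold F G.
  pose proof (Cmod_ge_0 (f x - f s)). pose proof (Cmod_ge_0 (g x - g s)).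
  nra.
Qed.

Lemma ccont_inv (f : C -> C) (s : C) : f s <> RtoC 0 -> ccont f s -> ccont (fun x => / f x)%C s.
Proof.
  intros Hs Hf e He.
  set (F := Cmod (f s)). assert (HF : 0 < F) by (apply Cmod_pos; exact Hs).
  set (e1 := Rmin (F / 2) (e * F * F / 4)).
  assert (He1 : 0 < e1) by (apply Rmin_glb_lt; [lra|]; repeat apply Rmult_lt_0_compat; lra).
  assert (H1 : e1 <= F / 2) by apply Rmin_l.
  assert (H2 : e1 <= e * F * F / 4) by apply Rmin_r.
  destruct (Hf e1 He1) as [d [Hd H]]. exists d. split; [easy|]. intros x Hx.
  specialize (H x Hx).
  assert (Hfx : F / 2 < Cmod (f x)).
  { pose proof (Cmod_triangle (f x) (f s - f x)).
    replace (f x + (f s - f x))%C with (f s) in H0 by ring.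
    rewrite Cmod_minus_sym in H. fold F in H0. lra. }
  assert (Hx0 : f x <> RtoC 0) by (apply Cmod_pos_neq_0; lra).
  replace (/ f x - / f s)%C with ((f s - f x) / (f x * f s))%C by (field; auto).
  rewrite Cmod_div, Cmod_mult by now apply Cmult_neq_0.
  rewrite Cmod_minus_sym. fold F. apply Rmult_lt_reg_r with (Cmod (f x) * F); [nra|].
  unfold Rdiv. rewrite Rmult_assoc, Rinv_l by nra.
  assert (e * (F / 2 * F) < e * (Cmod (f x) * F)) by (apply Rmult_lt_compat_l; nra).
  nra.
Qed.

(** Carathéodory's form of the derivative: the rules for products and inverses become algebra, and
    [phi] later serves as the continuous extension of the difference quotient to the centre of a
    square. *)
Definition cder (f : C -> C) (s l : C) : Prop :=
  exists phi : C -> C, phi s = l /\ ccont phi s /\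
    near s (fun x => f x = f s + phi x * (x - s))%C.

Lemma cder_ccont f s l : cder f s l -> ccont f s.
Proof.
  intros [phi [E [Hc Hn]]].
  apply ccont_ext with (fun x => f s + phi x * (x - s))%C.
  - revert Hn. apply near_mono. now intros.
  - apply ccont_plus; [apply ccont_const|]. apply ccont_mult; [easy|].
    apply ccont_ext with (fun x => x + - s)%C; [exists 1; split; [lra|reflexivity]|].
    apply ccont_plus; [apply ccont_id | apply ccont_const].
Qed.

Lemma cder_const c s : cder (fun _ => c) s 0.
Proof.
  exists (fun _ => RtoC 0). split; [easy|]. split; [apply ccont_const|].
  exists 1. split; [lra|]. intros. ring.
Qed.

Lemma cder_plus f g s l m :
  cder f s l -> cder g s m -> cder (fun x => f x + g x)%C s (l + m).
Proof.
  intros [u [Eu [Cu Nu]]] [v [Ev [Cv Nv]]].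
  exists (fun x => u x + v x)%C. split; [now rewrite Eu, Ev|].
  split; [now apply ccont_plus|].
  generalize (near_and _ _ _ Nu Nv). apply near_mono. intros x [-> ->]. ring.
Qed.

Lemma cder_mult f g s l m :
  cder f s l -> cder g s m -> cder (fun x => f x * g x)%C s (l * g s + f s * m).
Proof.
  intros Hf Hg. pose proof (cder_ccont _ _ _ Hg) as Cg.
  destruct Hf as [u [Eu [Cu Nu]]]. destruct Hg as [v [Ev [Cv Nv]]].
  exists (fun x => u x * g x + f s * v x)%C. split; [now rewrite Eu, Ev|]. split.
  - apply ccont_plus; apply ccont_mult; auto using ccont_const.
  - generalize (near_and _ _ _ Nu Nv). apply near_mono. intros x [-> ->]. ring.
Qed.

Lemma cder_inv (f : C -> C) (s l : C) : f s <> RtoC 0 -> cder f s l -> cder (fun x => / f x)%C s (- l / (f s * f s)).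
Proof.
  intros Hs Hf. pose proof (cder_ccont _ _ _ Hf) as Cf.
  destruct Hf as [u [Eu [Cu Nu]]].
  exists (fun x => (- (1)) * u x * (/ f x * / f s))%C. split; [rewrite Eu; now field|]. split.
  - apply ccont_mult; [apply ccont_mult; auto using ccont_const|].
    apply ccont_mult; [now apply ccont_inv | apply ccont_const].
  - assert (Hn : near s (fun x => f x <> RtoC 0)).
    { destruct (Cf (Cmod (f s))) as [d [Hd H]]; [apply Cmod_pos; exact Hs|].
      exists d. split; [easy|]. intros x Hx E. specialize (H x Hx). rewrite E in H.
      rewrite Cmod_minus_sym in H. replace (f s - 0)%C with (f s) in H by ring. lra. }
    generalize (near_and _ _ _ Nu Hn). apply near_mono. intros x [E Hx].
    assert (D : (u x * (x - s) = f x - f s)%C) by (rewrite E; ring).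
    transitivity (/ f s + - (1) * (u x * (x - s)) * (/ f x * / f s))%C; [|ring].
    rewrite D. field. auto.
Qed.

(** * Derivatives along lines *)

Lemma Cminus_neq_0 (x y : C) : x <> y -> (x - y)%C <> RtoC 0.
Proof. intros H E. apply H. replace x with ((x - y) + y)%C by ring. rewrite E. ring. Qed.

Lemma is_derive_cder (f : C -> C) (s l : C) :
  @is_derive C_AbsRing C_NormedModule f s l -> cder f s l.
Proof.
  intros [_ H]. specialize (H s (fun P HP => HP)).
  exists (fun x => if excluded_middle_informative (x = s) then l else (f x - f s) / (x - s))%C.
  split; [|split].
  - now destruct (excluded_middle_informative (s = s)).
  - intros e He. assert (He2 : 0 < e / 2) by lra.
    specialize (H (mkposreal _ He2)). destruct H as [d H].
    exists d. split; [apply cond_pos|]. intros x Hx.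
    destruct (excluded_middle_informative (s = s)); [|easy].
    destruct (excluded_middle_informative (x = s)) as [->|Hxs].
    + now rewrite Cmod_self.
    + specialize (H x Hx). simpl in H. change (Cmod (f x - f s - (x - s) * l) <= e / 2 * Cmod (x - s)) in H.
      pose proof (Cminus_neq_0 _ _ Hxs) as N.
      replace ((f x - f s) / (x - s) - l)%C with ((f x - f s - (x - s) * l) / (x - s))%C
        by (field; auto).
      assert (0 < Cmod (x - s)) by (apply Cmod_pos; auto).
      rewrite Cmod_div by auto. apply Rmult_lt_reg_r with (Cmod (x - s)); [easy|].
      unfold Rdiv. rewrite Rmult_assoc, Rinv_l by lra. nra.
  - exists 1. split; [lra|]. intros x _.
    destruct (excluded_middle_informative (x = s)) as [->|Hxs]; [ring|].
    field. now apply Cminus_neq_0.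
Qed.

Definition cRder (g : R -> C) (s : R) (l : C) : Prop :=
  is_derive (fun x => Re (g x)) s (Re l) /\ is_derive (fun x => Im (g x)) s (Im l).

Lemma cRder_ext_loc (f g : R -> C) s l :
  locally s (fun x => f x = g x) -> cRder f s l -> cRder g s l.
Proof.
  intros H [A B]. split.
  - apply is_derive_ext_loc with (2 := A). revert H. apply filter_imp. now intros x ->.
  - apply is_derive_ext_loc with (2 := B). revert H. apply filter_imp. now intros x ->.
Qed.

Lemma cRder_ext (f g : R -> C) s l : (forall x, f x = g x) -> cRder f s l -> cRder g s l.
Proof. intros H. apply cRder_ext_loc. now exists (mkposreal _ Rlt_0_1). Qed.

Lemma cRder_const c s : cRder (fun _ => c) s 0.
Proof. split; apply @is_derive_const. Qed.

Lemma cRder_id s : cRder (fun x => RtoC x) s 1.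
Proof. split; simpl; [apply @is_derive_id | apply @is_derive_const]. Qed.

Lemma cRder_plus f g s l m :
  cRder f s l -> cRder g s m -> cRder (fun x => f x + g x)%C s (l + m).
Proof. intros [A B] [A' B']. split; simpl; now apply @is_derive_plus. Qed.

Lemma is_derive_Rmult (f g : R -> R) (x a b : R) :
  is_derive f x a -> is_derive g x b -> is_derive (fun x => f x * g x) x (a * g x + f x * b).
Proof. intros A B. apply (is_derive_mult f g x a b A B). intros n m. apply Rmult_comm. Qed.

Lemma cRder_mult f g s l m :
  cRder f s l -> cRder g s m -> cRder (fun x => f x * g x)%C s (l * g s + f s * m).
Proof.
  intros [A B] [A' B']. split; unfold Re, Im in *; simpl.
  - evar_last.
    + apply @is_derive_minus; apply is_derive_Rmult; eassumption.
    + unfold minus, plus, opp, mult; simpl. ring.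
  - evar_last.
    + apply @is_derive_plus; apply is_derive_Rmult; eassumption.
    + unfold plus, mult; simpl. ring.
Qed.

Lemma cRder_inv (f : R -> C) s l : f s <> RtoC 0 ->
  cRder f s l -> cRder (fun x => / f x)%C s (- l / (f s * f s)).
Proof.
  intros H [A B].
  replace (- l / (f s * f s))%C with (- l * (/ f s * / f s))%C by (field; auto).
  unfold Re, Im in *.
  assert (N : fst (f s) * fst (f s) + snd (f s) * snd (f s) <> 0).
  { intro E. apply H. destruct (f s) as [x y]; simpl in *. unfold RtoC. f_equal; nra. }
  assert (ND : is_derive (fun x => fst (f x) ^ 2 + snd (f x) ^ 2) s
     (2 * fst l * fst (f s) + 2 * snd l * snd (f s))).
  { apply is_derive_ext with (fun x => fst (f x) * fst (f x) + snd (f x) * snd (f x)).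
    { intros. simpl. ring. }
    evar_last.
    + apply @is_derive_plus; apply is_derive_Rmult; eassumption.
    + unfold plus, mult; simpl. ring. }
  split; unfold Re, Im, Cinv; simpl fst; simpl snd.
  - evar_last.
    + apply is_derive_div; [exact A | exact ND | simpl; lra].
    + simpl in *. destruct (f s) as [x y], l as [l1 l2]; simpl in *. field. lra.
  - evar_last.
    + apply is_derive_div; [apply @is_derive_opp; exact B | exact ND | simpl; lra].
    + unfold opp; simpl in *. destruct (f s) as [x y], l as [l1 l2]; simpl in *. field. lra.
Qed.

Lemma cRder_conj f s l : cRder f s l -> cRder (fun x => Cconj (f x)) s (Cconj l).
Proof. intros [A B]. split; simpl; [exact A | now apply @is_derive_opp]. Qed.

Definition Rcont (f : R -> C) (s : R) : Prop :=
  forall eps : R, 0 < eps -> exists d : R, 0 < d /\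
    forall x, Rabs (x - s) < d -> Cmod (f x - f s) < eps.

Lemma Cmod_le_Rabs (z : C) : Cmod z <= Rabs (Re z) + Rabs (Im z).
Proof.
  replace z with (RtoC (Re z) + Ci * RtoC (Im z))%C at 1.
  - eapply Rle_trans; [apply Cmod_triangle|]. rewrite Cmod_mult, Cmod_Ci, !Cmod_R. lra.
  - destruct z as [x y]. unfold RtoC, Ci, Cmult, Cplus, Re, Im; simpl. f_equal; ring.
Qed.

Lemma im_le_Cmod (z : C) : Rabs (Im z) <= Cmod z.
Proof.
  pose proof (re_le_Cmod (- Ci * z)%C). rewrite Cmod_mult, Cmod_opp, Cmod_Ci in H.
  replace (Re (- Ci * z)) with (Im z) in H; [lra|].
  unfold Re, Im, Ci; simpl. ring.
Qed.

Lemma is_derive_cont_eps (f : R -> R) s l : is_derive f s l -> forall e, 0 < e ->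
  exists d, 0 < d /\ forall x, Rabs (x - s) < d -> Rabs (f x - f s) < e.
Proof.
  intros H e He. assert (Hc : continuous f s) by (apply @ex_derive_continuous; now exists l).
  destruct (proj1 (filterlim_locally _ _) Hc (mkposreal e He)) as [d Hd].
  exists d. split; [apply cond_pos|]. intros x Hx. apply (Hd x Hx).
Qed.

Lemma cRder_Rcont f s l : cRder f s l -> Rcont f s.
Proof.
  intros [A B] e He.
  destruct (is_derive_cont_eps _ _ _ A (e / 2)) as [d [Hd H]]; [lra|].
  destruct (is_derive_cont_eps _ _ _ B (e / 2)) as [d' [Hd' H']]; [lra|].
  exists (Rmin d d'). split; [now apply Rmin_glb_lt|]. intros x Hx.
  pose proof (Rmin_l d d'). pose proof (Rmin_r d d').
  specialize (H x ltac:(lra)). specialize (H' x ltac:(lra)).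
  eapply Rle_lt_trans; [apply Cmod_le_Rabs|]. unfold Re, Im in *; simpl.
  unfold Rminus in *. lra.
Qed.

(** Mean value inequality for curves: with u = f b - f a, the real function |u| g - Re (conj u f) is
    nondecreasing, which gives |u|^2 <= |u| (g b - g a). Since u may vanish, g a <= g b needs a
    separate argument, g' being bounded below by a modulus. *)
Lemma cRder_norm_le (f : R -> C) (l : R -> C) (g g' : R -> R) (a b : R) : a <= b ->
  (forall s, a <= s <= b -> cRder f s (l s) /\ is_derive g s (g' s) /\ Cmod (l s) <= g' s) ->
  Cmod (f b - f a) <= g b - g a.
Proof.
  intros Hab H. set (u := (f b - f a)%C).
  set (h := fun s => Cmod u * g s - (Re u * Re (f s) + Im u * Im (f s))).
  set (h' := fun s => Cmod u * g' s - (Re u * Re (l s) + Im u * Im (l s))).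
  assert (Hh : forall s, a <= s <= b -> is_derive h s (h' s)).
  { intros s Hs. destruct (H s Hs) as [[A B] [G _]]. unfold h, h'.
    apply @is_derive_minus; [now apply is_derive_scal|].
    apply @is_derive_plus; now apply is_derive_scal. }
  assert (Hp : forall s, a <= s <= b -> 0 <= h' s).
  { intros s Hs. destruct (H s Hs) as [_ [_ L]]. unfold h'.
    pose proof (re_le_Cmod (Cconj u * l s)) as R1.
    rewrite Cmod_mult, Cmod_conj in R1.
    replace (Re (Cconj u * l s)) with (Re u * Re (l s) + Im u * Im (l s)) in R1
      by (unfold Re, Im, Cconj; simpl; ring).
    pose proof (Rle_abs (Re u * Re (l s) + Im u * Im (l s))).
    pose proof (Rmult_le_compat_l (Cmod u) _ _ (Cmod_ge_0 u) L). lra. }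
  destruct (MVT_gen h a b h') as [c [Hc E]].
  - rewrite Rmin_left, Rmax_right by easy. intros x Hx. apply Hh. lra.
  - rewrite Rmin_left, Rmax_right by easy. intros x Hx.
    apply derivable_continuous_pt. exists (h' x). apply is_derive_Reals. apply Hh. lra.
  - rewrite Rmin_left, Rmax_right in Hc by easy.
    assert (0 <= h b - h a) by (rewrite E; apply Rmult_le_pos; [now apply Hp | lra]).
    unfold h in H0.
    assert (Cmod u ^ 2 <= Cmod u * (g b - g a)).
    { rewrite Cmod2_alt.
      replace (Re u ^ 2 + Im u ^ 2) with (Re u * (Re (f b) - Re (f a)) + Im u * (Im (f b) - Im (f a))).
      - lra.
      - unfold u, Re, Im; simpl. ring. }
    assert (0 <= g b - g a \/ g b - g a < 0) as [P|P] by lra.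
    + pose proof (Cmod_ge_0 u). nra.
    + exfalso. assert (0 <= g b - g a); [|lra].
      destruct (MVT_gen g a b g') as [c' [Hc' E']].
      * rewrite Rmin_left, Rmax_right by easy. intros x Hx. apply H. lra.
      * rewrite Rmin_left, Rmax_right by easy. intros x Hx.
        apply derivable_continuous_pt. exists (g' x). apply is_derive_Reals. apply H. lra.
      * rewrite Rmin_left, Rmax_right in Hc' by easy. rewrite E'.
        apply Rmult_le_pos; [|lra]. destruct (H c' Hc') as [_ [_ L]].
        pose proof (Cmod_ge_0 (l c')). lra.
Qed.

(* Differentiability with derivative l in the sense of real directional
   derivatives along all lines through t: all that the differential equations need. *)
Definition lder (f : C -> C) (t l : C) : Prop :=
  forall (t0 d : C) (s : R), t = (t0 + s * d)%C -> cRder (fun x : R => f (t0 + x * d)%C) s (d * l)%C.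

Lemma near_line (P : C -> Prop) (t0 d : C) (s : R) :
  near (t0 + s * d)%C P -> locally s (fun x => P (t0 + x * d)%C).
Proof.
  intros [r [Hr H]]. pose proof (Cmod_ge_0 d).
  assert (He : 0 < r / (Cmod d + 1)) by (apply Rdiv_lt_0_compat; lra).
  exists (mkposreal _ He). intros x Hx. apply H.
  replace (t0 + x * d - (t0 + s * d))%C with (RtoC (x - s) * d)%C
    by (rewrite RtoC_minus; ring).
  rewrite Cmod_mult, Cmod_R. change (Rabs (x - s) < r / (Cmod d + 1)) in Hx.
  assert (r / (Cmod d + 1) * (Cmod d + 1) = r) by (field; lra).
  pose proof (Rabs_pos (x - s)). nra.
Qed.

Lemma lder_ext_near f g t l : near t (fun x => f x = g x) -> lder f t l -> lder g t l.
Proof.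
  intros H F t0 d s E. apply cRder_ext_loc with (2 := F t0 d s E).
  apply (near_line (fun x => f x = g x)). now rewrite <- E.
Qed.

Lemma lder_ext f g t l : (forall x, f x = g x) -> lder f t l -> lder g t l.
Proof. intros H. apply lder_ext_near. exists 1. split; [lra|auto]. Qed.

Lemma lder_eq f t l m : lder f t l -> l = m -> lder f t m.
Proof. now intros H <-. Qed.

Lemma cRder_eq f t l m : cRder f t l -> l = m -> cRder f t m.
Proof. now intros H <-. Qed.

Lemma lder_const c t : lder (fun _ => c) t 0.
Proof. intros t0 d s E. apply cRder_eq with (RtoC 0); [apply cRder_const | ring]. Qed.

Lemma lder_id t : lder (fun x => x) t 1.
Proof.
  intros t0 d s E. eapply cRder_eq.
  - apply (cRder_plus (fun _ => t0) (fun x => RtoC x * d)%C); [apply cRder_const|].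
    apply (cRder_mult RtoC (fun _ => d)); [apply cRder_id | apply cRder_const].
  - simpl. ring.
Qed.

Lemma lder_plus f g t l m :
  lder f t l -> lder g t m -> lder (fun x => f x + g x)%C t (l + m).
Proof.
  intros F G t0 d s E. eapply cRder_eq; [apply cRder_plus; eauto | ring].
Qed.

Lemma lder_mult f g t l m :
  lder f t l -> lder g t m -> lder (fun x => f x * g x)%C t (l * g t + f t * m).
Proof.
  intros F G t0 d s E.
  eapply cRder_eq; [apply (cRder_mult _ _ _ _ _ (F t0 d s E) (G t0 d s E)) | subst; ring].
Qed.

Lemma lder_opp f t l : lder f t l -> lder (fun x => - f x)%C t (- l).
Proof.
  intros F. apply lder_ext with (fun x => (- (1)) * f x)%C; [intros; ring|].
  eapply lder_eq; [apply (lder_mult (fun _ => - (1))%C f); [apply lder_const | exact F] | simpl; ring].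
Qed.

Lemma lder_minus f g t l m :
  lder f t l -> lder g t m -> lder (fun x => f x - g x)%C t (l - m).
Proof. intros F G. apply lder_plus; [easy | now apply lder_opp]. Qed.

Lemma lder_inv (f : C -> C) t l : f t <> RtoC 0 ->
  lder f t l -> lder (fun x => / f x)%C t (- l / (f t * f t)).
Proof.
  intros N F t0 d s E. subst t.
  eapply cRder_eq; [apply (cRder_inv _ _ _ N (F t0 d s eq_refl)) | now field].
Qed.

Lemma lder_div (f g : C -> C) t l m : g t <> RtoC 0 ->
  lder f t l -> lder g t m -> lder (fun x => f x / g x)%C t ((l * g t - f t * m) / (g t * g t)).
Proof.
  intros N F G. eapply lder_eq; [apply (lder_mult f (fun x => / g x)%C); [exact F | apply lder_inv; eauto] | simpl; now field].
Qed.

(** Conjugating both the argument and the value restores complex linearity. In terms of lines, t0 +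
    x d is sent to - conj t0 + x (- conj d), so the directional definition transfers line by
    line. *)
Lemma lder_reflect f t l :
  lder f (- Cconj t) l -> lder (fun x => Cconj (f (- Cconj x)%C)) t (- Cconj l).
Proof.
  intros F t0 d s E.
  assert (Ec : (- Cconj t)%C = (- Cconj t0 + s * (- Cconj d))%C).
  { subst t. rewrite Cplus_conj, Cmult_conj.
    replace (Cconj (RtoC s)) with (RtoC s); [ring|].
    unfold Cconj, RtoC; simpl. now rewrite Ropp_0. }
  apply cRder_ext with (fun x : R => Cconj (f (- Cconj t0 + x * (- Cconj d))%C)).
  - intros x. do 2 f_equal. rewrite Cplus_conj, Cmult_conj.
    replace (Cconj (RtoC x)) with (RtoC x); [ring|].
    unfold Cconj, RtoC; simpl. now rewrite Ropp_0.
  - eapply cRder_eq; [apply cRder_conj, (F _ _ _ Ec)|].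
    rewrite Cmult_conj, Copp_conj, Cconj_conj. ring.
Qed.

Lemma is_derive_caratheodory (f psi : R -> R) (s : R) :
  continuous psi s -> locally s (fun x => f x = f s + psi x * (x - s)) ->
  is_derive f s (psi s).
Proof.
  intros Hc Hl. apply is_derive_Reals. intros e He.
  destruct (proj1 (filterlim_locally _ _) Hc (mkposreal e He)) as [d Hd].
  destruct Hl as [d' Hd'].
  assert (Hm : 0 < Rmin d d') by (apply Rmin_glb_lt; apply cond_pos).
  exists (mkposreal _ Hm). intros h Hh Hhd. simpl in Hhd.
  pose proof (Rmin_l d d'). pose proof (Rmin_r d d').
  rewrite (Hd' (s + h)).
  - replace ((f s + psi (s + h) * (s + h - s) - f s) / h - psi s) with (psi (s + h) - psi s)
      by (field; auto).
    apply (Hd (s + h)). change (Rabs (s + h - s) < d). replace (s + h - s) with h by ring. lra.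
  - change (Rabs (s + h - s) < d'). replace (s + h - s) with h by ring. lra.
Qed.

Lemma ccont_line phi (t0 d : C) (s : R) : ccont phi (t0 + s * d)%C ->
  continuous (fun x : R => Re (phi (t0 + x * d)%C)) s /\
  continuous (fun x : R => Im (phi (t0 + x * d)%C)) s.
Proof.
  intros H. assert (K : forall e, 0 < e -> locally s (fun x : R =>
    Cmod (phi (t0 + x * d)%C - phi (t0 + s * d)%C) < e)).
  { intros e He. apply (near_line (fun z => Cmod (phi z - phi (t0 + s * d)%C) < e)).
    destruct (H e He) as [r [Hr G]]. now exists r. }
  split; apply filterlim_locally; intros e; specialize (K e (cond_pos e)); revert K;
    apply filter_imp; intros x Hx.
  - eapply Rle_lt_trans; [|exact Hx].
    apply (re_le_Cmod (phi (t0 + x * d) - phi (t0 + s * d))%C).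
  - eapply Rle_lt_trans; [|exact Hx].
    apply (im_le_Cmod (phi (t0 + x * d) - phi (t0 + s * d))%C).
Qed.

Lemma cder_lder f t l : cder f t l -> lder f t l.
Proof.
  intros [phi [E [Hc Hn]]] t0 d s Et. subst t l.
  destruct (ccont_line _ _ _ _ Hc) as [HR HI].
  apply near_line in Hn.
  assert (HR' : continuous (fun x : R => Re (d * phi (t0 + x * d)%C)) s).
  { apply continuous_ext with (fun x : R => minus (mult (Re d) (Re (phi (t0 + x * d)%C)))
        (mult (Im d) (Im (phi (t0 + x * d)%C)))).
    { intros. reflexivity. }
    apply @continuous_minus; apply @continuous_mult; auto; apply continuous_const. }
  assert (HI' : continuous (fun x : R => Im (d * phi (t0 + x * d)%C)) s).
  { apply continuous_ext with (fun x : R => plus (mult (Re d) (Im (phi (t0 + x * d)%C)))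
        (mult (Im d) (Re (phi (t0 + x * d)%C)))).
    { intros. reflexivity. }
    apply @continuous_plus; apply @continuous_mult; auto; apply continuous_const. }
  split.
  - apply (is_derive_caratheodory _ (fun x : R => Re (d * phi (t0 + x * d)%C))); [easy|].
    revert Hn. apply filter_imp. intros x Hx. rewrite Hx. unfold Re, Im; simpl. ring.
  - apply (is_derive_caratheodory _ (fun x : R => Im (d * phi (t0 + x * d)%C))); [easy|].
    revert Hn. apply filter_imp. intros x Hx. rewrite Hx. unfold Re, Im; simpl. ring.
Qed.

(** * Goursat's theorem for squares *)

Definition cint (g : R -> C) (a b : R) : Prop :=
  ex_RInt (fun x => Re (g x)) a b /\ ex_RInt (fun x => Im (g x)) a b.

Definition CInt (g : R -> C) (a b : R) : C :=
  (RInt (fun x => Re (g x)) a b, RInt (fun x => Im (g x)) a b).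

Lemma cint_Rcont (g : R -> C) a b :
  (forall x, Rmin a b <= x <= Rmax a b -> Rcont g x) -> cint g a b.
Proof.
  intros H. split; apply @ex_RInt_continuous; intros x Hx; apply filterlim_locally; intros e;
    destruct (H x Hx e (cond_pos e)) as [d [Hd G]]; exists (mkposreal d Hd); intros y Hy;
    (eapply Rle_lt_trans; [|apply (G y Hy)]).
  - apply (re_le_Cmod (g y - g x)%C).
  - apply (im_le_Cmod (g y - g x)%C).
Qed.

Lemma cint_plus f g a b : cint f a b -> cint g a b -> cint (fun x => f x + g x)%C a b.
Proof. intros [A B] [A' B']. split; simpl; now apply @ex_RInt_plus. Qed.

Lemma CInt_plus f g a b : cint f a b -> cint g a b ->
  CInt (fun x => f x + g x)%C a b = (CInt f a b + CInt g a b)%C.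
Proof.
  intros [A B] [A' B']. unfold CInt, Cplus; simpl. f_equal; now apply @RInt_plus.
Qed.

Lemma CInt_scal c f a b : cint f a b -> CInt (fun x => c * f x)%C a b = (c * CInt f a b)%C.
Proof.
  intros [A B]. unfold CInt, Cmult, Re, Im in *; simpl. f_equal.
  - rewrite <- !(RInt_scal (V := R_CompleteNormedModule)) by easy.
    apply @RInt_minus; now apply @ex_RInt_scal.
  - rewrite <- !(RInt_scal (V := R_CompleteNormedModule)) by easy.
    apply @RInt_plus; now apply @ex_RInt_scal.
Qed.

Lemma CInt_ext f g a b : (forall x, Rmin a b <= x <= Rmax a b -> f x = g x) -> CInt f a b = CInt g a b.
Proof.
  intros H. unfold CInt. f_equal; apply RInt_ext; intros x Hx; rewrite H; auto; lra.
Qed.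

Lemma CInt_Chasles f a b c : cint f a b -> cint f b c ->
  (CInt f a b + CInt f b c)%C = CInt f a c.
Proof.
  intros [A B] [A' B']. unfold CInt, Cplus; simpl. f_equal; now apply @RInt_Chasles.
Qed.

Lemma CInt_const c a b : CInt (fun _ => c) a b = (RtoC (b - a) * c)%C.
Proof.
  unfold CInt. rewrite !RInt_const. unfold Cmult, RtoC, Re, Im, scal; simpl.
  unfold mult; simpl. f_equal; ring.
Qed.

(** The factor 2 comes from |z| <= |Re z| + |Im z| applied to componentwise integrals; no later
    estimate depends on the sharp constant. *)
Lemma CInt_bound f a b M : a <= b -> cint f a b ->
  (forall x, a <= x <= b -> Cmod (f x) <= M) -> Cmod (CInt f a b) <= 2 * (b - a) * M.
Proof.
  intros Hab [A B] H. eapply Rle_trans; [apply Cmod_le_Rabs|].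
  unfold CInt, Re, Im; simpl.
  assert (H1 : Rabs (RInt (fun x => fst (f x)) a b) <= (b - a) * M).
  { apply abs_RInt_le_const; auto. intros x Hx. eapply Rle_trans; [apply (re_le_Cmod (f x)) | auto]. }
  assert (H2 : Rabs (RInt (fun x => snd (f x)) a b) <= (b - a) * M).
  { apply abs_RInt_le_const; auto. intros x Hx. eapply Rle_trans; [apply (im_le_Cmod (f x)) | auto]. }
  lra.
Qed.

(** Counterclockwise boundary integral, with opposite sides merged into one integrand and dz = i dy
    on the vertical ones. *)
Definition rect_int (f : C -> C) (a b c d : R) : C :=
  (CInt (fun x => f (x, c) - f (x, d)) a b + Ci * CInt (fun y => f (b, y) - f (a, y)) c d)%C.

Definition in_rect (a b c d : R) (z : C) : Prop := a <= Re z <= b /\ c <= Im z <= d.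

Lemma ccont_Rcont_h f (x y : R) : ccont f (x, y) -> Rcont (fun x => f (x, y)) x.
Proof.
  intros H e He. destruct (H e He) as [d [Hd G]]. exists d. split; [easy|].
  intros x' Hx. apply G. replace (Cminus (x', y) (x, y)) with (RtoC (x' - x)).
  - now rewrite Cmod_R.
  - unfold RtoC, Cminus, Cplus, Copp; simpl. f_equal; ring.
Qed.

Lemma ccont_Rcont_v f (x y : R) : ccont f (x, y) -> Rcont (fun y => f (x, y)) y.
Proof.
  intros H e He. destruct (H e He) as [d [Hd G]]. exists d. split; [easy|].
  intros x' Hx. apply G. replace (Cminus (x, x') (x, y)) with (Ci * RtoC (x' - y))%C.
  - now rewrite Cmod_mult, Cmod_Ci, Cmod_R, Rmult_1_l.
  - unfold RtoC, Cminus, Cplus, Copp, Cmult, Ci; simpl. f_equal; ring.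
Qed.

Lemma cint_h f a b c d x1 x2 y : (forall z, in_rect a b c d z -> ccont f z) ->
  a <= x1 <= b -> a <= x2 <= b -> c <= y <= d -> cint (fun x => f (x, y)) x1 x2.
Proof.
  intros H H1 H2 Hy. apply cint_Rcont. intros x Hx. apply ccont_Rcont_h, H.
  assert (a <= Rmin x1 x2) by (apply Rmin_glb; lra).
  assert (Rmax x1 x2 <= b) by (apply Rmax_lub; lra).
  split; simpl; lra.
Qed.

Lemma cint_v f a b c d x y1 y2 : (forall z, in_rect a b c d z -> ccont f z) ->
  a <= x <= b -> c <= y1 <= d -> c <= y2 <= d -> cint (fun y => f (x, y)) y1 y2.
Proof.
  intros H H1 H2 Hy. apply cint_Rcont. intros y Hx. apply ccont_Rcont_v, H.
  assert (c <= Rmin y1 y2) by (apply Rmin_glb; lra).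
  assert (Rmax y1 y2 <= d) by (apply Rmax_lub; lra).
  split; simpl; lra.
Qed.

Definition on_sides (a b c d : R) (z : C) : Prop :=
  in_rect a b c d z /\ (Re z = a \/ Re z = b \/ Im z = c \/ Im z = d).

Lemma cint_side_h f a b c d y : a <= b -> c <= d -> (forall z, on_sides a b c d z -> ccont f z) ->
  y = c \/ y = d -> cint (fun x => f (x, y)) a b.
Proof.
  intros Ha Hc H Hy. apply cint_Rcont. intros x Hx. rewrite Rmin_left, Rmax_right in Hx by easy.
  apply ccont_Rcont_h, H. unfold on_sides, in_rect; simpl. lra.
Qed.

Lemma cint_side_v f a b c d x : a <= b -> c <= d -> (forall z, on_sides a b c d z -> ccont f z) ->
  x = a \/ x = b -> cint (fun y => f (x, y)) c d.
Proof.
  intros Ha Hc H Hy. apply cint_Rcont. intros y Hx. rewrite Rmin_left, Rmax_right in Hx by easy.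
  apply ccont_Rcont_v, H. unfold on_sides, in_rect; simpl. lra.
Qed.

Lemma cint_minus f g a b : cint f a b -> cint g a b -> cint (fun x => f x - g x)%C a b.
Proof.
  intros H K. apply (cint_plus f (fun x => - g x)%C); [easy|].
  destruct K as [A B]. split; simpl; now apply @ex_RInt_opp.
Qed.

Lemma rect_int_split_x f a m b c d : (forall z, in_rect a b c d z -> ccont f z) ->
  a <= m <= b -> c <= d -> rect_int f a b c d = (rect_int f a m c d + rect_int f m b c d)%C.
Proof.
  intros H Hm Hc. unfold rect_int.
  rewrite <- (CInt_Chasles _ a m b).
  - rewrite (CInt_ext (fun y => f (b, y) - f (a, y))%C
      (fun y => (f (b, y) - f (m, y)) + (f (m, y) - f (a, y)))%C) by (intros; ring).
    rewrite CInt_plus; [ring | |]; apply cint_minus; apply (cint_v f a b c d); auto; lra.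
  - apply cint_minus; apply (cint_h f a b c d); auto; lra.
  - apply cint_minus; apply (cint_h f a b c d); auto; lra.
Qed.

Lemma rect_int_split_y f a b c m d : (forall z, in_rect a b c d z -> ccont f z) ->
  a <= b -> c <= m <= d -> rect_int f a b c d = (rect_int f a b c m + rect_int f a b m d)%C.
Proof.
  intros H Ha Hm. unfold rect_int.
  rewrite <- (CInt_Chasles _ c m d).
  - rewrite (CInt_ext (fun x => f (x, c) - f (x, d))%C
      (fun x => (f (x, c) - f (x, m)) + (f (x, m) - f (x, d)))%C) by (intros; ring).
    rewrite CInt_plus; [ring | |]; apply cint_minus; apply (cint_h f a b c d); auto; lra.
  - apply cint_minus; apply (cint_v f a b c d); auto; lra.
  - apply cint_minus; apply (cint_v f a b c d); auto; lra.
Qed.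

Lemma rect_int_plus f g a b c d : a <= b -> c <= d ->
  (forall z, on_sides a b c d z -> ccont f z) -> (forall z, on_sides a b c d z -> ccont g z) ->
  rect_int (fun z => f z + g z)%C a b c d = (rect_int f a b c d + rect_int g a b c d)%C.
Proof.
  intros Ha Hc Hf Hg. unfold rect_int.
  rewrite (CInt_ext (fun y => f (b, y) + g (b, y) - (f (a, y) + g (a, y)))%C
      (fun y => (f (b, y) - f (a, y)) + (g (b, y) - g (a, y)))%C) by (intros; ring).
  rewrite (CInt_ext (fun x => f (x, c) + g (x, c) - (f (x, d) + g (x, d)))%C
      (fun x => (f (x, c) - f (x, d)) + (g (x, c) - g (x, d)))%C) by (intros; ring).
  rewrite (CInt_plus (fun y => f (b, y) - f (a, y))%C (fun y => g (b, y) - g (a, y))%C),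
    (CInt_plus (fun x => f (x, c) - f (x, d))%C (fun x => g (x, c) - g (x, d))%C); [ring | | | |];
    apply cint_minus.
  - apply (cint_side_h f a b c d); auto.
  - apply (cint_side_h f a b c d); auto.
  - apply (cint_side_h g a b c d); auto.
  - apply (cint_side_h g a b c d); auto.
  - apply (cint_side_v f a b c d); auto.
  - apply (cint_side_v f a b c d); auto.
  - apply (cint_side_v g a b c d); auto.
  - apply (cint_side_v g a b c d); auto.
Qed.

Lemma rect_int_affine (u l s : C) a b c d :
  rect_int (fun z => u + l * (z - s))%C a b c d = RtoC 0.
Proof.
  unfold rect_int.
  rewrite (CInt_ext _ (fun _ => l * Ci * RtoC (c - d))%C).
  2:{ intros. unfold Cminus, Cmult, Copp, RtoC, Ci; unfold Cplus; simpl. f_equal; ring. }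
  rewrite (CInt_ext (fun y : R => u + l * ((b, y) - s) - (u + l * ((a, y) - s)))%C
    (fun _ => l * RtoC (b - a))%C).
  2:{ intros. unfold Cminus, Cmult, Copp, RtoC, Ci; unfold Cplus; simpl. f_equal; ring. }
  rewrite !CInt_const. rewrite !RtoC_minus. ring.
Qed.

Lemma rect_int_bound f a b c d M : a <= b -> c <= d ->
  (forall z, on_sides a b c d z -> ccont f z) ->
  (forall z, on_sides a b c d z -> Cmod (f z) <= M) ->
  Cmod (rect_int f a b c d) <= 4 * ((b - a) + (d - c)) * M.
Proof.
  intros Ha Hc Hf HM. unfold rect_int.
  eapply Rle_trans; [apply Cmod_triangle|]. rewrite Cmod_mult, Cmod_Ci.
  assert (H1 : Cmod (CInt (fun x => f (x, c) - f (x, d))%C a b) <= 2 * (b - a) * (2 * M)).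
  { apply CInt_bound; auto.
    - apply cint_minus; apply (cint_side_h f a b c d); auto.
    - intros x Hx. unfold Cminus. eapply Rle_trans; [apply Cmod_triangle|]. rewrite Cmod_opp.
      assert (Cmod (f (x, c)) <= M) by (apply HM; unfold on_sides, in_rect; simpl; lra).
      assert (Cmod (f (x, d)) <= M) by (apply HM; unfold on_sides, in_rect; simpl; lra). lra. }
  assert (H2 : Cmod (CInt (fun y => f (b, y) - f (a, y))%C c d) <= 2 * (d - c) * (2 * M)).
  { apply CInt_bound; auto.
    - apply cint_minus; apply (cint_side_v f a b c d); auto.
    - intros x Hx. unfold Cminus. eapply Rle_trans; [apply Cmod_triangle|]. rewrite Cmod_opp.
      assert (Cmod (f (b, x)) <= M) by (apply HM; unfold on_sides, in_rect; simpl; lra).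
      assert (Cmod (f (a, x)) <= M) by (apply HM; unfold on_sides, in_rect; simpl; lra). lra. }
  lra.
Qed.

Lemma nested_intervals (a h : nat -> R) :
  (forall n, a n <= a (S n)) -> (forall n, a (S n) + h (S n) <= a n + h n) ->
  (forall n, 0 <= h n) -> exists x, forall n, a n <= x <= a n + h n.
Proof.
  intros Ha Hb Hh.
  assert (Am : forall n k, a n <= a (n + k)%nat).
  { intros n k. induction k; [rewrite Nat.add_0_r; lra|].
    rewrite Nat.add_succ_r. specialize (Ha (n + k)%nat). lra. }
  assert (Bm : forall n k, a (n + k)%nat + h (n + k)%nat <= a n + h n).
  { intros n k. induction k; [rewrite Nat.add_0_r; lra|].
    rewrite Nat.add_succ_r. specialize (Hb (n + k)%nat). lra. }
  assert (AB : forall n m, a m <= a n + h n).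
  { intros n m. destruct (Nat.le_ge_cases n m) as [L|L].
    - replace m with (n + (m - n))%nat by lia.
      specialize (Bm n (m - n)%nat). specialize (Hh (n + (m - n))%nat). lra.
    - replace n with (m + (n - m))%nat by lia.
      specialize (Am m (n - m)%nat). specialize (Hh (m + (n - m))%nat). lra. }
  destruct (completeness (fun x => exists n, x = a n)) as [x [U L]].
  - exists (a 0%nat + h 0%nat). intros y [n ->]. apply AB.
  - exists (a 0%nat), 0%nat. reflexivity.
  - exists x. intros n. split; [apply U; now exists n|]. apply L. intros y [m ->]. apply AB.
Qed.

Lemma in_rect_sub a b c d a' b' c' d' z : a <= a' -> b' <= b -> c <= c' -> d' <= d ->
  in_rect a' b' c' d' z -> in_rect a b c d z.
Proof. unfold in_rect. lra. Qed.

Lemma rect_int_quarters f a c h : 0 < h ->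
  (forall z, in_rect a (a + h) c (c + h) z -> ccont f z) ->
  rect_int f a (a + h) c (c + h) =
  (rect_int f a (a + h / 2) c (c + h / 2) + rect_int f a (a + h / 2) (c + h / 2) (c + h / 2 + h / 2)
   + (rect_int f (a + h / 2) (a + h / 2 + h / 2) c (c + h / 2)
      + rect_int f (a + h / 2) (a + h / 2 + h / 2) (c + h / 2) (c + h / 2 + h / 2)))%C.
Proof.
  intros Hh Hc. replace (a + h / 2 + h / 2) with (a + h) by lra.
  replace (c + h / 2 + h / 2) with (c + h) by lra.
  rewrite (rect_int_split_x f a (a + h / 2)) by (auto; lra).
  f_equal; apply rect_int_split_y; try lra; intros z Hz; apply Hc; revert Hz;
    apply in_rect_sub; lra.
Qed.

Lemma cder_affine_bound f s l e : cder f s l -> 0 < e ->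
  near s (fun z => Cmod (f z - (f s + l * (z - s)))%C <= e * Cmod (z - s)%C).
Proof.
  intros [phi [E [Hc Hn]]] He. destruct (Hc e He) as [d [Hd H]].
  assert (H' : near s (fun z => Cmod (phi z - phi s) < e)) by (now exists d).
  generalize (near_and _ _ _ Hn H'). apply near_mono. intros z [-> Hz].
  rewrite <- E. replace (f s + phi z * (z - s) - (f s + phi s * (z - s)))%C
    with ((phi z - phi s) * (z - s))%C by ring.
  rewrite Cmod_mult. apply Rmult_le_compat_r; [apply Cmod_ge_0 | lra].
Qed.

Lemma in_rect_dist a c h z s : 0 <= h ->
  in_rect a (a + h) c (c + h) z -> in_rect a (a + h) c (c + h) s -> Cmod (z - s) <= 2 * h.
Proof.
  intros Hh [A B] [A' B']. eapply Rle_trans; [apply Cmod_le_Rabs|].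
  unfold Re, Im in *; simpl.
  assert (Rabs (fst z + - fst s) <= h) by (apply Rabs_le; lra).
  assert (Rabs (snd z + - snd s) <= h) by (apply Rabs_le; lra). lra.
Qed.

Lemma pow_half_small (h r : R) : 0 < h -> 0 < r -> exists n, h / 2 ^ n < r.
Proof.
  intros Hh Hr. destruct (pow_lt_1_zero (1 / 2)) with (y := r / h) as [n Hn].
  - rewrite Rabs_right; lra.
  - now apply Rdiv_lt_0_compat.
  - exists n. specialize (Hn n (Nat.le_refl n)).
    rewrite Rabs_right in Hn by (apply Rle_ge, pow_le; lra).
    unfold Rdiv in Hn at 1. rewrite Rmult_1_l, pow_inv in Hn.
    apply Rmult_lt_compat_r with (r := h) in Hn; [|easy].
    replace (r / h * h) with r in Hn by (field; lra).
    unfold Rdiv. lra.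
Qed.

(** Repeated quartering: a nonzero integral would persist, relative to the area, in a nested
    sequence of squares, whereas near the limit point f is affine up to o(|z - s|) and affine
    functions integrate to zero. *)
Lemma goursat_square f a c h : 0 < h ->
  (forall z, in_rect a (a + h) c (c + h) z -> exists l, cder f z l) ->
  rect_int f a (a + h) c (c + h) = RtoC 0.
Proof.
  intros Hh Hf.
  assert (Hc : forall z, in_rect a (a + h) c (c + h) z -> ccont f z).
  { intros z Hz. destruct (Hf z Hz) as [l Hl]. eapply cder_ccont; eauto. }
  apply Cmod_eq_0. apply Rle_antisym; [|apply Cmod_ge_0].
  apply Rnot_lt_le. intros Hpos.
  set (J := fun p h => Cmod (rect_int f (fst p) (fst p + h) (snd p) (snd p + h))).
  (* Half of the initial ratio of integral to squared side, so that the invariant [e * k ^ 2 < J] is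
     strict from the start. *)
  set (e := Cmod (rect_int f a (a + h) c (c + h)) / h ^ 2 / 2).
  assert (He : 0 < e).
  { unfold e. repeat apply Rdiv_lt_0_compat; try lra. now apply pow_lt. }
  (* The last quarter is the default: when the first three integrals are at most e k^2, the fourth
     must exceed it, the four moduli summing to more than 4 e k^2. *)
  set (next := fun (p : R * R) (k : R) =>
    if Rlt_dec (e * k ^ 2) (J (fst p, snd p) k) then p
    else if Rlt_dec (e * k ^ 2) (J (fst p, snd p + k) k) then (fst p, snd p + k)
    else if Rlt_dec (e * k ^ 2) (J (fst p + k, snd p) k) then (fst p + k, snd p)
    else (fst p + k, snd p + k)).
  set (sq := fix sq n := match n with O => (a, c) | S n => next (sq n) (h / 2 ^ (S n)) end).
  set (hn := fun n => h / 2 ^ n).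
  assert (Hhn : forall n, 0 < hn n) by (intros n; apply Rdiv_lt_0_compat; [lra | apply pow_lt; lra]).
  assert (Hh2 : forall n, hn (S n) = hn n / 2).
  { intros n. unfold hn. simpl. field. apply pow_nonzero. lra. }
  assert (Hnext : forall p k, 0 < k ->
    (fst p <= fst (next p k) <= fst p + k) /\ (snd p <= snd (next p k) <= snd p + k)).
  { intros p k Hk. unfold next.
    repeat destruct (Rlt_dec _ _); simpl; lra. }
  assert (Esq : forall n, sq (S n) = next (sq n) (hn (S n))) by reflexivity.
  assert (Hin : forall n, a <= fst (sq n) /\ fst (sq n) + hn n <= a + h /\
                          c <= snd (sq n) /\ snd (sq n) + hn n <= c + h).
  { induction n.
    - unfold hn. simpl. lra.
    - rewrite Esq. destruct (Hnext (sq n) (hn (S n)) (Hhn _)) as [A B].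
      rewrite !Hh2 in *. pose proof (Hhn n). lra. }
  assert (Hbad : forall n, e * hn n ^ 2 < J (sq n) (hn n)).
  { induction n.
    - unfold J, hn, e. simpl fst. simpl snd. simpl pow.
      replace (h / 1) with h by field.
      assert (0 < h * h) by nra.
      set (m := Cmod _) in *. replace (m / (h * (h * 1)) / 2 * (h * (h * 1))) with (m / 2) by (field; lra).
      lra.
    - rewrite Esq. set (p := sq n) in *. set (k := hn (S n)).
      assert (Ek : hn n = k + k) by (unfold k; rewrite Hh2; lra).
      assert (Hk : 0 < k) by apply Hhn.
      destruct (Hin n) as [I1 [I2 [I3 I4]]]. fold p in I1, I2, I3, I4.
      assert (Q : J p (hn n) <= J p k + J (fst p, snd p + k) k + (J (fst p + k, snd p) k
                                + J (fst p + k, snd p + k) k)).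
      { unfold J; simpl fst; simpl snd. rewrite (rect_int_quarters f _ _ (hn n)).
        - replace (hn n / 2) with k by lra.
          eapply Rle_trans; [apply Cmod_triangle|].
          apply Rplus_le_compat; apply Cmod_triangle.
        - apply Hhn.
        - intros z Hz. apply Hc. revert Hz. apply in_rect_sub; lra. }
      rewrite Ek in IHn, Q.
      assert (P : p = (fst p, snd p)) by now destruct p.
      unfold next. rewrite <- P.
      repeat (destruct (Rlt_dec _ _); [assumption|]).
      lra. }
  destruct (nested_intervals (fun n => fst (sq n)) hn) as [x Hx].
  { intros n. rewrite Esq. destruct (Hnext (sq n) (hn (S n)) (Hhn _)); lra. }
  { intros n. rewrite Esq. destruct (Hnext (sq n) (hn (S n)) (Hhn _)). rewrite !Hh2 in *. lra. }
  { intros n. left. apply Hhn. }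
  destruct (nested_intervals (fun n => snd (sq n)) hn) as [y Hy].
  { intros n. rewrite Esq. destruct (Hnext (sq n) (hn (S n)) (Hhn _)); lra. }
  { intros n. rewrite Esq. destruct (Hnext (sq n) (hn (S n)) (Hhn _)). rewrite !Hh2 in *. lra. }
  { intros n. left. apply Hhn. }
  set (s := (x, y) : C).
  destruct (Hf s) as [l Hl].
  { specialize (Hx 0%nat). specialize (Hy 0%nat). unfold hn in *. simpl in *.
    split; simpl; lra. }
  (* With slope error e / 32 and points within 2 k of s, the perimeter bound is 8 k (e / 32) (2 k) =
     e k^2 / 2, which contradicts the invariant. *)
  destruct (cder_affine_bound f s l (e / 32) Hl) as [r [Hr Hb]]; [lra|].
  destruct (pow_half_small h (r / 2)) as [n Hn]; [lra|lra|]. fold (hn n) in Hn.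
  specialize (Hbad n). specialize (Hx n). specialize (Hy n). specialize (Hin n). specialize (Hhn n).
  unfold J in Hbad. set (p := sq n) in *. set (k := hn n) in *.
  assert (Hs : in_rect (fst p) (fst p + k) (snd p) (snd p + k) s) by (split; simpl; lra).
  set (g := fun z => (f z + ((- f s) + (- l) * (z - s)))%C).
  assert (Hca : forall u m z, ccont (fun z => u + m * (z - s))%C z).
  { intros u m z. apply ccont_plus; [apply ccont_const|]. apply ccont_mult; [apply ccont_const|].
    apply (ccont_plus (fun x => x) (fun _ => - s)%C); [apply ccont_id | apply ccont_const]. }
  assert (Hcf : forall z, in_rect (fst p) (fst p + k) (snd p) (snd p + k) z -> ccont f z).
  { intros z Hz. apply Hc. revert Hz. apply in_rect_sub; lra. }
  assert (Eg : rect_int g (fst p) (fst p + k) (snd p) (snd p + k)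
               = rect_int f (fst p) (fst p + k) (snd p) (snd p + k)).
  { unfold g. rewrite rect_int_plus; try lra; auto; [|intros z [Hz _]; auto]. rewrite rect_int_affine. ring. }
  rewrite <- Eg in Hbad.
  assert (B : Cmod (rect_int g (fst p) (fst p + k) (snd p) (snd p + k))
      <= 4 * ((fst p + k - fst p) + (snd p + k - snd p)) * (e / 32 * (2 * k))).
  { apply rect_int_bound; try lra.
    - intros z [Hz _]. unfold g. apply ccont_plus; auto.
    - intros z [Hz _]. pose proof (in_rect_dist _ _ _ _ _ (Rlt_le _ _ Hhn) Hz Hs) as D.
      unfold g. replace (f z + (- f s + - l * (z - s)))%C with (f z - (f s + l * (z - s)))%C by ring.
      eapply Rle_trans; [apply Hb; lra|]. apply Rmult_le_compat_l; lra. }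
  nra.
Qed.

(** * The identity theorem *)

Lemma goursat_square_bounds f a b c d : a < b -> d - c = b - a ->
  (forall z, in_rect a b c d z -> exists l, cder f z l) -> rect_int f a b c d = RtoC 0.
Proof.
  intros Hab E H. replace b with (a + (b - a)) in * by ring.
  replace d with (c + (b - a)) in * by lra.
  replace (a + (b - a) - a) with (b - a) in * by ring.
  apply goursat_square; [lra | exact H].
Qed.

Definition in_square (s : C) (r : R) : C -> Prop :=
  in_rect (Re s - r) (Re s + r) (Im s - r) (Im s + r).
Definition square_int (f : C -> C) (s : C) (r : R) : C :=
  rect_int f (Re s - r) (Re s + r) (Im s - r) (Im s + r).

(** Cutting into thirds yields nine squares of side 2 r / 3. The centre s lies inside the middle
    one, so none of the other eight closed squares contains it and Goursat's theorem applies to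
    them. Halving would put s on a corner of every piece. *)
Lemma square_int_third f s r : 0 < r ->
  (forall z, in_square s r z -> ccont f z) ->
  (forall z, in_square s r z -> z <> s -> exists l, cder f z l) ->
  square_int f s r = square_int f s (r / 3).
Proof.
  intros Hr Hc Hd. unfold square_int, in_square in *. set (x := Re s) in *. set (y := Im s) in *.
  assert (Hz : forall a b c d, x - r <= a -> b <= x + r -> y - r <= c -> d <= y + r ->
     a < b -> d - c = b - a -> (b < x \/ x < a \/ d < y \/ y < c) -> rect_int f a b c d = RtoC 0).
  { intros a b c d Ha Hb Hc' Hd' Hab E Ho. apply goursat_square_bounds; auto. intros z Hz. apply Hd.
    - revert Hz. apply in_rect_sub; lra.
    - intros E'. rewrite E' in Hz. destruct Hz. fold x y in H, H0. lra. }
  assert (Hsub : forall a b c d, x - r <= a -> b <= x + r -> y - r <= c -> d <= y + r ->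
     forall z, in_rect a b c d z -> ccont f z).
  { intros. apply Hc. revert H3. apply in_rect_sub; lra. }
  assert (S : forall a b, x - r <= a -> b <= x + r -> a < b ->
    rect_int f a b (y - r) (y + r) =
    (rect_int f a b (y - r) (y - r / 3) + (rect_int f a b (y - r / 3) (y + r / 3)
      + rect_int f a b (y + r / 3) (y + r)))%C).
  { intros a b Ha Hb Hab. rewrite (rect_int_split_y f a b (y - r) (y - r / 3)) by (try apply Hsub; lra).
    f_equal. apply rect_int_split_y; try apply Hsub; lra. }
  rewrite (rect_int_split_x f _ (x - r / 3)) by (try apply Hsub; lra).
  rewrite (rect_int_split_x f (x - r / 3) (x + r / 3)) by (try apply Hsub; lra).
  rewrite !S by lra.
  rewrite (Hz (x - r) (x - r / 3) (y - r) (y - r / 3)) by lra.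
  rewrite (Hz (x - r) (x - r / 3) (y - r / 3) (y + r / 3)) by lra.
  rewrite (Hz (x - r) (x - r / 3) (y + r / 3) (y + r)) by lra.
  rewrite (Hz (x - r / 3) (x + r / 3) (y - r) (y - r / 3)) by lra.
  rewrite (Hz (x - r / 3) (x + r / 3) (y + r / 3) (y + r)) by lra.
  rewrite (Hz (x + r / 3) (x + r) (y - r) (y - r / 3)) by lra.
  rewrite (Hz (x + r / 3) (x + r) (y - r / 3) (y + r / 3)) by lra.
  rewrite (Hz (x + r / 3) (x + r) (y + r / 3) (y + r)) by lra.
  ring.
Qed.

Lemma in_square_near s r z : in_square s r z -> Cmod (z - s) <= 2 * r.
Proof.
  intros [A B]. eapply Rle_trans; [apply Cmod_le_Rabs|].
  unfold Re, Im in *; simpl.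
  assert (Rabs (fst z + - fst s) <= r) by (apply Rabs_le; lra).
  assert (Rabs (snd z + - snd s) <= r) by (apply Rabs_le; lra). lra.
Qed.

(* A single exceptional point, at which f is merely continuous, is harmless:
   the integral over a concentric square does not depend on its size. *)
Lemma square_int_zero f s r : 0 < r ->
  (forall z, in_square s r z -> ccont f z) ->
  (forall z, in_square s r z -> z <> s -> exists l, cder f z l) ->
  square_int f s r = RtoC 0.
Proof.
  intros Hr Hc Hd.
  assert (E : forall n, square_int f s r = square_int f s (r / 3 ^ n)).
  { induction n.
    - simpl. f_equal. field.
    - rewrite IHn.
      assert (H3 : 1 <= 3 ^ n) by (apply pow_R1_Rle; lra).
      assert (Hl : r / 3 ^ n <= r).
      { apply Rmult_le_reg_r with (3 ^ n); [lra|].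
        replace (r / 3 ^ n * 3 ^ n) with r by (field; lra). nra. }
      rewrite square_int_third.
      + f_equal. simpl. field. lra.
      + apply Rdiv_lt_0_compat; lra.
      + intros z Hz. apply Hc. revert Hz. apply in_rect_sub; lra.
      + intros z Hz. apply Hd. revert Hz. apply in_rect_sub; lra. }
  destruct (Hc s) with (eps := 1) as [d [Hd' G]]; [split; lra | lra |].
  set (M := Cmod (f s) + 1). assert (HM : 0 < M) by (pose proof (Cmod_ge_0 (f s)); unfold M; lra).
  apply Cmod_eq_0. apply Rle_antisym; [|apply Cmod_ge_0]. apply Rnot_lt_le. intros Hpos.
  set (m := Cmod (square_int f s r)) in *.
  assert (Hk : 0 < Rmin (d / 2) (m / (16 * M))).
  { apply Rmin_glb_lt; [lra|]. apply Rdiv_lt_0_compat; lra. }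
  destruct (pow_half_small r _ Hr Hk) as [n Hn].
  pose proof (Rmin_l (d / 2) (m / (16 * M))) as L1. pose proof (Rmin_r (d / 2) (m / (16 * M))) as L2.
  assert (P : 0 < 2 ^ n <= 3 ^ n) by (split; [apply pow_lt | apply pow_incr]; lra).
  set (k := r / 3 ^ n).
  assert (Hk0 : 0 < k) by (apply Rdiv_lt_0_compat; lra).
  assert (Hkr : k <= r / 2 ^ n).
  { apply Rmult_le_compat_l; [lra|]. apply Rinv_le_contravar; lra. }
  assert (Hkr' : k <= r).
  { unfold k. assert (H3 : 1 <= 3 ^ n) by (apply pow_R1_Rle; lra).
    apply Rmult_le_reg_r with (3 ^ n); [lra|].
    replace (r / 3 ^ n * 3 ^ n) with r by (field; lra). nra. }
  assert (B : m <= 4 * ((Re s + k - (Re s - k)) + (Im s + k - (Im s - k))) * M).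
  { unfold m. rewrite (E n). fold k. apply rect_int_bound; try lra.
    - intros z [Hz _]. apply Hc. revert Hz. apply in_rect_sub; lra.
    - intros z [Hz _]. pose proof (in_square_near _ _ _ Hz).
      specialize (G z ltac:(lra)). unfold M.
      pose proof (Cmod_triangle (f s) (f z - f s)).
      replace (f s + (f z - f s))%C with (f z) in H0 by ring. lra. }
  assert (m < 16 * M * (m / (16 * M))).
  { eapply Rle_lt_trans; [exact B|]. replace (4 * _ * M) with (16 * M * k) by ring.
    apply Rmult_lt_compat_l; lra. }
  replace (16 * M * (m / (16 * M))) with m in H by (field; lra). lra.
Qed.

Definition on_boundary (s : C) (r : R) (z : C) : Prop :=
  in_square s r z /\ (Rabs (Re z - Re s) = r \/ Rabs (Im z - Im s) = r).

Lemma boundary_far s r z : 0 < r -> on_boundary s r z -> r <= Cmod (z - s).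
Proof.
  intros Hr [_ [H|H]]; rewrite <- H.
  - apply (re_le_Cmod (z - s)).
  - apply (im_le_Cmod (z - s)).
Qed.

Lemma boundary_sides s r z : 0 < r -> in_square s r z ->
  (Re z = Re s - r \/ Re z = Re s + r \/ Im z = Im s - r \/ Im z = Im s + r) -> on_boundary s r z.
Proof.
  intros Hr Hz H. split; [easy|].
  destruct H as [->|[->|[->| ->]]].
  - left. replace (Re s - r - Re s) with (- r) by ring. rewrite Rabs_Ropp, Rabs_right; lra.
  - left. replace (Re s + r - Re s) with r by ring. rewrite Rabs_right; lra.
  - right. replace (Im s - r - Im s) with (- r) by ring. rewrite Rabs_Ropp, Rabs_right; lra.
  - right. replace (Im s + r - Im s) with r by ring. rewrite Rabs_right; lra.
Qed.

Lemma RInt_ge_const (f : R -> R) a b m : a <= b -> ex_RInt f a b ->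
  (forall x, a <= x <= b -> m <= f x) -> (b - a) * m <= RInt f a b.
Proof.
  intros Hab Hf H. replace ((b - a) * m) with (RInt (fun _ => m) a b)
    by (rewrite RInt_const; reflexivity).
  apply RInt_le; auto; [apply ex_RInt_const | intros; apply H; lra].
Qed.

(** Pairing opposite sides turns 1 / (z - s) into the positive kernel 2 r / (u^2 + r^2), up to the
    factor i. A lower bound replaces the exact value 2 PI i: on [-r, r] the kernel is at least 1 /
    r, so each of the two integrals is at least 2. *)
Lemma square_kernel_lower s r (w : C) (f : C -> C) : 0 < r ->
  (forall z, on_boundary s r z -> f z = (w / (z - s))%C) ->
  4 * Cmod w <= Cmod (square_int f s r).
Proof.
  intros Hr Hf.
  assert (Dw : forall A B : C, (w / A - w / B)%C = (w * (/ A - / B))%C) by (intros; unfold Cdiv; ring).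
  set (h := fun u : R => 2 * r / (u ^ 2 + r ^ 2)).
  assert (Hr2 : forall u, 0 < u ^ 2 + r ^ 2) by (intros; nra).
  assert (Eh : square_int f s r =
    (Ci * w * RtoC (RInt (fun x => h (x - Re s)) (Re s - r) (Re s + r)
                   + RInt (fun y => h (y - Im s)) (Im s - r) (Im s + r))%R)%C).
  { unfold square_int, rect_int.
    assert (hc : forall a u, continuous (fun x => h (x - a)) u).
    { intros a u. unfold h. apply @ex_derive_continuous. auto_derive.
      specialize (Hr2 (u - a)). simpl in *. unfold Rminus in *. lra. }
    assert (Hi : forall a b c, ex_RInt (fun x => h (x - a)) b c).
    { intros. apply @ex_RInt_continuous. intros; apply hc. }
    assert (Hk : forall (a b c : R) (v : C), CInt (fun x => v * RtoC (h (x - a)%R))%C b c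
                  = (v * RtoC (RInt (fun x => h (x - a)%R) b c))%C).
    { intros a b c v. rewrite CInt_scal.
      - f_equal. unfold CInt, Re, Im, RtoC; simpl. f_equal.
        rewrite RInt_const. unfold scal; simpl. unfold mult; simpl. ring.
      - split; simpl; [apply Hi | apply ex_RInt_const]. }
    rewrite (CInt_ext _ (fun x => Ci * w * RtoC (h (x - Re s)%R))%C).
    - rewrite (CInt_ext (fun y => f ((Re s + r)%R, y) - f ((Re s - r)%R, y))%C
        (fun y => w * RtoC (h (y - Im s)%R))%C).
      + rewrite !Hk, RtoC_plus. ring.
      + intros y. rewrite Rmin_left, Rmax_right by lra. intros Hy.
        rewrite !Hf; try (apply boundary_sides; unfold in_square, in_rect; simpl; lra).
        rewrite Dw.
        f_equal. specialize (Hr2 (y - Im s)). destruct s as [s1 s2]; unfold Re, Im, h in *; simpl in *.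
        replace (Cminus (s1 + r, y) (s1, s2)) with ((r, y - s2) : C)
          by (unfold Cminus, Copp; unfold Cplus; simpl; f_equal; ring).
        replace (Cminus (s1 - r, y) (s1, s2)) with ((- r, y - s2) : C)
          by (unfold Cminus, Copp; unfold Cplus; simpl; f_equal; ring).
        unfold Cinv, Cminus, Copp; unfold Cplus; simpl. unfold RtoC. f_equal; field; nra.
    - intros x. rewrite Rmin_left, Rmax_right by lra. intros Hy.
      rewrite !Hf; try (apply boundary_sides; unfold in_square, in_rect; simpl; lra).
      rewrite Dw.
      rewrite (Cmult_comm Ci w), <- Cmult_assoc.
      f_equal. specialize (Hr2 (x - Re s)). destruct s as [s1 s2]; unfold Re, Im, h in *; simpl in *.
      replace (Cminus (x, s2 - r) (s1, s2)) with ((x - s1, - r) : C)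
          by (unfold Cminus, Copp; unfold Cplus; simpl; f_equal; ring).
      replace (Cminus (x, s2 + r) (s1, s2)) with ((x - s1, r) : C)
          by (unfold Cminus, Copp; unfold Cplus; simpl; f_equal; ring).
      unfold Cinv, Cminus, Copp, Ci, Cmult, RtoC; unfold Cplus; simpl. f_equal; field; nra. }
  rewrite Eh, !Cmod_mult, Cmod_Ci, Cmod_R.
  assert (L : forall a, 2 <= RInt (fun x => h (x - a)) (a - r) (a + r)).
  { intros a. replace 2 with ((a + r - (a - r)) * (/ r)) by (field; lra).
    apply RInt_ge_const; [lra| |].
    - apply @ex_RInt_continuous. intros u _. unfold h. apply @ex_derive_continuous. auto_derive.
      specialize (Hr2 (u - a)). simpl in *. unfold Rminus in *. lra.
    - intros x Hx. unfold h. specialize (Hr2 (x - a)).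
      apply Rmult_le_reg_r with (r * ((x - a) ^ 2 + r ^ 2)); [nra|].
      replace (/ r * (r * ((x - a) ^ 2 + r ^ 2))) with ((x - a) ^ 2 + r ^ 2) by (field; lra).
      replace (2 * r / ((x - a) ^ 2 + r ^ 2) * (r * ((x - a) ^ 2 + r ^ 2))) with (2 * r ^ 2)
        by (field; lra). nra. }
  pose proof (L (Re s)). pose proof (L (Im s)).
  rewrite Rabs_right by lra. pose proof (Cmod_ge_0 w). nra.
Qed.

Lemma ccont_minus f g s : ccont f s -> ccont g s -> ccont (fun x => f x - g x)%C s.
Proof.
  intros Hf Hg. apply ccont_plus; [easy|].
  apply ccont_ext with (fun x => (- (1)) * g x)%C.
  - exists 1. split; [lra|]. intros. ring.
  - apply ccont_mult; [apply ccont_const | easy].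
Qed.

Lemma cder_ext f g s l : near s (fun x => f x = g x) -> cder f s l -> cder g s l.
Proof.
  intros H [phi [E [Hc Hn]]]. exists phi. split; [easy|]. split; [easy|].
  pose proof (near_self _ _ H) as E0. simpl in E0.
  generalize (near_and _ _ _ H Hn). apply near_mono. intros x [<- ->]. now rewrite E0.
Qed.

Lemma cder_shift c s : cder (fun z => z - c)%C s 1.
Proof.
  exists (fun _ => RtoC 1). split; [easy|]. split; [apply ccont_const|].
  exists 1. split; [lra|]. intros. ring.
Qed.

Lemma near_neq (s c : C) : s <> c -> near s (fun z => z <> c).
Proof.
  intros H. exists (Cmod (s - c)). split.
  - apply Cmod_pos. now apply Cminus_neq_0.
  - intros x Hx ->. rewrite Cmod_minus_sym in Hx. lra.
Qed.

(* Apply Cauchy's theorem to (G z - G s) / (z - s). *)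
Lemma center_le_boundary G s r M : 0 < r ->
  (forall z, in_square s r z -> exists l, cder G z l) ->
  (forall z, on_boundary s r z -> Cmod (G z) <= M) ->
  Cmod (G s) <= 4 * M.
Proof.
  intros Hr Hd HM.
  destruct (Hd s) as [l [phi [El [Hphi [e [He Hn]]]]]]; [split; lra|].
  assert (Cc : forall z, in_square s r z -> ccont G z).
  { intros z Hz. destruct (Hd z Hz) as [m Hm]. eapply cder_ccont; eauto. }
  set (f := fun z => if excluded_middle_informative (z = s) then l else ((G z - G s) / (z - s))%C).
  assert (Ef : forall z, z <> s -> near z (fun x => ((G x - G s) / (x - s))%C = f x)).
  { intros z Hz. generalize (near_neq z s Hz). apply near_mono. intros x Hx. unfold f.
    now destruct (excluded_middle_informative (x = s)). }
  assert (Hf : forall z, in_square s r z -> z <> s -> exists m, cder f z m).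
  { intros z Hz Hzs. destruct (Hd z Hz) as [m Hm].
    eexists. eapply cder_ext; [apply Ef; easy|]. unfold Cdiv. apply cder_mult.
    - unfold Cminus. apply cder_plus; [exact Hm | apply cder_const].
    - apply cder_inv; [now apply Cminus_neq_0 | apply cder_shift]. }
  assert (Hc : forall z, in_square s r z -> ccont f z).
  { intros z Hz. destruct (excluded_middle_informative (z = s)) as [->|Hzs].
    - apply ccont_ext with phi; [|easy]. exists e. split; [easy|]. intros x Hx. unfold f.
      destruct (excluded_middle_informative (x = s)) as [->|Hxs]; [easy|].
      rewrite (Hn x Hx). field. now apply Cminus_neq_0.
    - destruct (Hf z Hz Hzs) as [m Hm]. eapply cder_ccont; eauto. }
  assert (Z : square_int f s r = RtoC 0) by now apply square_int_zero.
  set (g := fun z => (- G s / (z - s))%C).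
  assert (Hb : forall z, on_boundary s r z -> z <> s).
  { intros z Hz ->. pose proof (boundary_far _ _ _ Hr Hz). rewrite Cmod_self in H. lra. }
  assert (Hsd : forall z, on_sides (Re s - r) (Re s + r) (Im s - r) (Im s + r) z -> on_boundary s r z).
  { intros z [Hz Hz']. now apply boundary_sides. }
  assert (Hg : forall z, on_sides (Re s - r) (Re s + r) (Im s - r) (Im s + r) z ->
     ccont g z).
  { intros z Hz. apply Hsd, Hb in Hz. unfold g, Cdiv. apply ccont_mult; [apply ccont_const|].
    apply ccont_inv; [now apply Cminus_neq_0|]. apply ccont_minus; [apply ccont_id | apply ccont_const]. }
  (* On the boundary h equals G z / (z - s). Its integral is that of the kernel G s / (z - s),
     because the integral of f vanishes. Comparing 4 |G s| with the perimeter bound 16 M gives the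
     constant 4. *)
  set (h := fun z => (- (1) * g z + f z)%C).
  assert (Eh : square_int h s r = (square_int (fun z => - (1) * g z)%C s r + square_int f s r)%C).
  { apply rect_int_plus; try lra.
    - intros z Hz. apply ccont_mult; [apply ccont_const | now apply Hg].
    - intros z [Hz _]. now apply Hc. }
  assert (L : 4 * Cmod (G s) <= Cmod (square_int (fun z => - (1) * g z)%C s r)).
  { apply square_kernel_lower; auto. intros z Hz. unfold g, Cdiv. ring. }
  rewrite Z, Cplus_0_r in Eh. rewrite <- Eh in L.
  assert (B : Cmod (square_int h s r) <= 4 * ((Re s + r - (Re s - r)) + (Im s + r - (Im s - r))) * (M / r)).
  { apply rect_int_bound; try lra.
    - intros z Hz. apply ccont_plus; [|destruct Hz as [Hz _]; now apply Hc].
      apply ccont_mult; [apply ccont_const | now apply Hg].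
    - intros z Hz. apply Hsd in Hz. pose proof (Hb _ Hz) as Hzs.
      replace (h z) with (G z / (z - s))%C.
      + rewrite Cmod_div by now apply Cminus_neq_0.
        pose proof (boundary_far _ _ _ Hr Hz). pose proof (HM z Hz). pose proof (Cmod_ge_0 (G z)).
        apply Rmult_le_compat; auto; [left; apply Rinv_0_lt_compat; lra|].
        apply Rinv_le_contravar; lra.
      + unfold h, g, f. destruct (excluded_middle_informative (z = s)); [easy|].
        field. now apply Cminus_neq_0. }
  replace (4 * _ * (M / r)) with (16 * M) in B by (field; lra). lra.
Qed.

Lemma cder_pow (f : C -> C) (s l : C) n : cder f s l -> exists m, cder (fun z => f z ^ n)%C s m.
Proof.
  intros H. induction n.
  - exists (RtoC 0). simpl. apply cder_const.
  - destruct IHn as [m Hm]. eexists. simpl. apply cder_mult; eauto.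
Qed.

(* G / (z - q)^n is again differentiable, for every n, because G vanishes near q. *)
Lemma identity_local G s q r M : 0 < r ->
  (forall z, in_square s r z -> exists l, cder G z l) ->
  (forall z, in_square s r z -> Cmod (G z) <= M) ->
  near q (fun z => G z = RtoC 0) -> Cmod (s - q) < r / 3 -> G s = RtoC 0.
Proof.
  intros Hr Hd HM Hq Hsq.
  destruct (excluded_middle_informative (s = q)) as [->|Hne]; [now apply (near_self _ _ Hq)|].
  set (H := fun n z => (G z * (/ (z - q)) ^ n)%C).
  assert (HH : forall n, Cmod (H n s) <= 4 * (M * (3 / (2 * r)) ^ n)).
  { intros n. apply center_le_boundary with r; [easy| |].
    - intros z Hz. destruct (excluded_middle_informative (z = q)) as [->|Hzq].
      + exists (RtoC 0). apply cder_ext with (fun _ => RtoC 0); [|apply cder_const].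
        revert Hq. apply near_mono. intros x Hx. unfold H. rewrite Hx. ring.
      + destruct (Hd z Hz) as [l Hl].
        destruct (cder_pow (fun z => / (z - q))%C z _ n
          (cder_inv (fun z => z - q)%C z 1 (Cminus_neq_0 _ _ Hzq) (cder_shift q z))) as [m Hm].
        eexists. unfold H. apply cder_mult; eauto.
    (* Boundary points are at distance at least r from s, and s is within r / 3 of q. Hence |s - q|
       / |z - q| is at most 1/2, and dividing G by (z - q)^n gains 2^n against a constant
       independent of n. *)
    - intros z Hz. assert (D : 2 * r / 3 <= Cmod (z - q)).
      { pose proof (boundary_far _ _ _ Hr Hz).
        pose proof (Cmod_triangle (z - q) (q - s)).
        replace (z - q + (q - s))%C with (z - s)%C in H1 by ring.
        rewrite Cmod_minus_sym in Hsq. lra. }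
      assert (N : (z - q)%C <> RtoC 0) by (apply Cmod_pos_neq_0; lra).
      unfold H. rewrite Cmod_mult, Cmod_pow, Cmod_inv by easy.
      apply Rmult_le_compat; [apply Cmod_ge_0 | | |].
      + apply pow_le. left. apply Rinv_0_lt_compat. lra.
      + apply HM. apply Hz.
      + apply pow_incr. split; [left; apply Rinv_0_lt_compat; lra|].
        replace (3 / (2 * r)) with (/ (2 * r / 3)) by (field; lra).
        apply Rinv_le_contravar; lra. }
  assert (M0 : 0 <= M).
  { eapply Rle_trans; [apply Cmod_ge_0 | apply (HM s)]. split; lra. }
  assert (Hn : forall n, Cmod (G s) <= 4 * M / 2 ^ n).
  { intros n. specialize (HH n). unfold H in HH.
    assert (N : (s - q)%C <> RtoC 0) by now apply Cminus_neq_0.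
    assert (P : 0 < Cmod (s - q)) by now apply Cmod_pos.
    rewrite Cmod_mult, Cmod_pow, Cmod_inv in HH by easy.
    replace (Cmod (G s)) with (Cmod (G s) * (/ Cmod (s - q)) ^ n * Cmod (s - q) ^ n).
    - eapply Rle_trans; [apply Rmult_le_compat_r; [apply pow_le; lra | exact HH]|].
      replace (4 * (M * (3 / (2 * r)) ^ n) * Cmod (s - q) ^ n)
        with (4 * M * (3 / (2 * r) * Cmod (s - q)) ^ n) by (rewrite Rpow_mult_distr; ring).
      unfold Rdiv at 2. apply Rmult_le_compat_l; [lra|]. rewrite <- pow_inv.
      apply pow_incr. split.
      + apply Rmult_le_pos; [|lra]. left. apply Rdiv_lt_0_compat; lra.
      + apply Rmult_le_reg_l with (2 * r); [lra|].
        replace (2 * r * (3 / (2 * r) * Cmod (s - q))) with (3 * Cmod (s - q)) by (field; lra).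
        lra.
    - rewrite Rmult_assoc, <- Rpow_mult_distr, Rinv_l, pow1 by lra. ring. }
  apply Cmod_eq_0. apply Rle_antisym; [|apply Cmod_ge_0]. apply Rnot_lt_le. intros Hp.
  destruct (pow_half_small (4 * M + 1) (Cmod (G s))) as [n Hn']; [lra|easy|].
  specialize (Hn n). assert (0 < / 2 ^ n) by (apply Rinv_0_lt_compat, pow_lt; lra).
  unfold Rdiv in *. nra.
Qed.

(** * Lines avoiding isolated points *)

Definition punctured (P : C -> Prop) (t : C) : Prop := near t (fun x => x <> t -> P x).

Lemma RtoC_eq_0 (x : R) : RtoC x = RtoC 0 -> x = 0.
Proof. intros H. now injection H. Qed.

(* Points off the line see only the punctured neighbourhoods of points of the line. *)
Lemma generic_parallel (good : C -> Prop) (t d : C) (L eta : R) :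
  Cmod d = 1 -> 0 < eta ->
  (forall s : R, 0 <= s <= L -> punctured good (t + s * d)%C) ->
  exists h : R, 0 < h < eta /\ forall s : R, 0 <= s <= L -> good (t + h * (Ci * d) + s * d)%C.
Proof.
  intros Hd Heta H.
  (* The factor 2 leaves room both for the offset along the line, below delta(s'), and for the
     sideways shift h, which is smaller than the Lebesgue number e <= delta(s'). *)
  assert (Hr : forall s : R, exists r : posreal, 0 <= s <= L -> forall x,
    Cmod (x - (t + s * d)) < 2 * r -> x <> (t + s * d)%C -> good x).
  { intros s. destruct (classic (0 <= s <= L)) as [Hs|Hs].
    - destruct (H s Hs) as [r [Hr G]].
      assert (Hr2 : 0 < r / 2) by lra. exists (mkposreal _ Hr2). intros _ x Hx. apply G.
      simpl in Hx. lra.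
    - exists (mkposreal _ Rlt_0_1). tauto. }
  set (delta := fun s => proj1_sig (constructive_indefinite_description _ (Hr s))).
  assert (Hdel : forall s, 0 <= s <= L -> forall x,
    Cmod (x - (t + s * d)) < 2 * delta s -> x <> (t + s * d)%C -> good x).
  { intros s. exact (proj2_sig (constructive_indefinite_description _ (Hr s))). }
  destruct (compactness_value_1d 0 L delta) as [e He].
  pose proof (cond_pos e) as Pe.
  exists (Rmin e eta / 2).
  assert (0 < Rmin e eta) by now apply Rmin_glb_lt.
  pose proof (Rmin_l e eta). pose proof (Rmin_r e eta). set (h := Rmin e eta / 2).
  assert (Hh : 0 < h < eta /\ h < e) by (unfold h; lra).
  split; [lra|]. intros s Hs. specialize (He s Hs). apply NNPP in He.
  destruct He as [s' [Hs' [Hss Hes]]].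
  assert (E : (t + h * (Ci * d) + s * d - (t + s' * d))%C = ((RtoC (s - s') + Ci * h) * d)%C)
    by (rewrite RtoC_minus; ring).
  apply (Hdel s' Hs').
  - rewrite E, Cmod_mult, Hd, Rmult_1_r.
    eapply Rle_lt_trans; [apply Cmod_triangle|].
    rewrite Cmod_mult, Cmod_Ci, !Cmod_R, (Rabs_right h) by lra. lra.
  - intros F. assert (F' : ((RtoC (s - s') + Ci * h) * d)%C = RtoC 0) by (rewrite <- E, F; ring).
    apply (f_equal Cmod) in F'. rewrite Cmod_mult, Hd, Rmult_1_r, Cmod_0 in F'.
    apply Cmod_eq_0 in F'. apply (f_equal Im) in F'. unfold Im in F'. simpl in F'. lra.
Qed.

Definition Rcontinuous_at (f : R -> R) (s : R) : Prop :=
  forall e, 0 < e -> exists d, 0 < d /\ forall x, Rabs (x - s) < d -> Rabs (f x - f s) < e.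

(** Method of continuity. At the supremum of the s up to which the bound 1/2 holds, the improved
    bound 1/4 leaves a gap that continuity turns into further progress, so the supremum is L. *)
Lemma continuity_bootstrap (E : R -> R) (L : R) :
  (forall s, 0 <= s <= L -> Rcontinuous_at E s) -> E 0 <= 1 / 2 ->
  (forall s, 0 <= s <= L -> (forall x, 0 <= x <= s -> E x <= 1 / 2) -> E s <= 1 / 4) ->
  forall s, 0 <= s <= L -> E s <= 1 / 4.
Proof.
  intros Hc H0 Hb s Hs.
  set (A := fun s => 0 <= s <= L /\ forall x, 0 <= x <= s -> E x <= 1 / 2).
  assert (HA0 : A 0). { split; [lra|]. intros x Hx. now replace x with 0 by lra. }
  destruct (completeness A) as [m [U Lb]].
  - exists L. intros x [Hx _]. lra.
  - now exists 0.
  - assert (Hm : 0 <= m <= L).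
    { split; [now apply U|]. apply Lb. intros x [Hx _]. lra. }
    assert (Hlt : forall x, 0 <= x < m -> E x <= 1 / 2).
    { intros x Hx. destruct (classic (exists y, A y /\ x < y)) as [[y [[Hy G] Hxy]]|N].
      - apply G. lra.
      - exfalso. assert (m <= x); [|lra]. apply Lb. intros y Hy.
        apply Rnot_lt_le. intros Hl. apply N. now exists y. }
    assert (HAm : A m).
    { split; [easy|]. intros x Hx. destruct (Req_dec x m) as [->|Hne]; [|apply Hlt; lra].
      destruct (Req_dec m 0) as [->|Hm0]; [easy|].
      apply Rnot_lt_le. intros Hbad.
      destruct (Hc m Hm (E m - 1 / 2)) as [d [Hd G]]; [lra|].
      set (y := Rmax 0 (m - d / 2)).
      assert (Hy : 0 <= y < m /\ Rabs (y - m) < d).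
      { unfold y, Rmax. destruct (Rle_dec 0 (m - d / 2)).
        - split; [lra|]. rewrite Rabs_left; lra.
        - split; [lra|]. rewrite Rabs_left; lra. }
      destruct Hy as [Hy Hyd]. specialize (G y Hyd). specialize (Hlt y Hy).
      apply Rabs_def2 in G. lra. }
    assert (Em : E m <= 1 / 4) by (apply Hb; [easy | apply HAm]).
    destruct (Rle_lt_or_eq_dec m L (proj2 Hm)) as [HmL|HmL].
    + exfalso. destruct (Hc m Hm (1 / 4)) as [d [Hd G]]; [lra|].
      set (y := Rmin L (m + d / 2)).
      assert (m < y) by (apply Rmin_glb_lt; lra).
      assert (y <= L) by apply Rmin_l. assert (y <= m + d / 2) by apply Rmin_r.
      assert (HAy : A y); [|specialize (U y HAy); lra].
      split; [lra|]. intros x Hx. destruct (Rle_dec x m); [apply HAm; lra|].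
      specialize (G x). rewrite Rabs_right in G by lra. specialize (G ltac:(lra)).
      apply Rabs_def2 in G. lra.
    + apply Hb; [easy|]. intros x Hx. apply HAm. lra.
Qed.

Lemma sign_sq eps : eps = 1 \/ eps = -1 -> eps * eps = 1.
Proof. intros [-> | ->]; ring. Qed.

Definition strip (eps x0 T : R) (t : C) : Prop := Rabs (Re t) < x0 /\ T < eps * Im t.

Lemma lder_Rcont f t0 d s l : lder f (t0 + RtoC s * d)%C l -> Rcont (fun x => f (t0 + RtoC x * d)%C) s.
Proof. intros H. eapply cRder_Rcont. now apply H. Qed.

Lemma Re_shift (t : C) (h : R) (d : C) : Re (t + h * d)%C = Re t + h * Re d.
Proof. unfold Re; simpl. ring. Qed.
Lemma Im_shift (t : C) (h : R) (d : C) : Im (t + h * d)%C = Im t + h * Im d.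
Proof. unfold Im; simpl. ring. Qed.

(** Integration of M / tau^2 from infinity, where f tends to zero. The vertical line through t may
    meet bad points, so the integration runs along a slightly shifted parallel line. *)
Lemma vertical_decay eps x0 T (good : C -> Prop) (f : C -> C) M :
  eps = 1 \/ eps = -1 -> 0 < T -> 0 <= M ->
  (forall t, strip eps x0 T t -> punctured good t) ->
  (forall t, strip eps x0 T t -> good t ->
     exists l, lder f t l /\ Cmod l <= M / (eps * Im t) ^ 2) ->
  (forall e, 0 < e -> exists S, forall t, strip eps x0 T t -> good t -> S < eps * Im t -> Cmod (f t) <= e) ->
  forall t, strip eps x0 T t -> good t -> Cmod (f t) <= M / (eps * Im t).
Proof.
  intros Heps HT HM Hgood Hf Hlim t Ht Gt.
  pose proof (sign_sq _ Heps) as Esq.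
  apply Rnot_lt_le. intros Hbad.
  set (tau := eps * Im t) in *. assert (Htau : T < tau) by apply Ht.
  (* Half of the assumed excess over M / tau: one e pays for the value of f at the top of the
     segment, the other for the sideways shift of t. *)
  set (e := (Cmod (f t) - M / tau) / 2). assert (He : 0 < e) by (unfold e; lra).
  destruct (Hlim e He) as [S HS].
  set (L := Rmax 1 (S + 1)). assert (HL1 : 1 <= L) by apply Rmax_l.
  assert (HLS : S + 1 <= L) by apply Rmax_r.
  set (d := (RtoC eps * Ci)%C).
  assert (Hd : Cmod d = 1).
  { unfold d. rewrite Cmod_mult, Cmod_Ci, Cmod_R. destruct Heps as [-> | ->].
    - rewrite Rabs_R1. ring.
    - rewrite Rabs_left; lra. }
  assert (Rd : Re d = 0) by (unfold d, Re; simpl; ring).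
  assert (Id : Im d = eps) by (unfold d, Im; simpl; ring).
  assert (Rid : Re (Ci * d) = - eps) by (unfold d, Re; simpl; ring).
  assert (Iid : Im (Ci * d) = 0) by (unfold d, Im; simpl; ring).
  destruct (Hf t Ht Gt) as [l0 [Hl0 _]].
  assert (C0 : Rcont (fun x => f (t + RtoC x * (Ci * d))%C) 0).
  { apply lder_Rcont with l0. replace (t + RtoC 0 * (Ci * d))%C with t by ring. easy. }
  destruct (C0 e He) as [r [Hr Hcont]].
  destruct Ht as [Hx Hy]. set (m := x0 - Rabs (Re t)).
  assert (Hm : 0 < m) by (unfold m; lra).
  destruct (generic_parallel good t d L (Rmin r m)) as [h [Hh Gh]]; [easy | now apply Rmin_glb_lt | |].
  { intros s Hs. apply Hgood. split.
    - rewrite Re_shift, Rd. now rewrite Rmult_0_r, Rplus_0_r.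
    - rewrite Im_shift, Id. replace (eps * (Im t + s * eps)) with (tau + s * (eps * eps)) by (unfold tau; ring).
      rewrite Esq. lra. }
  pose proof (Rmin_l r m). pose proof (Rmin_r r m).
  set (t' := (t + RtoC h * (Ci * d))%C) in *.
  assert (Rt' : Rabs (Re t') < x0).
  { unfold t'. rewrite Re_shift, Rid.
    assert (Rabs (Re t + h * - eps) <= Rabs (Re t) + h).
    { eapply Rle_trans; [apply Rabs_triang|]. apply Rplus_le_compat_l.
      rewrite Rabs_mult, Rabs_Ropp, (Rabs_right h) by lra.
      replace (Rabs eps) with 1; [lra|]. destruct Heps as [-> | ->]; [now rewrite Rabs_R1|].
      rewrite Rabs_left; lra. }
    unfold m in *. lra. }
  assert (It' : Im t' = Im t) by (unfold t'; rewrite Im_shift, Iid; ring).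
  assert (Hst : forall s : R, 0 <= s -> strip eps x0 T (t' + s * d)%C /\ eps * Im (t' + s * d)%C = tau + s).
  { intros s Hs. rewrite Im_shift, Id, It'. 
    assert (Et : eps * (Im t + s * eps) = tau + s) by (replace (eps * (Im t + s * eps)) with (tau + s * (eps * eps)) by (unfold tau; ring);
      rewrite Esq; ring).
    split; [split|easy].
    - rewrite Re_shift, Rd. now rewrite Rmult_0_r, Rplus_0_r.
    - rewrite Im_shift, Id, It', Et. lra. }
  assert (Hex : forall s : R, exists l : C, 0 <= s <= L ->
    lder f (t' + s * d)%C l /\ Cmod l <= M / (tau + s) ^ 2).
  { intros s. destruct (classic (0 <= s <= L)) as [Hs|Hs]; [|exists (RtoC 0); tauto].
    destruct (Hst s (proj1 Hs)) as [S1 S2].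
    destruct (Hf _ S1 (Gh s Hs)) as [l [Hl Bl]]. rewrite S2 in Bl. now exists l. }
  set (l := fun s => proj1_sig (constructive_indefinite_description _ (Hex s))).
  assert (Hl : forall s : R, 0 <= s <= L -> lder f (t' + s * d)%C (l s) /\ Cmod (l s) <= M / (tau + s) ^ 2).
  { intros s. exact (proj2_sig (constructive_indefinite_description _ (Hex s))). }
  assert (B : Cmod (f (t' + RtoC L * d)%C - f (t' + RtoC 0 * d)%C)
     <= - (M / (tau + L)) - - (M / (tau + 0))).
  { apply (cRder_norm_le (fun s => f (t' + RtoC s * d)%C) (fun s => d * l s)%C
      (fun s => - (M / (tau + s))) (fun s => M / (tau + s) ^ 2)); [lra|].
    intros s Hs. destruct (Hl s Hs) as [H1 H2]. split; [now apply H1|]. split.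
    - auto_derive; [lra|]. field. lra.
    - now rewrite Cmod_mult, Hd, Rmult_1_l. }
  replace (t' + RtoC 0 * d)%C with t' in B by ring. rewrite Rplus_0_r in B.
  destruct (Hst L ltac:(lra)) as [S1 S2].
  assert (F1 : Cmod (f (t' + RtoC L * d)%C) <= e) by (apply HS; [easy | apply Gh; lra | lra]).
  assert (F2 : Cmod (f t' - f t) < e).
  { specialize (Hcont h). rewrite Rminus_0_r, Rabs_right in Hcont by lra.
    specialize (Hcont ltac:(lra)). cbv beta in Hcont. fold t' in Hcont.
    now replace (t + RtoC 0 * (Ci * d))%C with t in Hcont by ring. }
  assert (PM : 0 <= M / (tau + L)) by (apply Rdiv_le_0_compat; lra).
  pose proof (Cmod_triangle (f (t' + RtoC L * d)%C) (- (f (t' + RtoC L * d) - f t') + - (f t' - f t))%C) as T1.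
  replace (f (t' + RtoC L * d) + (- (f (t' + RtoC L * d) - f t') + - (f t' - f t)))%C with (f t) in T1 by ring.
  pose proof (Cmod_triangle (- (f (t' + RtoC L * d) - f t')) (- (f t' - f t)))%C as T2.
  rewrite !Cmod_opp in T2. unfold e in *. lra.
Qed.

(** * The system in the variables v and v - z *)

Definition bounded_on (S : C -> Prop) (f : C -> C) : Prop :=
  exists M, forall t, S t -> Cmod (f t) <= M.

Lemma bounded_nonneg S f : bounded_on S f -> exists M, 0 <= M /\ forall t, S t -> Cmod (f t) <= M.
Proof.
  intros [M H]. exists (Rmax 0 M). split; [apply Rmax_l|].
  intros t Ht. eapply Rle_trans; [apply H, Ht | apply Rmax_r].
Qed.

Lemma bounded_const S c : bounded_on S (fun _ => c).
Proof. exists (Cmod c). intros. lra. Qed.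

Lemma bounded_plus S f g : bounded_on S f -> bounded_on S g -> bounded_on S (fun t => f t + g t)%C.
Proof.
  intros [M H] [M' H']. exists (M + M'). intros t Ht.
  eapply Rle_trans; [apply Cmod_triangle|]. specialize (H t Ht). specialize (H' t Ht). lra.
Qed.

Lemma bounded_opp S f : bounded_on S f -> bounded_on S (fun t => - f t)%C.
Proof. intros [M H]. exists M. intros t Ht. rewrite Cmod_opp. auto. Qed.

Lemma bounded_minus S f g : bounded_on S f -> bounded_on S g -> bounded_on S (fun t => f t - g t)%C.
Proof. intros H H'. apply bounded_plus; [easy | now apply bounded_opp]. Qed.

Lemma bounded_mult S f g : bounded_on S f -> bounded_on S g -> bounded_on S (fun t => f t * g t)%C.
Proof.
  intros H H'. destruct (bounded_nonneg _ _ H) as [M [HM G]].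
  destruct (bounded_nonneg _ _ H') as [M' [HM' G']]. exists (M * M'). intros t Ht.
  rewrite Cmod_mult. apply Rmult_le_compat; auto using Cmod_ge_0.
Qed.

Lemma bounded_inv S (f : C -> C) m : 0 < m -> (forall t, S t -> m <= Cmod (f t)) ->
  bounded_on S (fun t => / f t)%C.
Proof.
  intros Hm H. exists (/ m). intros t Ht. specialize (H t Ht).
  rewrite Cmod_inv by (apply Cmod_pos_neq_0; lra). apply Rinv_le_contravar; lra.
Qed.

(** Boundedness is part of the relation so that it is stable under products, and under quotients
    with denominators bounded below. Estimates of rational expressions then follow their syntax. N
    is the error [lnq] when a solution is compared with its leading term, and the distance of two
    solutions in the uniqueness argument. *)
Definition close_on (S : C -> Prop) (N : C -> R) (f g : C -> C) : Prop :=
  bounded_on S f /\ bounded_on S g /\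
  exists K, 0 <= K /\ forall t, S t -> Cmod (f t - g t) <= K * N t.

Lemma close_refl S N f : (forall t, S t -> 0 <= N t) -> bounded_on S f -> close_on S N f f.
Proof.
  intros HN H. split; [easy|]. split; [easy|]. exists 0. split; [lra|].
  intros t Ht. rewrite Cmod_self. lra.
Qed.

Lemma close_const S N c : (forall t, S t -> 0 <= N t) -> close_on S N (fun _ => c) (fun _ => c).
Proof. intros. apply close_refl; auto using bounded_const. Qed.

Lemma close_plus S N f g f' g' : close_on S N f g -> close_on S N f' g' ->
  close_on S N (fun t => f t + f' t)%C (fun t => g t + g' t)%C.
Proof.
  intros [A [B [K [HK H]]]] [A' [B' [K' [HK' H']]]].
  split; [now apply bounded_plus|]. split; [now apply bounded_plus|].
  exists (K + K'). split; [lra|]. intros t Ht.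
  replace (f t + f' t - (g t + g' t))%C with ((f t - g t) + (f' t - g' t))%C by ring.
  eapply Rle_trans; [apply Cmod_triangle|]. specialize (H t Ht). specialize (H' t Ht). lra.
Qed.

Lemma close_opp S N f g : close_on S N f g -> close_on S N (fun t => - f t)%C (fun t => - g t)%C.
Proof.
  intros [A [B [K [HK H]]]]. split; [now apply bounded_opp|]. split; [now apply bounded_opp|].
  exists K. split; [easy|]. intros t Ht.
  replace (- f t - - g t)%C with (- (f t - g t))%C by ring. rewrite Cmod_opp. auto.
Qed.

Lemma close_minus S N f g f' g' : close_on S N f g -> close_on S N f' g' ->
  close_on S N (fun t => f t - f' t)%C (fun t => g t - g' t)%C.
Proof. intros H H'. apply close_plus; [easy | now apply close_opp]. Qed.

Lemma close_mult S N f g f' g' : close_on S N f g -> close_on S N f' g' ->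
  close_on S N (fun t => f t * f' t)%C (fun t => g t * g' t)%C.
Proof.
  intros [A [B [K [HK H]]]] [A' [B' [K' [HK' H']]]].
  split; [now apply bounded_mult|]. split; [now apply bounded_mult|].
  destruct (bounded_nonneg _ _ A') as [M [HM G]]. destruct (bounded_nonneg _ _ B) as [M' [HM' G']].
  exists (K * M + M' * K'). split; [nra|]. intros t Ht.
  replace (f t * f' t - (g t * g' t))%C with ((f t - g t) * f' t + g t * (f' t - g' t))%C by ring.
  eapply Rle_trans; [apply Cmod_triangle|]. rewrite !Cmod_mult.
  specialize (H t Ht). specialize (H' t Ht). specialize (G t Ht). specialize (G' t Ht).
  assert (Cmod (f t - g t) * Cmod (f' t) <= K * N t * M)
    by (apply Rmult_le_compat; auto using Cmod_ge_0).
  assert (Cmod (g t) * Cmod (f' t - g' t) <= M' * (K' * N t))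
    by (apply Rmult_le_compat; auto using Cmod_ge_0). lra.
Qed.

Lemma close_inv S N (f g : C -> C) m : 0 < m -> (forall t, S t -> m <= Cmod (f t)) ->
  (forall t, S t -> m <= Cmod (g t)) -> close_on S N f g ->
  close_on S N (fun t => / f t)%C (fun t => / g t)%C.
Proof.
  intros Hm Hf Hg [A [B [K [HK H]]]].
  split; [now apply bounded_inv with m|]. split; [now apply bounded_inv with m|].
  exists (/ (m * m) * K). split; [apply Rmult_le_pos; auto; left; apply Rinv_0_lt_compat; nra|].
  intros t Ht. specialize (Hf t Ht). specialize (Hg t Ht). specialize (H t Ht).
  assert (f t <> RtoC 0) by (apply Cmod_pos_neq_0; lra).
  assert (g t <> RtoC 0) by (apply Cmod_pos_neq_0; lra).
  replace (/ f t - / g t)%C with (/ (f t * g t) * - (f t - g t))%C by (field; auto).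
  rewrite Cmod_mult, Cmod_opp, Cmod_inv, Cmod_mult by (now apply Cmult_neq_0).
  rewrite Rmult_assoc. apply Rmult_le_compat; auto using Cmod_ge_0.
  - left. apply Rinv_0_lt_compat. nra.
  - apply Rinv_le_contravar; [nra|]. apply Rmult_le_compat; lra.
Qed.

Lemma close_div S N (f g f' g' : C -> C) m : 0 < m -> (forall t, S t -> m <= Cmod (f' t)) ->
  (forall t, S t -> m <= Cmod (g' t)) -> close_on S N f g -> close_on S N f' g' ->
  close_on S N (fun t => f t / f' t)%C (fun t => g t / g' t)%C.
Proof. intros. apply close_mult; [easy|]. now apply close_inv with m. Qed.

Lemma close_ext (S : C -> Prop) N f g f' g' : (forall t, S t -> f t = f' t) -> (forall t, S t -> g t = g' t) ->
  close_on S N f g -> close_on S N f' g'.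
Proof.
  intros Ef Eg [[M A] [[M' B] [K [HK H]]]]. split; [|split].
  - exists M. intros t Ht. rewrite <- Ef; auto.
  - exists M'. intros t Ht. rewrite <- Eg; auto.
  - exists K. split; [easy|]. intros t Ht. rewrite <- Ef, <- Eg; auto.
Qed.

(* With a = (Theta_0 - Theta_1 + Theta_oo) / 2, b = (Theta_0 - Theta_1 - Theta_oo) / 2,
   B = b^2 and Theta_0 + Theta_1 = 1 - i g, the product
   (z + Theta_0) (z + (Theta_0 + Theta_1 + Theta_oo) / 2) is [Qz a B g z]. *)
Definition Qz (a B : C) (g : R) (z : C) : C :=
  ((z + (1 - Ci * g + a) / 2) * (z + (1 - Ci * g + a) / 2) - B / 4)%C.
Definition ode_y (a : C) (g : R) (t y z yd : C) : Prop :=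
  (t * yd = t * y - 2 * z * (y - 1) ^ 2 - (y - 1) * (a * y - (a + 1 - Ci * g)))%C.
Definition ode_z (a B : C) (g : R) (t y z zd : C) : Prop :=
  (t * zd = y * z * (z + a) - 1 / y * Qz a B g z)%C.

Definition solves (a B : C) (g : R) (S : C -> Prop) (y z : C -> C) : Prop :=
  forall t, S t -> exists yd zd, lder y t yd /\ lder z t zd /\
    ode_y a g t (y t) (z t) yd /\ (y t <> RtoC 0 -> ode_z a B g t (y t) (z t) zd).

(* v = y z (z + a) / t and v - z stay regular at the poles of y. *)
Definition vv (a : C) (y z : C -> C) (t : C) : C := (y t * (z t * (z t + a)) / t)%C.
Definition pp (a : C) (y z : C -> C) (t : C) : C := (vv a y z t - z t)%C.

(** Coefficients of the expansion in 1/t displayed in [lder_vv_pp]. The extra term of [hp] stems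
    from Q / y in the second equation, since 1 / y = z (z + a) / (t v). *)
Definition kk (a : C) (g : R) : C := (2 * a - Ci * g)%C.
Definition hv (a B : C) (g : R) (z : C) : C :=
  (- (z * (z + a) * (2 * z + (a + 1 - Ci * g))) - (2 * z + a) * Qz a B g z)%C.
Definition hp (a B : C) (g : R) (z v : C) : C :=
  (hv a B g z + z * (z + a) * Qz a B g z * / v)%C.

Lemma vv_neq_0 a y z t : t <> RtoC 0 -> vv a y z t <> RtoC 0 ->
  y t <> RtoC 0 /\ z t <> RtoC 0 /\ (z t + a)%C <> RtoC 0.
Proof.
  unfold vv, Cdiv. intros Ht H. repeat split; intros E; apply H; rewrite E; ring.
Qed.

(** The reason for the choice of v: the contributions - 2 z y^2 and - a y^2 of the first equation
    cancel against y (2 z + a) times y z (z + a) of the second, so v' is free of positive powers of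
    y other than through v. As z' = v + O(1/t^2), the term v drops out of (v - z)'. *)
Lemma lder_vv_pp a B g y z t yd zd : t <> RtoC 0 -> vv a y z t <> RtoC 0 ->
  lder y t yd -> lder z t zd -> ode_y a g t (y t) (z t) yd -> ode_z a B g t (y t) (z t) zd ->
  lder (vv a y z) t (vv a y z t + vv a y z t * (4 * z t + kk a g) / t + hv a B g (z t) / t ^ 2)%C /\
  lder (pp a y z) t (vv a y z t * (4 * z t + kk a g) / t + hp a B g (z t) (vv a y z t) / t ^ 2)%C.
Proof.
  intros Ht Hv Ly Lz Ey Ez. destruct (vv_neq_0 _ _ _ _ Ht Hv) as [Hy [Hz Hza]].
  assert (Hyd : yd = ((t * y t - 2 * z t * (y t - 1) ^ 2 - (y t - 1) * (a * y t - (a + 1 - Ci * g))) / t)%C).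
  { rewrite <- Ey. field. auto. }
  assert (Hzd : zd = ((y t * z t * (z t + a) - 1 / y t * Qz a B g (z t)) / t)%C).
  { rewrite <- Ez. field. auto. }
  assert (Lv : lder (vv a y z) t (vv a y z t + vv a y z t * (4 * z t + kk a g) / t + hv a B g (z t) / t ^ 2)%C).
  { eapply lder_eq.
    - unfold vv. apply lder_div; [exact Ht| |apply lder_id].
      apply lder_mult; [exact Ly|]. apply lder_mult; [exact Lz|].
      apply lder_plus; [exact Lz | apply lder_const].
    - rewrite Hyd, Hzd. unfold vv, hv, kk. generalize (Qz a B g (z t)). intros Q. field. auto. }
  split; [exact Lv|].
  eapply lder_eq; [apply lder_minus; [exact Lv | exact Lz]|].
  rewrite Hzd. unfold hp, hv, kk, vv. generalize (Qz a B g (z t)). intros Q. field. auto.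
Qed.

(** * Propagation of asymptotics across a strip *)

Definition lnq (x : R) : R := ln x / x.

Lemma lnq_small K e : 0 < e -> exists T, forall x, T < x -> K * lnq x <= e.
Proof.
  intros He. pose proof is_lim_div_ln_p as H. apply is_lim_spec in H.
  assert (He' : 0 < e / (Rabs K + 1)).
  { apply Rdiv_lt_0_compat; auto. pose proof (Rabs_pos K). lra. }
  destruct (H (mkposreal _ He')) as [T HT]. exists T. intros x Hx.
  specialize (HT x Hx). simpl in HT. rewrite Rminus_0_r in HT. unfold lnq.
  eapply Rle_trans; [apply Rle_abs|]. rewrite Rabs_mult.
  pose proof (Rabs_pos K). pose proof (Rabs_pos (ln x / x)).
  apply Rle_trans with ((Rabs K + 1) * (e / (Rabs K + 1))).
  - apply Rmult_le_compat; lra.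
  - right. field. lra.
Qed.

Lemma inv_le_lnq x : 3 < x -> / x <= lnq x.
Proof.
  intros Hx. unfold lnq, Rdiv. rewrite <- (Rmult_1_l (/ x)) at 1.
  apply Rmult_le_compat_r; [left; apply Rinv_0_lt_compat; lra|].
  rewrite <- (ln_exp 1). apply ln_le; [apply exp_pos|]. pose proof exp_le_3. lra.
Qed.

Lemma lnq_pos x : 3 < x -> 0 < lnq x.
Proof. intros Hx. pose proof (inv_le_lnq x Hx). assert (0 < / x) by (apply Rinv_0_lt_compat; lra). lra. Qed.

Lemma continuous_Rcontinuous f s : continuous f s <-> Rcontinuous_at f s.
Proof.
  split.
  - intros H e He. destruct (proj1 (filterlim_locally _ _) H (mkposreal e He)) as [d Hd].
    exists d. split; [apply cond_pos|]. intros x Hx. apply (Hd x Hx).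
  - intros H. apply filterlim_locally. intros e. destruct (H e (cond_pos e)) as [d [Hd G]].
    exists (mkposreal d Hd). intros x Hx. apply (G x Hx).
Qed.

Lemma continuous_Cmod_minus (f : R -> C) c s : Rcont f s -> continuous (fun x => Cmod (f x - c)%C) s.
Proof.
  intros H. apply continuous_Rcontinuous. intros e He. destruct (H e He) as [d [Hd G]].
  exists d. split; [easy|]. intros x Hx. specialize (G x Hx).
  apply Rabs_def1.
  - pose proof (Cmod_triangle (f s - c) (f x - f s)).
    replace (f s - c + (f x - f s))%C with (f x - c)%C in H0 by ring. lra.
  - pose proof (Cmod_triangle (f x - c) (- (f x - f s))).
    replace (f x - c + - (f x - f s))%C with (f s - c)%C in H0 by ring. rewrite Cmod_opp in H0. lra.
Qed.

Lemma continuous_le_limit (F : R -> R) (s : R) : continuous F s ->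
  (forall eta, 0 < eta -> exists h, Rabs (h - s) < eta /\ F h <= 0) -> F s <= 0.
Proof.
  intros H K. apply continuous_Rcontinuous in H. apply Rnot_lt_le. intros Hp.
  destruct (H (F s) Hp) as [d [Hd G]]. destruct (K d Hd) as [h [Hh Fh]].
  specialize (G h Hh). apply Rabs_def2 in G. lra.
Qed.

Lemma continuous_lnq_affine (u v s : R) : 0 < u + s * v -> continuous (fun x => lnq (u + x * v)) s.
Proof. intros H. apply @ex_derive_continuous. unfold lnq. auto_derive. lra. Qed.

Lemma cRder_segment_le (f : R -> C) (l : R -> C) (s D : R) : 0 <= s ->
  (forall x, 0 <= x <= s -> cRder f x (l x) /\ Cmod (l x) <= D) -> Cmod (f s - f 0) <= D * s.
Proof.
  intros Hs H. replace (D * s) with (D * s - D * 0) by ring.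
  apply (cRder_norm_le f l (fun x => D * x) (fun _ => D)); [easy|].
  intros x Hx. destruct (H x Hx) as [A B]. split; [easy|]. split; [|easy].
  auto_derive; [easy|ring].
Qed.

Lemma strip_Cmod eps x T t : eps = 1 \/ eps = -1 -> strip eps x T t -> eps * Im t <= Cmod t.
Proof.
  intros Heps _. eapply Rle_trans; [|apply im_le_Cmod].
  destruct Heps as [-> | ->]; [rewrite Rmult_1_l; apply Rle_abs|].
  rewrite <- Rabs_Ropp. replace (-1 * Im t) with (- Im t) by ring. apply Rle_abs.
Qed.

Lemma strip_neq_0 eps x T t : 0 <= T -> strip eps x T t -> t <> RtoC 0.
Proof. intros HT [_ H] E. rewrite E in H. unfold Im in H; simpl in H. lra. Qed.

Definition strip_conclusion (a : C) (p kap : C) (X : C -> C) (eps x1 : R) (good : C -> Prop)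
    (y z : C -> C) (K T : R) : Prop :=
  forall t, Rabs (Re t) <= x1 -> T < eps * Im t -> good t ->
    Cmod (vv a y z t - kap * X t) <= K * lnq (eps * Im t) /\
    Cmod (pp a y z t - p) <= K * lnq (eps * Im t).

(* Along horizontal segments v / X and v - z vary by O(1/t) only, so the asymptotics
   propagate from the line Re t = x1 through the regions excluded from D2. *)
Lemma strip_estimate a B g (p kap nu : C) (X : C -> C) eps x1 T0 (good : C -> Prop)
    (y z : C -> C) m M K0 :
  eps = 1 \/ eps = -1 -> 0 < x1 -> 0 < m -> kap <> RtoC 0 ->
  (forall t, strip eps (x1 + 1) T0 t -> lder X t (X t * (1 - nu / t))%C /\ m <= Cmod (X t) <= M) ->
  (forall t, strip eps (x1 + 1) T0 t -> punctured good t) ->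
  solves a B g (fun t => strip eps (x1 + 1) T0 t /\ good t) y z ->
  (forall t, strip eps (x1 + 1) T0 t -> good t -> Re t = x1 ->
     Cmod (vv a y z t - kap * X t) <= K0 * lnq (eps * Im t) /\
     Cmod (pp a y z t - p) <= K0 * lnq (eps * Im t)) ->
  exists K T, 0 <= K /\ T0 <= T /\ 3 <= T /\ strip_conclusion a p kap X eps x1 good y z K T.
Proof.
  intros Heps Hx1 Hm Hkap HX Hgood Hsol Hstart.
  set (k0 := Cmod kap). assert (Hk0 : 0 < k0) by now apply Cmod_pos.
  set (T1 := Rmax T0 3). assert (HT0 : T0 <= T1) by apply Rmax_l. assert (HT3 : 3 <= T1) by apply Rmax_r.
  set (str := strip eps (x1 + 1) T1).
  assert (Hstr : forall t, str t -> strip eps (x1 + 1) T0 t) by (intros t [A A']; split; lra).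
  (* Relative error of v. Since X' / X = 1 - nu / t, the leading term of v' = v + O(1/t) cancels in
     r'. *)
  set (r := fun t => (vv a y z t / (kap * X t))%C).
  assert (Ht0 : forall t, str t -> t <> RtoC 0) by (intros t; apply strip_neq_0; lra).
  assert (HX0 : forall t, str t -> X t <> RtoC 0).
  { intros t Ht. destruct (HX t (Hstr t Ht)) as [_ [H _]]. apply Cmod_pos_neq_0. lra. }
  assert (HkX : forall t, str t -> (kap * X t)%C <> RtoC 0).
  { intros t Ht. apply Cmult_neq_0; auto. }
  (* A priori region: total error at most 1/2 keeps r away from 0, hence v, 1 / v, z and all
     coefficients are bounded there by constants that do not depend on the segment considered. *)
  set (S := fun t => str t /\ good t /\ Cmod (pp a y z t - p) + Cmod (r t - 1) <= 1 / 2).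
  assert (Bp : bounded_on S (pp a y z)).
  { exists (Cmod p + 1 / 2). intros t [_ [_ H]].
    pose proof (Cmod_triangle p (pp a y z t - p)).
    replace (p + (pp a y z t - p))%C with (pp a y z t) in H0 by ring.
    pose proof (Cmod_ge_0 (r t - 1)). lra. }
  assert (Br : bounded_on S r).
  { exists (3 / 2). intros t [_ [_ H]].
    pose proof (Cmod_triangle 1 (r t - 1)). rewrite Cmod_1 in H0.
    replace (1 + (r t - 1))%C with (r t) in H0 by ring.
    pose proof (Cmod_ge_0 (pp a y z t - p)). lra. }
  assert (Lr : forall t, S t -> 1 / 2 <= Cmod (r t)).
  { intros t [_ [_ H]]. pose proof (Cmod_triangle (r t) (- (r t - 1))). rewrite Cmod_opp in H0.
    replace (r t + - (r t - 1))%C with (RtoC 1) in H0 by ring. rewrite Cmod_1 in H0.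
    pose proof (Cmod_ge_0 (pp a y z t - p)). lra. }
  assert (BX : bounded_on S X).
  { exists M. intros t [Ht _]. apply (HX t (Hstr t Ht)). }
  assert (Ev : forall t, str t -> vv a y z t = (kap * X t * r t)%C).
  { intros t Ht. unfold r. field. split; auto. }
  assert (Bv : bounded_on S (vv a y z)).
  { destruct (bounded_mult S _ _ (bounded_mult S _ _ (bounded_const S kap) BX) Br) as [C0 HC0].
    exists C0. intros t Ht. rewrite Ev by apply Ht. now apply HC0. }
  assert (Lv : forall t, S t -> k0 * m / 2 <= Cmod (vv a y z t)).
  { intros t Ht. rewrite Ev, !Cmod_mult by apply Ht. fold k0. specialize (Lr t Ht).
    destruct (HX t (Hstr t (proj1 Ht))) as [_ [H _]].
    assert (k0 * m <= k0 * Cmod (X t)) by nra.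
    assert (k0 * Cmod (X t) * (1 / 2) <= k0 * Cmod (X t) * Cmod (r t)) by (apply Rmult_le_compat_l; nra).
    lra. }
  assert (Hkm : 0 < k0 * m / 2) by nra.
  assert (Biv : bounded_on S (fun t => / vv a y z t)%C) by now apply bounded_inv with (k0 * m / 2).
  assert (Bit : bounded_on S (fun t => / t)%C).
  { apply bounded_inv with 3; [lra|]. intros t [Ht _]. pose proof (strip_Cmod _ _ _ _ Heps Ht).
    destruct Ht as [_ Ht]. lra. }
  assert (Bz : bounded_on S z).
  { destruct (bounded_minus S _ _ Bv Bp) as [C0 HC0]. exists C0. intros t Ht. specialize (HC0 t Ht).
    cbv beta in HC0. unfold pp in HC0.
    now replace (vv a y z t - (vv a y z t - z t))%C with (z t) in HC0 by ring. }
  assert (BQ : bounded_on S (fun t => Qz a B g (z t))).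
  { unfold Qz. repeat first [exact Bz | apply bounded_minus | apply bounded_plus | apply bounded_mult | apply bounded_const]. }
  assert (Bhv : bounded_on S (fun t => hv a B g (z t))).
  { unfold hv. repeat first [exact Bz | exact BQ | apply bounded_minus | apply bounded_opp | apply bounded_plus | apply bounded_mult | apply bounded_const]. }
  assert (Bhp : bounded_on S (fun t => hp a B g (z t) (vv a y z t))).
  { unfold hp. repeat first [exact Bz | exact BQ | exact Bhv | exact Biv | apply bounded_plus | apply bounded_mult | apply bounded_const]. }
  assert (B1 : bounded_on S (fun t => vv a y z t * (4 * z t + kk a g) + hp a B g (z t) (vv a y z t) * / t)%C).
  { repeat first [exact Bz | exact Bv | exact Bhp | exact Bit | apply bounded_plus | apply bounded_mult | apply bounded_const]. }
  assert (B2 : bounded_on S (fun t => r t * (4 * z t + kk a g + nu + hv a B g (z t) * / vv a y z t * / t))%C).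
  { repeat first [exact Bz | exact Biv | exact Br | exact Bhv | exact Bit | apply bounded_plus | apply bounded_mult | apply bounded_const]. }
  destruct (bounded_nonneg _ _ B1) as [C1 [HC1 G1]]. destruct (bounded_nonneg _ _ B2) as [C2 [HC2 G2]].
  assert (Hgood' : forall t, str t -> punctured good t) by (intros; apply Hgood; auto).
  assert (Hdiff : forall t, str t -> good t -> (exists l, lder (pp a y z) t l) /\ (exists l, lder r t l)).
  { intros t Ht Gt. destruct (Hsol t (conj (Hstr t Ht) Gt)) as [yd [zd [Ly [Lz _]]]].
    assert (Lv' : exists l, lder (vv a y z) t l).
    { eexists. unfold vv. apply lder_div; [now apply Ht0| |apply lder_id].
      apply lder_mult; [exact Ly|]. apply lder_mult; [exact Lz|].
      apply lder_plus; [exact Lz | apply lder_const]. }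
    destruct Lv' as [l Ll]. split; [eexists; apply lder_minus; eauto|].
    eexists. apply lder_div; [now apply HkX | exact Ll|].
    apply lder_mult; [apply lder_const | apply (HX t (Hstr t Ht))]. }
  assert (Hder : forall t, S t -> exists l1 l2, lder (pp a y z) t l1 /\ lder r t l2 /\
     Cmod l1 <= C1 / (eps * Im t) /\ Cmod l2 <= C2 / (eps * Im t)).
  { intros t Ht. pose proof Ht as [Hs [Gt _]].
    destruct (Hsol t (conj (Hstr t Hs) Gt)) as [yd [zd [Ly [Lz [Ey Ez]]]]].
    assert (Nv : vv a y z t <> RtoC 0) by (apply Cmod_pos_neq_0; specialize (Lv t Ht); lra).
    pose proof (Ht0 t Hs) as Nt. pose proof (HX0 t Hs) as NX.
    destruct (vv_neq_0 _ _ _ _ Nt Nv) as [Ny _].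
    destruct (lder_vv_pp a B g y z t yd zd Nt Nv Ly Lz Ey (Ez Ny)) as [L1 L2].
    destruct (HX t (Hstr t Hs)) as [LX _].
    assert (Hit : Cmod (/ t) <= / (eps * Im t)).
    { rewrite Cmod_inv by easy. pose proof (strip_Cmod _ _ _ _ Heps Hs). destruct Hs as [_ Hs].
      apply Rinv_le_contravar; lra. }
    exists ((vv a y z t * (4 * z t + kk a g) + hp a B g (z t) (vv a y z t) * / t) * / t)%C.
    exists (r t * (4 * z t + kk a g + nu + hv a B g (z t) * / vv a y z t * / t) * / t)%C.
    split; [|split; [|split]].
    - eapply lder_eq; [exact L2 | field; auto].
    - eapply lder_eq.
      + apply lder_div; [now apply HkX | exact L1|]. apply lder_mult; [apply lder_const | exact LX].
      + unfold r. field. auto.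
    - rewrite Cmod_mult. apply Rmult_le_compat; auto using Cmod_ge_0.
    - rewrite Cmod_mult. apply Rmult_le_compat; auto using Cmod_ge_0. }
  set (E := fun t => Cmod (pp a y z t - p) + Cmod (r t - 1)).
  set (K1 := K0 + K0 / (k0 * m)). set (Cd := C1 + C2).
  (* The initial error and the drift over a length of at most 2 x1 are each kept below 1/8, so that
     the a priori bound 1/2 improves to 1/4. *)
  destruct (lnq_small K1 (1 / 8)) as [T2 HT2]; [lra|].
  destruct (lnq_small (Cd * (2 * x1)) (1 / 8)) as [T3 HT3']; [lra|].
  (* The extra 1 leaves room for the vertical shift h < 1 of the horizontal segment. *)
  set (T := Rmax T1 (Rmax T2 T3) + 1).
  assert (HT : T1 + 1 <= T /\ T2 + 1 <= T /\ T3 + 1 <= T).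
  { unfold T. pose proof (Rmax_l T1 (Rmax T2 T3)). pose proof (Rmax_r T1 (Rmax T2 T3)).
    pose proof (Rmax_l T2 T3). pose proof (Rmax_r T2 T3). lra. }
  assert (HE0 : forall t, str t -> good t -> Re t = x1 -> E t <= K1 * lnq (eps * Im t)).
  { intros t Ht Gt Rt. destruct (Hstart t (Hstr t Ht) Gt Rt) as [H1 H2].
    assert (Er : (r t - 1 = (vv a y z t - kap * X t) / (kap * X t))%C).
    { unfold r. field. pose proof (HX0 t Ht). auto. }
    unfold E, K1. rewrite Er, Cmod_div, Cmod_mult by now apply HkX. fold k0.
    destruct (HX t (Hstr t Ht)) as [_ [H _]].
    assert (0 < k0 * m) by nra.
    assert (Cmod (vv a y z t - kap * X t) / (k0 * Cmod (X t)) <= K0 * lnq (eps * Im t) * / (k0 * m)).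
    { apply Rmult_le_compat; auto using Cmod_ge_0.
      - left. apply Rinv_0_lt_compat. nra.
      - apply Rinv_le_contravar; nra. }
    replace ((K0 + K0 / (k0 * m)) * lnq (eps * Im t)) with
      (K0 * lnq (eps * Im t) + K0 * lnq (eps * Im t) * / (k0 * m)) by (unfold Rdiv; ring). lra. }
  set (K2 := K1 + Cd * (2 * x1)).
  assert (Main : forall t, Rabs (Re t) <= x1 -> T < eps * Im t -> good t -> E t <= K2 * lnq (eps * Im t)).
  { intros t Hx Hy Gt. pose proof (Rabs_le_between (Re t) x1) as HR. apply HR in Hx. clear HR.
    set (L := x1 - Re t). assert (HL : 0 <= L <= 2 * x1) by (unfold L; lra).
    set (d := (- (1))%C).
    assert (Hd : Cmod d = 1) by (unfold d; rewrite Cmod_opp; apply Cmod_1).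
    assert (Rd : Re d = -1) by (unfold d, Re; simpl; ring).
    assert (Id : Im d = 0) by (unfold d, Im; simpl; ring).
    assert (Rid : Re (Ci * d) = 0) by (unfold d, Re; simpl; ring).
    assert (Iid : Im (Ci * d) = -1) by (unfold d, Im; simpl; ring).
    assert (He1 : Rabs eps = 1) by (destruct Heps as [-> | ->]; [apply Rabs_R1 | rewrite Rabs_left; lra]).
    assert (Hpar : forall (h s : R), 0 <= h < 1 -> 0 <= s <= L ->
       str (t + h * (Ci * d) + (s - L) * d)%C /\
       eps * Im (t + h * (Ci * d) + (s - L) * d)%C = eps * Im t + h * - eps /\
       T - 1 < eps * Im t + h * - eps).
    { intros h s Hh Hs. rewrite <- RtoC_minus.
      assert (E1 : eps * Im (t + h * (Ci * d) + RtoC (s - L) * d)%C = eps * Im t + h * - eps).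
      { rewrite !Im_shift, Id, Iid. ring. }
      assert (T - 1 < eps * Im t + h * - eps) by (destruct Heps as [-> | ->]; lra).
      split; [|auto]. split; [|rewrite E1; lra].
      rewrite !Re_shift, Rid, Rd. unfold L in *. apply Rabs_lt_between. lra. }
    (* The horizontal segment from the line Re t = x1 to t may pass through bad points. The estimate
       is proved on parallel segments at arbitrarily small height h and carried to h = 0 by
       continuity of F, t itself being good. *)
    set (F := fun x : R => E (t + x * (Ci * d))%C - K2 * lnq (eps * Im t + x * - eps)).
    assert (HF : F 0 <= 0).
    { apply continuous_le_limit.
      - destruct (Hpar 0 L) as [P1 _]; [lra|lra|].
        replace (t + RtoC 0 * (Ci * d) + (L - L) * d)%C with (t + RtoC 0 * (Ci * d))%C in P1 by ring.
        destruct (Hdiff (t + RtoC 0 * (Ci * d))%C P1) as [[l1 Hl1] [l2 Hl2]].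
        { now replace (t + RtoC 0 * (Ci * d))%C with t by ring. }
        unfold F, E. apply @continuous_minus.
        + apply @continuous_plus.
          * apply (continuous_Cmod_minus (fun x : R => pp a y z (t + x * (Ci * d))%C)).
            eapply lder_Rcont; eauto.
          * apply (continuous_Cmod_minus (fun x : R => r (t + x * (Ci * d))%C)).
            eapply lder_Rcont; eauto.
        + apply (continuous_scal (fun _ => K2) (fun x => lnq (eps * Im t + x * - eps)));
            [apply continuous_const | apply continuous_lnq_affine; lra].
      - intros eta Heta.
        destruct (generic_parallel good (t + - L * d)%C d L (Rmin eta 1)) as [h [Hh Gh]]; [easy | | |].
        + apply Rmin_glb_lt; lra.
        + intros s Hs. apply Hgood'. destruct (Hpar 0 s) as [P1 _]; [lra|easy|].
          now replace (t + - L * d + s * d)%C with (t + RtoC 0 * (Ci * d) + (s - L) * d)%C by ring.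
        + pose proof (Rmin_l eta 1). pose proof (Rmin_r eta 1).
          exists h. split; [rewrite Rminus_0_r, Rabs_right; lra|].
          set (t0 := (t + - L * d + h * (Ci * d))%C).
          set (tau := eps * Im t + h * - eps).
          assert (Hs' : forall s : R, 0 <= s <= L -> str (t0 + s * d)%C /\ eps * Im (t0 + s * d)%C = tau
                     /\ T - 1 < tau /\ good (t0 + s * d)%C).
          { intros s Hs. destruct (Hpar h s) as [P1 [P2 P3]]; [lra|easy|]. specialize (Gh s Hs).
            replace (t + h * (Ci * d) + (s - L) * d)%C with (t0 + s * d)%C in P1, P2 by (unfold t0; ring).
            auto. }
          assert (Htau : T - 1 < tau) by apply (Hs' 0 ltac:(lra)).
          assert (Htp : 0 < tau) by lra.
          set (e := fun s : R => E (t0 + s * d)%C).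
          assert (He0 : e 0 <= K1 * lnq tau).
          { destruct (Hs' 0 ltac:(lra)) as [Q1 [Q2 [Q3 Q4]]]. unfold e. rewrite <- Q2.
            apply HE0; auto. unfold t0. rewrite !Re_shift. 
            replace (t + - L * d)%C with (t + RtoC (- L) * d)%C by (rewrite RtoC_opp; ring).
            rewrite Re_shift, Rd, Rid. unfold L. ring. }
          assert (Hk1 : K1 * lnq tau <= 1 / 8) by (apply HT2; lra).
          assert (Hk2 : Cd * (2 * x1) * lnq tau <= 1 / 8) by (apply HT3'; lra).
          assert (HC : 0 <= Cd) by (unfold Cd; lra).
          assert (Hstep : forall s, 0 <= s <= L -> (forall x, 0 <= x <= s -> e x <= 1 / 2) ->
            e s <= K1 * lnq tau + Cd * (2 * x1) * lnq tau).
          { intros s Hs Hle.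
            assert (Hex : forall x : R, exists l : C * C, 0 <= x <= s ->
               lder (pp a y z) (t0 + x * d)%C (fst l) /\ lder r (t0 + x * d)%C (snd l) /\
               Cmod (fst l) <= C1 / tau /\ Cmod (snd l) <= C2 / tau).
            { intros x. destruct (classic (0 <= x <= s)) as [Hx'|Hx']; [|exists (RtoC 0, RtoC 0); tauto].
              destruct (Hs' x ltac:(lra)) as [Q1 [Q2 [Q3 Q4]]].
              destruct (Hder (t0 + x * d)%C) as [l1 [l2 H']].
              { split; [easy|]. split; [easy|]. now apply Hle. }
              rewrite Q2 in H'. exists (l1, l2). now intros _. }
            set (l := fun x => proj1_sig (constructive_indefinite_description _ (Hex x))).
            assert (Hl : forall x : R, 0 <= x <= s ->
               lder (pp a y z) (t0 + x * d)%C (fst (l x)) /\ lder r (t0 + x * d)%C (snd (l x)) /\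
               Cmod (fst (l x)) <= C1 / tau /\ Cmod (snd (l x)) <= C2 / tau).
            { intros x. exact (proj2_sig (constructive_indefinite_description _ (Hex x))). }
            assert (D1 : Cmod (pp a y z (t0 + s * d)%C - pp a y z (t0 + RtoC 0 * d)%C) <= C1 / tau * s).
            { apply (cRder_segment_le (fun x : R => pp a y z (t0 + x * d)%C) (fun x => d * fst (l x))%C); [lra|].
              intros x Hx'. destruct (Hl x Hx') as [Q1 [Q2 [Q3 Q4]]]. split; [now apply Q1|].
              now rewrite Cmod_mult, Hd, Rmult_1_l. }
            assert (D2 : Cmod (r (t0 + s * d)%C - r (t0 + RtoC 0 * d)%C) <= C2 / tau * s).
            { apply (cRder_segment_le (fun x : R => r (t0 + x * d)%C) (fun x => d * snd (l x))%C); [lra|].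
              intros x Hx'. destruct (Hl x Hx') as [Q1 [Q2 [Q3 Q4]]]. split; [now apply Q2|].
              now rewrite Cmod_mult, Hd, Rmult_1_l. }
            assert (D3 : C1 / tau * s + C2 / tau * s <= Cd * (2 * x1) * lnq tau).
            { replace (C1 / tau * s + C2 / tau * s) with (Cd * s * / tau) by (unfold Cd, Rdiv; ring).
              apply Rmult_le_compat.
              - apply Rmult_le_pos; lra.
              - left. now apply Rinv_0_lt_compat.
              - apply Rmult_le_compat_l; lra.
              - apply inv_le_lnq. lra. }
            unfold e, E in *.
            pose proof (Cmod_triangle (pp a y z (t0 + RtoC 0 * d)%C - p)
              (pp a y z (t0 + s * d)%C - pp a y z (t0 + RtoC 0 * d)%C)) as Z1.
            replace (pp a y z (t0 + RtoC 0 * d) - p + (pp a y z (t0 + s * d) - pp a y z (t0 + RtoC 0 * d)))%C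
              with (pp a y z (t0 + s * d) - p)%C in Z1 by ring.
            pose proof (Cmod_triangle (r (t0 + RtoC 0 * d)%C - 1)
              (r (t0 + s * d)%C - r (t0 + RtoC 0 * d)%C)) as Z2.
            replace (r (t0 + RtoC 0 * d) - 1 + (r (t0 + s * d) - r (t0 + RtoC 0 * d)))%C
              with (r (t0 + s * d) - 1)%C in Z2 by ring.
            lra. }
          assert (Hquarter : forall s, 0 <= s <= L -> e s <= 1 / 4).
          { apply continuity_bootstrap.
            - intros s Hs. apply continuous_Rcontinuous.
              destruct (Hs' s Hs) as [Q1 [Q2 [Q3 Q4]]].
              destruct (Hdiff _ Q1 Q4) as [[l1 Hl1] [l2 Hl2]].
              unfold e, E. apply @continuous_plus.
              + apply (continuous_Cmod_minus (fun x : R => pp a y z (t0 + x * d)%C)).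
                eapply lder_Rcont; eauto.
              + apply (continuous_Cmod_minus (fun x : R => r (t0 + x * d)%C)).
                eapply lder_Rcont; eauto.
            - lra.
            - intros s Hs Hle. specialize (Hstep s Hs Hle). lra. }
          assert (HeL : e L <= K2 * lnq tau).
          { unfold K2. rewrite Rmult_plus_distr_r. apply Hstep; [lra|]. intros x Hx'.
            specialize (Hquarter x Hx'). lra. }
          unfold F. fold tau. unfold e in HeL.
          replace (t0 + L * d)%C with (t + h * (Ci * d))%C in HeL by (unfold t0; ring). lra. }
    unfold F in HF. replace (t + RtoC 0 * (Ci * d))%C with t in HF by ring.
    rewrite Rmult_0_l, Rplus_0_r in HF. lra. }
  (* K2 serves for v - z, and k0 M K2 for v because v - kap X = kap X (r - 1). *)
  exists (Rmax 0 (Rmax K2 (k0 * M * K2))), T.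
  split; [apply Rmax_l|]. split; [lra|]. split; [lra|].
  intros t Hx Hy Gt. specialize (Main t Hx Hy Gt). unfold E in Main.
  assert (Hs : str t) by (split; lra).
  pose proof (lnq_pos (eps * Im t) ltac:(lra)) as Lp.
  pose proof (Rmax_r 0 (Rmax K2 (k0 * M * K2))) as R0.
  pose proof (Rmax_l K2 (k0 * M * K2)) as R1. pose proof (Rmax_r K2 (k0 * M * K2)) as R2.
  pose proof (Cmod_ge_0 (r t - 1)). pose proof (Cmod_ge_0 (pp a y z t - p)). split.
  - apply Rle_trans with (k0 * M * K2 * lnq (eps * Im t)).
    + replace (vv a y z t - kap * X t)%C with (kap * X t * (r t - 1))%C by (rewrite Ev by easy; ring).
      rewrite !Cmod_mult. fold k0. destruct (HX t (Hstr t Hs)) as [_ [H1 H2]].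
      rewrite (Rmult_assoc (k0 * M)). apply Rmult_le_compat; try lra.
      * apply Rmult_le_pos; [lra | apply Cmod_ge_0].
      * apply Rmult_le_compat_l; lra.
    + apply Rmult_le_compat_r; lra.
  - apply Rle_trans with (K2 * lnq (eps * Im t)); [lra|]. apply Rmult_le_compat_r; lra.
Qed.

(** * Uniqueness at infinity *)

Definition small_on (S : C -> Prop) (N : C -> R) (f : C -> C) : Prop :=
  exists K, 0 <= K /\ forall t, S t -> Cmod (f t) <= K * N t.

Lemma small_close S N f g : close_on S N f g -> small_on S N (fun t => f t - g t)%C.
Proof. now intros [_ [_ H]]. Qed.

Lemma small_plus S N f g : small_on S N f -> small_on S N g -> small_on S N (fun t => f t + g t)%C.
Proof.
  intros [K [HK H]] [K' [HK' H']]. exists (K + K'). split; [lra|]. intros t Ht.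
  eapply Rle_trans; [apply Cmod_triangle|]. specialize (H t Ht). specialize (H' t Ht). lra.
Qed.

Lemma small_opp S N f : small_on S N f -> small_on S N (fun t => - f t)%C.
Proof. intros [K [HK H]]. exists K. split; [easy|]. intros t Ht. rewrite Cmod_opp. auto. Qed.

Lemma small_minus S N f g : small_on S N f -> small_on S N g -> small_on S N (fun t => f t - g t)%C.
Proof. intros H H'. apply small_plus; [easy | now apply small_opp]. Qed.

Lemma small_mult S N f g : bounded_on S f -> small_on S N g -> small_on S N (fun t => f t * g t)%C.
Proof.
  intros H [K [HK H']]. destruct (bounded_nonneg _ _ H) as [M [HM G]].
  exists (M * K). split; [nra|]. intros t Ht. rewrite Cmod_mult, Rmult_assoc.
  apply Rmult_le_compat; auto using Cmod_ge_0.
Qed.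

Lemma Cmod_inv_sq_le (c t : C) (tau D : R) : 0 < tau <= Cmod t -> Cmod c <= D ->
  Cmod (c / t ^ 2) <= D / tau ^ 2.
Proof.
  intros [H1 H2] HD. assert (Nt : t <> RtoC 0) by (apply Cmod_pos_neq_0; lra).
  rewrite Cmod_div, Cmod_pow.
  - unfold Rdiv. apply Rmult_le_compat; auto using Cmod_ge_0.
    + left. apply Rinv_0_lt_compat, pow_lt. lra.
    + apply Rinv_le_contravar; [apply pow_lt; lra | apply pow_incr; lra].
  - simpl. rewrite Cmult_1_r. now apply Cmult_neq_0.
Qed.

Lemma Cmod_over_le (c t : C) (tau D : R) : 0 < tau <= Cmod t -> Cmod c <= D -> Cmod (c / t) <= D / tau.
Proof.
  intros [H1 H2] HD. assert (Nt : t <> RtoC 0) by (apply Cmod_pos_neq_0; lra).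
  rewrite Cmod_div by easy. unfold Rdiv. apply Rmult_le_compat; auto using Cmod_ge_0.
  - left. apply Rinv_0_lt_compat. lra.
  - apply Rinv_le_contravar; lra.
Qed.

Lemma Cmod_minus_triangle (x y : C) : Cmod (x - y) <= Cmod x + Cmod y.
Proof. unfold Cminus. eapply Rle_trans; [apply Cmod_triangle|]. rewrite Cmod_opp. lra. Qed.

(* In terms of P = v - z and v the linearised system has, to order 1/t, only
   oscillating coefficients and a nilpotent mean; subtracting the oscillating
   primitives makes the difference N of two solutions satisfy N' = O(N / t^2),
   up to the nilpotent part. *)
Lemma infinity_unique a B g (p kap : C) (X : C -> C) eps x1 T0 (good : C -> Prop)
    (y1 z1 y2 z2 : C -> C) m M K :
  eps = 1 \/ eps = -1 -> 0 < m -> kap <> RtoC 0 ->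
  (forall t, strip eps x1 T0 t -> m <= Cmod (X t) <= M) ->
  (forall t, strip eps x1 T0 t -> punctured good t) ->
  solves a B g (fun t => strip eps x1 T0 t /\ good t) y1 z1 ->
  solves a B g (fun t => strip eps x1 T0 t /\ good t) y2 z2 ->
  strip_conclusion a p kap X eps x1 good y1 z1 K T0 ->
  strip_conclusion a p kap X eps x1 good y2 z2 K T0 ->
  exists T, T0 <= T /\ 3 <= T /\ forall t, strip eps x1 T t -> good t ->
    vv a y1 z1 t = vv a y2 z2 t /\ z1 t = z2 t /\ vv a y1 z1 t <> RtoC 0.
Proof.
  intros Heps Hm Hkap HX Hgood Sol1 Sol2 Con1 Con2.
  set (k0 := Cmod kap). assert (Hk0 : 0 < k0) by now apply Cmod_pos.
  assert (Hkm : 0 < k0 * m / 2) by nra.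
  set (V1 := vv a y1 z1) in *. set (V2 := vv a y2 z2) in *.
  set (P1 := pp a y1 z1) in *. set (P2 := pp a y2 z2) in *.
  destruct (lnq_small K (Rmin 1 (k0 * m / 2))) as [T2 HT2]; [apply Rmin_glb_lt; lra|].
  set (T1 := Rmax T0 (Rmax 3 T2)).
  assert (HT1 : T0 <= T1 /\ 3 <= T1 /\ T2 <= T1).
  { unfold T1. pose proof (Rmax_l T0 (Rmax 3 T2)). pose proof (Rmax_r T0 (Rmax 3 T2)).
    pose proof (Rmax_l 3 T2). pose proof (Rmax_r 3 T2). lra. }
  set (S := fun t => strip eps x1 T1 t /\ good t).
  assert (HS0 : forall t, S t -> strip eps x1 T0 t /\ good t).
  { intros t [[A A'] G]. split; [split; lra | easy]. }
  assert (Htau : forall t, S t -> 3 < eps * Im t <= Cmod t).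
  { intros t [Ht _]. pose proof (strip_Cmod _ _ _ _ Heps Ht). destruct Ht. lra. }
  assert (Nt : forall t, S t -> t <> RtoC 0).
  { intros t Ht. specialize (Htau t Ht). apply Cmod_pos_neq_0. lra. }
  assert (Kb : forall t, S t -> K * lnq (eps * Im t) <= 1 /\ K * lnq (eps * Im t) <= k0 * m / 2).
  { intros t [[_ Ht] _]. specialize (HT2 (eps * Im t) ltac:(lra)).
    pose proof (Rmin_l 1 (k0 * m / 2)). pose proof (Rmin_r 1 (k0 * m / 2)). lra. }
  assert (Co1 : forall t, S t -> Cmod (V1 t - kap * X t) <= K * lnq (eps * Im t) /\
                                 Cmod (P1 t - p) <= K * lnq (eps * Im t)).
  { intros t Ht. apply Con1; try apply Ht; destruct Ht as [[A A'] G]; lra. }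
  assert (Co2 : forall t, S t -> Cmod (V2 t - kap * X t) <= K * lnq (eps * Im t) /\
                                 Cmod (P2 t - p) <= K * lnq (eps * Im t)).
  { intros t Ht. apply Con2; try apply Ht; destruct Ht as [[A A'] G]; lra. }
  assert (Gv : forall V, (forall t, S t -> Cmod (V t - kap * X t) <= K * lnq (eps * Im t)) ->
     bounded_on S V /\ forall t, S t -> k0 * m / 2 <= Cmod (V t)).
  { intros V HV. split.
    - exists (1 + k0 * M). intros t Ht. specialize (HV t Ht). destruct (Kb t Ht) as [H1 H2].
      pose proof (Cmod_triangle (kap * X t) (V t - kap * X t)) as H3.
      replace (kap * X t + (V t - kap * X t))%C with (V t) in H3 by ring.
      rewrite Cmod_mult in H3. fold k0 in H3. destruct (HX t (proj1 (HS0 t Ht))). nra.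
    - intros t Ht. specialize (HV t Ht). destruct (Kb t Ht) as [H1 H2].
      pose proof (Cmod_minus_triangle (V t) (V t - kap * X t)) as H3.
      replace (V t - (V t - kap * X t))%C with (kap * X t)%C in H3 by ring.
      rewrite Cmod_mult in H3. fold k0 in H3. destruct (HX t (proj1 (HS0 t Ht))). nra. }
  destruct (Gv V1) as [BV1 LV1]; [apply Co1|]. destruct (Gv V2) as [BV2 LV2]; [apply Co2|].
  assert (Gp : forall P, (forall t, S t -> Cmod (P t - p) <= K * lnq (eps * Im t)) -> bounded_on S P).
  { intros P HP. exists (1 + Cmod p). intros t Ht. specialize (HP t Ht). destruct (Kb t Ht) as [H1 H2].
    pose proof (Cmod_triangle p (P t - p)) as H3.
    replace (p + (P t - p))%C with (P t) in H3 by ring. lra. }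
  assert (BP1 : bounded_on S P1) by (apply Gp, Co1). assert (BP2 : bounded_on S P2) by (apply Gp, Co2).
  set (N := fun t => Cmod (V1 t - V2 t) + Cmod (P1 t - P2 t)).
  assert (N0 : forall t, S t -> 0 <= N t).
  { intros t _. unfold N. pose proof (Cmod_ge_0 (V1 t - V2 t)). pose proof (Cmod_ge_0 (P1 t - P2 t)). lra. }
  assert (Cv : close_on S N V1 V2).
  { split; [easy|]. split; [easy|]. exists 1. split; [lra|]. intros t _. unfold N.
    pose proof (Cmod_ge_0 (P1 t - P2 t)). lra. }
  assert (Cp : close_on S N P1 P2).
  { split; [easy|]. split; [easy|]. exists 1. split; [lra|]. intros t _. unfold N.
    pose proof (Cmod_ge_0 (V1 t - V2 t)). lra. }
  assert (Cz : close_on S N z1 z2).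
  { apply close_ext with (fun t => V1 t - P1 t)%C (fun t => V2 t - P2 t)%C.
    - intros t _. unfold P1, pp. fold V1. ring.
    - intros t _. unfold P2, pp. fold V2. ring.
    - now apply close_minus. }
  assert (Cc : forall c, close_on S N (fun _ => c) (fun _ => c)) by (intros; now apply close_const).
  assert (Bit : bounded_on S (fun t => / t)%C).
  { apply bounded_inv with 3; [lra|]. intros t Ht. specialize (Htau t Ht). lra. }
  assert (Cit : close_on S N (fun t => / t)%C (fun t => / t)%C) by now apply close_refl.
  assert (Civ : close_on S N (fun t => / V1 t)%C (fun t => / V2 t)%C)
    by now apply close_inv with (k0 * m / 2).
  assert (CQ : close_on S N (fun t => Qz a B g (z1 t)) (fun t => Qz a B g (z2 t))).
  { unfold Qz. repeat first [exact Cz | apply Cc | apply close_minus | apply close_plus | apply close_mult]. }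
  assert (Chv : close_on S N (fun t => hv a B g (z1 t)) (fun t => hv a B g (z2 t))).
  { unfold hv. repeat first [exact Cz | exact CQ | apply Cc | apply close_opp | apply close_minus
      | apply close_plus | apply close_mult]. }
  assert (Chp : close_on S N (fun t => hp a B g (z1 t) (V1 t)) (fun t => hp a B g (z2 t) (V2 t))).
  { unfold hp. repeat first [exact Cz | exact CQ | exact Chv | exact Civ | apply Cc
      | apply close_plus | apply close_mult]. }
  (* Primitive, to leading order, of the 1/t coefficient V (4 z + k) = 4 V^2 + V (k - 4 P) of P':
     since V' is V up to O(1/t) and P is slow, V integrates to V and 4 V^2 to 2 V^2. Subtracting AA
     / t leaves a derivative of order 1/t^2, with coefficient [GG]. *)
  set (AA := fun (V P : C -> C) t => (2 * V t * V t + V t * (kk a g - 4 * P t))%C).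
  assert (CA : close_on S N (AA V1 P1) (AA V2 P2)).
  { unfold AA. repeat first [exact Cv | exact Cp | apply Cc | apply close_minus
      | apply close_plus | apply close_mult]. }
  set (ee := fun (V z : C -> C) t => (V t * (4 * z t + kk a g) + hv a B g (z t) * / t)%C).
  assert (Ce : close_on S N (ee V1 z1) (ee V2 z2)).
  { unfold ee. repeat first [exact Cv | exact Cz | exact Chv | exact Cit | apply Cc
      | apply close_plus | apply close_mult]. }
  set (GG := fun (V P z : C -> C) t => (hp a B g (z t) (V t) + AA V P t
     - (4 * V t + kk a g - 4 * P t) * ee V z t
     + 4 * V t * (V t * (4 * z t + kk a g) + hp a B g (z t) (V t) * / t))%C).
  assert (CG : close_on S N (GG V1 P1 z1) (GG V2 P2 z2)).
  { unfold GG. repeat first [exact Cv | exact Cz | exact Cp | exact Chp | exact Cit | exact CA | exact Ce | apply Cc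
      | apply close_minus | apply close_plus | apply close_mult]. }
  set (hh := fun (V z : C -> C) t => (hv a B g (z t) * / V t)%C).
  assert (Ch : close_on S N (hh V1 z1) (hh V2 z2)).
  { unfold hh. apply close_mult; [exact Chv | exact Civ]. }
  (* The quotient removes the growth V' = V: its logarithmic derivative is (4 (z1 - z2) + dh / t) /
     t. In z1 - z2 = dv - dp the part dv oscillates and has a primitive, while dp is controlled
     beforehand through [D1]; this one-way coupling is the nilpotent mean. *)
  set (rho := fun t => (V1 t / V2 t)%C).
  assert (Br : bounded_on S rho).
  { unfold rho, Cdiv. apply bounded_mult; [easy|]. now apply bounded_inv with (k0 * m / 2). }
  set (dh := fun t => (hh V1 z1 t - hh V2 z2 t)%C).
  set (dv := fun t => (V1 t - V2 t)%C). set (dz := fun t => (z1 t - z2 t)%C).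
  set (dp := fun t => (P1 t - P2 t)%C). set (de := fun t => (ee V1 z1 t - ee V2 z2 t)%C).
  assert (Sdh : small_on S N dh) by now apply small_close.
  assert (Sdv : small_on S N dv) by now apply small_close.
  assert (Sde : small_on S N de) by now apply small_close.
  assert (Bdh : bounded_on S dh) by (apply bounded_minus; apply Ch).
  assert (Bdz : bounded_on S dz) by (apply bounded_minus; apply Cz).
  set (RR := fun t => (rho t * dh t - 4 * (rho t * (4 * dz t + dh t * / t)) * dv t
                       - 4 * rho t * de t + 4 * rho t * dv t)%C).
  assert (SR : small_on S N RR).
  { unfold RR. apply small_plus; [apply small_minus; [apply small_minus|]|]; apply small_mult; auto;
      repeat first [exact Br | exact Bdz | exact Bdh | exact Bit | apply bounded_const
        | apply bounded_plus | apply bounded_mult]. }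
  assert (Hd : forall t, S t ->
     lder V1 t (V1 t + V1 t * (4 * z1 t + kk a g) / t + hv a B g (z1 t) / t ^ 2)%C /\
     lder P1 t (V1 t * (4 * z1 t + kk a g) / t + hp a B g (z1 t) (V1 t) / t ^ 2)%C /\
     lder V2 t (V2 t + V2 t * (4 * z2 t + kk a g) / t + hv a B g (z2 t) / t ^ 2)%C /\
     lder P2 t (V2 t * (4 * z2 t + kk a g) / t + hp a B g (z2 t) (V2 t) / t ^ 2)%C /\
     V1 t <> RtoC 0 /\ V2 t <> RtoC 0).
  { intros t Ht. specialize (LV1 t Ht). specialize (LV2 t Ht).
    assert (NV1 : V1 t <> RtoC 0) by (apply Cmod_pos_neq_0; lra).
    assert (NV2 : V2 t <> RtoC 0) by (apply Cmod_pos_neq_0; lra).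
    destruct (Sol1 t (HS0 t Ht)) as [yd1 [zd1 [Ly1 [Lz1 [Ey1 Ez1]]]]].
    destruct (Sol2 t (HS0 t Ht)) as [yd2 [zd2 [Ly2 [Lz2 [Ey2 Ez2]]]]].
    destruct (lder_vv_pp a B g y1 z1 t yd1 zd1 (Nt t Ht) NV1 Ly1 Lz1 Ey1) as [Q1 Q2].
    { apply Ez1. now apply (vv_neq_0 a y1 z1 t (Nt t Ht)). }
    destruct (lder_vv_pp a B g y2 z2 t yd2 zd2 (Nt t Ht) NV2 Ly2 Lz2 Ey2) as [Q3 Q4].
    { apply Ez2. now apply (vv_neq_0 a y2 z2 t (Nt t Ht)). }
    auto 10. }
  assert (EP : forall t, z1 t = (V1 t - P1 t)%C /\ z2 t = (V2 t - P2 t)%C).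
  { intros t. unfold P1, P2, pp. fold V1 V2. split; ring. }
  set (D1 := fun t => ((P1 t - AA V1 P1 t / t) - (P2 t - AA V2 P2 t / t))%C).
  assert (HD1 : forall t, S t -> lder D1 t ((GG V1 P1 z1 t - GG V2 P2 z2 t) / t ^ 2)%C).
  { intros t Ht. destruct (Hd t Ht) as [L1 [L2 [L3 [L4 [N1 N2]]]]]. pose proof (Nt t Ht) as Nt'.
    destruct (EP t) as [E1 E2].
    assert (GA : forall V P z lv lp, lder V t lv -> lder P t lp -> z t = (V t - P t)%C ->
      lv = (V t + V t * (4 * z t + kk a g) / t + hv a B g (z t) / t ^ 2)%C ->
      lp = (V t * (4 * z t + kk a g) / t + hp a B g (z t) (V t) / t ^ 2)%C ->
      lder (fun t => P t - AA V P t / t)%C t (GG V P z t / t ^ 2)%C).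
    { intros V P z lv lp Lv Lp Ez Elv Elp. eapply lder_eq.
      - apply lder_minus; [exact Lp|]. apply lder_div; [easy| |apply lder_id].
        unfold AA. apply lder_plus.
        + apply lder_mult; [apply lder_mult; [apply lder_const | exact Lv] | exact Lv].
        + apply lder_mult; [exact Lv|]. apply lder_minus; [apply lder_const|].
          apply lder_mult; [apply lder_const | exact Lp].
      - rewrite Elv, Elp. unfold GG, ee, AA. generalize (hv a B g (z t)) (hp a B g (z t) (V t)).
        intros h1 h2. rewrite Ez. field. auto. }
    eapply lder_eq.
    - apply lder_minus; [apply (GA V1 P1 z1 _ _ L1 L2 E1 eq_refl eq_refl)
        | apply (GA V2 P2 z2 _ _ L3 L4 E2 eq_refl eq_refl)].
    - field. auto. }
  (* Since dv' = dv up to O(1/t), the correction 4 rho dv / t cancels the oscillating part of rho',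
     leaving only - 4 rho dp / t at order 1/t. *)
  set (D2 := fun t => (rho t - 1 - 4 * (rho t * dv t) / t)%C).
  assert (HD2 : forall t, S t -> lder D2 t ((- 4 * rho t * dp t * t + RR t) / t ^ 2)%C).
  { intros t Ht. destruct (Hd t Ht) as [L1 [L2 [L3 [L4 [N1 N2]]]]]. pose proof (Nt t Ht) as Nt'.
    destruct (EP t) as [E1 E2].
    assert (Ldv : lder dv t ((V1 t + V1 t * (4 * z1 t + kk a g) / t + hv a B g (z1 t) / t ^ 2)
        - (V2 t + V2 t * (4 * z2 t + kk a g) / t + hv a B g (z2 t) / t ^ 2))%C)
      by now apply lder_minus.
    assert (Lr : lder rho t (rho t * (4 * dz t + dh t / t) / t)%C).
    { eapply lder_eq; [apply lder_div; [exact N2 | exact L1 | exact L3]|].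
      unfold rho, dz, dh, hh. field. auto. }
    eapply lder_eq.
    - apply lder_minus; [apply lder_minus; [exact Lr | apply lder_const]|].
      apply lder_div; [easy| |apply lder_id].
      apply lder_mult; [apply lder_const|]. apply lder_mult; [exact Lr | exact Ldv].
    - unfold RR, de, ee. generalize (rho t) (dh t) (hv a B g (z1 t)) (hv a B g (z2 t)).
      intros r d h1 h2. unfold dz, dp, dv. rewrite E1, E2. field. auto. }
  destruct CG as [_ [_ [Kg [HKg SG]]]].
  destruct (small_close _ _ _ _ CA) as [Ka [HKa SA]].
  destruct SR as [Kr [HKr SR]].
  destruct (bounded_nonneg _ _ Br) as [R0 [HR0 GR0]].
  destruct (bounded_nonneg _ _ BV2) as [M2 [HM2 GM2]].
  (* If N <= A, then |dp| <= Cp1 A / tau by integrating D1. Inserting this in D2' makes the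
     remaining 1/t term of size A / tau^2, which gives Cr for rho - 1, and C0 for N through V1 - V2
     = V2 (rho - 1). *)
  set (Cp1 := Kg + Ka). set (Cr := 4 * R0 * Cp1 + Kr + 4 * R0).
  set (C0 := M2 * Cr + Cp1).
  assert (HCp1 : 0 <= Cp1) by (unfold Cp1; lra).
  assert (HCr : 0 <= Cr) by (unfold Cr; nra).
  (* D1 and D2 are O(lnq) because the leading terms of the two solutions coincide; this supplies the
     vanishing at infinity required by [vertical_decay]. *)
  assert (Hlim : forall (f : C -> C) (c T : R), T1 <= T ->
     (forall t, S t -> Cmod (f t) <= c * lnq (eps * Im t)) ->
     forall e, 0 < e -> exists U, forall t, strip eps x1 T t -> good t -> U < eps * Im t -> Cmod (f t) <= e).
  { intros f c T HT Hf e He. destruct (lnq_small c e He) as [U HU]. exists U. intros t [A A'] Gt Ut.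
    eapply Rle_trans; [apply Hf; split; [split; lra | easy]|]. now apply HU. }
  assert (Hil : forall t, S t -> / (eps * Im t) <= lnq (eps * Im t)).
  { intros t Ht. apply inv_le_lnq. apply Htau, Ht. }
  destruct (bounded_nonneg _ _ (bounded_minus _ _ _ (proj1 CA) (proj1 (proj2 CA)))) as [MA [HMA GA]].
  destruct (bounded_nonneg _ _ (bounded_mult _ _ _ Br (bounded_minus _ _ _ BV1 BV2))) as [MB [HMB GB]].
  assert (LD1 : forall t, S t -> Cmod (D1 t) <= (2 * K + MA) * lnq (eps * Im t)).
  { intros t Ht. destruct (Co1 t Ht) as [_ Q1]. destruct (Co2 t Ht) as [_ Q2].
    specialize (Htau t Ht). specialize (Hil t Ht).
    replace (D1 t) with ((P1 t - p) - (P2 t - p) - (AA V1 P1 t - AA V2 P2 t) / t)%C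
      by (unfold D1; field; auto).
    eapply Rle_trans; [apply Cmod_minus_triangle|].
    pose proof (Cmod_minus_triangle (P1 t - p) (P2 t - p)).
    assert (Cmod ((AA V1 P1 t - AA V2 P2 t) / t) <= MA / (eps * Im t))
      by (apply Cmod_over_le; [lra | now apply GA]).
    assert (MA / (eps * Im t) <= MA * lnq (eps * Im t)) by (apply Rmult_le_compat_l; lra).
    lra. }
  assert (LD2 : forall t, S t -> Cmod (D2 t) <= (2 * K / (k0 * m / 2) + 4 * MB) * lnq (eps * Im t)).
  { intros t Ht. destruct (Co1 t Ht) as [Q1 _]. destruct (Co2 t Ht) as [Q2 _].
    specialize (Htau t Ht). specialize (Hil t Ht). destruct (Hd t Ht) as [_ [_ [_ [_ [N1 N2]]]]].
    replace (D2 t) with (((V1 t - kap * X t) - (V2 t - kap * X t)) / V2 t - 4 * ((rho t * dv t) / t))%C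
      by (unfold D2, rho; field; auto).
    eapply Rle_trans; [apply Cmod_minus_triangle|].
    pose proof (Cmod_minus_triangle (V1 t - kap * X t) (V2 t - kap * X t)).
    assert (Cmod (((V1 t - kap * X t) - (V2 t - kap * X t)) / V2 t) <= (2 * K * lnq (eps * Im t)) / (k0 * m / 2)).
    { apply Cmod_over_le; [split; [lra | now apply LV2] | lra]. }
    assert (Cmod (4 * (rho t * dv t / t)) <= 4 * (MB / (eps * Im t))).
    { rewrite Cmod_mult, Cmod_R, (Rabs_right 4) by lra. apply Rmult_le_compat_l; [lra|].
      apply Cmod_over_le; [lra | now apply GB]. }
    assert (MB / (eps * Im t) <= MB * lnq (eps * Im t)) by (apply Rmult_le_compat_l; lra).
    replace ((2 * K / (k0 * m / 2) + 4 * MB) * lnq (eps * Im t)) with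
      (2 * K * lnq (eps * Im t) / (k0 * m / 2) + 4 * (MB * lnq (eps * Im t))) by (field; lra).
    lra. }
  assert (Hstep : forall A T, 0 <= A -> T1 <= T ->
     (forall t, strip eps x1 T t -> good t -> N t <= A) ->
     forall t, strip eps x1 T t -> good t -> N t <= C0 * A / (eps * Im t)).
  { intros A T HA HT HN.
    assert (HST : forall t, strip eps x1 T t -> good t -> S t).
    { intros t [Q Q'] Gt. split; [split; lra | easy]. }
    assert (HgT : forall t, strip eps x1 T t -> punctured good t).
    { intros t [Q Q']. apply Hgood. split; lra. }
    assert (Z1 : forall t, strip eps x1 T t -> good t -> Cmod (D1 t) <= Kg * A / (eps * Im t)).
    { apply vertical_decay; auto; try lra; [nra| |].
      - intros t Ht Gt. pose proof (HST t Ht Gt) as St. exists ((GG V1 P1 z1 t - GG V2 P2 z2 t) / t ^ 2)%C.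
        split; [now apply HD1|]. apply Cmod_inv_sq_le; [specialize (Htau t St); lra|].
        eapply Rle_trans; [now apply SG|]. apply Rmult_le_compat_l; auto.
      - apply (Hlim D1 _ T HT LD1). }
    assert (Z2 : forall t, strip eps x1 T t -> good t -> Cmod (dp t) <= Cp1 * A / (eps * Im t)).
    { intros t Ht Gt. pose proof (HST t Ht Gt) as St. specialize (Z1 t Ht Gt).
      replace (dp t) with (D1 t + (AA V1 P1 t - AA V2 P2 t) / t)%C
        by (unfold D1, dp; field; auto).
      eapply Rle_trans; [apply Cmod_triangle|].
      assert (Cmod ((AA V1 P1 t - AA V2 P2 t) / t) <= Ka * A / (eps * Im t)).
      { apply Cmod_over_le; [specialize (Htau t St); lra|].
        eapply Rle_trans; [now apply SA|]. apply Rmult_le_compat_l; auto. }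
      replace (Cp1 * A / (eps * Im t)) with (Kg * A / (eps * Im t) + Ka * A / (eps * Im t))
        by (unfold Cp1, Rdiv; ring). lra. }
    assert (Z3 : forall t, strip eps x1 T t -> good t ->
        Cmod (D2 t) <= (4 * R0 * Cp1 + Kr) * A / (eps * Im t)).
    { apply vertical_decay; auto; try lra.
      - apply Rmult_le_pos; auto. nra.
      - intros t Ht Gt. pose proof (HST t Ht Gt) as St. pose proof (Htau t St) as Tt.
        exists ((- 4 * rho t * dp t * t + RR t) / t ^ 2)%C.
        split; [now apply HD2|].
        replace ((- 4 * rho t * dp t * t + RR t) / t ^ 2)%C
          with ((- 4 * rho t * dp t) / t + RR t / t ^ 2)%C by (field; auto).
        eapply Rle_trans; [apply Cmod_triangle|].
        assert (W1 : Cmod (- 4 * rho t * dp t / t) <= (4 * R0 * (Cp1 * A / (eps * Im t))) / (eps * Im t)).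
        { apply Cmod_over_le; [lra|]. rewrite !Cmod_mult.
          replace (Cmod (- 4)) with 4 by (rewrite Cmod_R, Rabs_left; lra).
          apply Rmult_le_compat; auto using Cmod_ge_0.
          - apply Rmult_le_pos; [lra | apply Cmod_ge_0].
          - apply Rmult_le_compat_l; [lra | auto]. }
        assert (W2 : Cmod (RR t / t ^ 2) <= Kr * A / (eps * Im t) ^ 2).
        { apply Cmod_inv_sq_le; [lra|]. eapply Rle_trans; [now apply SR|].
          apply Rmult_le_compat_l; auto. }
        replace ((4 * R0 * Cp1 + Kr) * A / (eps * Im t) ^ 2) with
          ((4 * R0 * (Cp1 * A / (eps * Im t))) / (eps * Im t) + Kr * A / (eps * Im t) ^ 2)
          by (set (tau := eps * Im t) in *; field; lra). apply Rplus_le_compat; [exact W1 | exact W2].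
      - apply (Hlim D2 _ T HT LD2). }
    intros t Ht Gt. pose proof (HST t Ht Gt) as St. pose proof (Htau t St) as Tt.
    specialize (Z2 t Ht Gt). specialize (Z3 t Ht Gt).
    destruct (Hd t St) as [_ [_ [_ [_ [N1 N2]]]]].
    assert (Z4 : Cmod (rho t - 1) <= Cr * A / (eps * Im t)).
    { replace (rho t - 1)%C with (D2 t + 4 * (rho t * dv t) / t)%C by (unfold D2; field; auto).
      eapply Rle_trans; [apply Cmod_triangle|].
      assert (Cmod (4 * (rho t * dv t) / t) <= (4 * (R0 * A)) / (eps * Im t)).
      { apply Cmod_over_le; [lra|]. rewrite !Cmod_mult, Cmod_R, (Rabs_right 4) by lra.
        apply Rmult_le_compat_l; [lra|]. apply Rmult_le_compat; auto using Cmod_ge_0.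
        specialize (HN t Ht Gt). unfold N in HN. unfold dv.
        pose proof (Cmod_ge_0 (P1 t - P2 t)). lra. }
      replace (Cr * A / (eps * Im t)) with ((4 * R0 * Cp1 + Kr) * A / (eps * Im t) + 4 * (R0 * A) / (eps * Im t))
        by (unfold Cr, Rdiv; ring). lra. }
    unfold N. replace (V1 t - V2 t)%C with (V2 t * (rho t - 1))%C by (unfold rho; field; auto).
    fold (dp t). rewrite Cmod_mult.
    assert (Cmod (V2 t) * Cmod (rho t - 1) <= M2 * (Cr * A / (eps * Im t)))
      by (apply Rmult_le_compat; auto using Cmod_ge_0).
    replace (C0 * A / (eps * Im t)) with (M2 * (Cr * A / (eps * Im t)) + Cp1 * A / (eps * Im t))
      by (unfold C0, Rdiv; ring). lra. }
  assert (HC0 : 0 <= C0) by (unfold C0; nra).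
  (* Beyond 2 C0 the gain C0 / tau is at most 1/2, so iterating [Hstep] in the same strip halves the
     bound on N each time and N vanishes. *)
  set (T := Rmax T1 (2 * C0)). assert (HTT : T1 <= T) by apply Rmax_l.
  assert (HTC : 2 * C0 <= T) by apply Rmax_r.
  destruct (bounded_nonneg _ _ (bounded_minus _ _ _ BV1 BV2)) as [M3 [HM3 GM3]].
  destruct (bounded_nonneg _ _ (bounded_minus _ _ _ BP1 BP2)) as [M4 [HM4 GM4]].
  assert (Hn : forall n t, strip eps x1 T t -> good t -> N t <= (M3 + M4) / 2 ^ n).
  { induction n; intros t Ht Gt.
    - simpl. assert (St : S t) by (destruct Ht; split; [split; lra | easy]).
      specialize (GM3 t St). specialize (GM4 t St). unfold N. cbv beta in *. lra.
    - eapply Rle_trans; [apply (Hstep ((M3 + M4) / 2 ^ n) T); auto|].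
      + apply Rdiv_le_0_compat; [lra | apply pow_lt; lra].
      + assert (Ht2 : T < eps * Im t) by apply Ht.
        replace ((M3 + M4) / 2 ^ Datatypes.S n) with ((/ 2) * ((M3 + M4) / 2 ^ n))
          by (simpl; field; apply pow_nonzero; lra).
        replace (C0 * ((M3 + M4) / 2 ^ n) / (eps * Im t)) with
          (C0 / (eps * Im t) * ((M3 + M4) / 2 ^ n)) by (unfold Rdiv; ring).
        apply Rmult_le_compat_r; [apply Rdiv_le_0_compat; [lra | apply pow_lt; lra]|].
        apply Rmult_le_reg_r with (eps * Im t); [lra|].
        unfold Rdiv. rewrite Rmult_assoc, Rinv_l by lra. lra. }
  exists T. split; [lra|]. split; [lra|]. intros t Ht Gt.
  assert (St : S t) by (destruct Ht; split; [split; lra | easy]).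
  assert (HN0 : N t <= 0).
  { apply Rnot_lt_le. intros Hp. destruct (pow_half_small (M3 + M4 + 1) (N t)) as [n Hn']; [lra|easy|].
    specialize (Hn n t Ht Gt). assert (0 < / 2 ^ n) by (apply Rinv_0_lt_compat, pow_lt; lra).
    unfold Rdiv in *. nra. }
  unfold N in HN0. pose proof (Cmod_ge_0 (V1 t - V2 t)). pose proof (Cmod_ge_0 (P1 t - P2 t)).
  assert (EV : V1 t = V2 t).
  { assert (E0 : (V1 t - V2 t)%C = RtoC 0) by (apply Cmod_eq_0; lra).
    replace (V1 t) with ((V1 t - V2 t) + V2 t)%C by ring. rewrite E0. ring. }
  assert (EPP : P1 t = P2 t).
  { assert (E0 : (P1 t - P2 t)%C = RtoC 0) by (apply Cmod_eq_0; lra).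
    replace (P1 t) with ((P1 t - P2 t) + P2 t)%C by ring. rewrite E0. ring. }
  destruct (EP t) as [E1 E2]. split; [easy|]. split; [now rewrite E1, E2, EV, EPP|].
  apply (Hd t St).
Qed.

(** * The function X2 *)

Lemma Cmod_sqr (t : C) : Cmod t * Cmod t = Re t * Re t + Im t * Im t.
Proof. pose proof (Cmod2_alt t). simpl in H. lra. Qed.

Lemma half_plane_Cmod eps t : eps = 1 \/ eps = -1 -> half_plane eps t -> 0 < Cmod t /\ Im t <> 0.
Proof.
  unfold half_plane. intros Heps H. assert (N : Im t <> 0) by (intros E; rewrite E in H; lra).
  split; [|easy]. pose proof (im_le_Cmod t). apply Rabs_no_R0 in N. pose proof (Rabs_pos (Im t)). lra.
Qed.

(** The arctangent form is smooth on the half-plane and measures the deviation from eps PI / 2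
    directly; it also makes the effect of t -> - conj t on the argument visible, atan being odd. *)
Lemma Carg_half_plane eps t : eps = 1 \/ eps = -1 -> half_plane eps t ->
  Carg t = eps * PI / 2 - atan (Re t / Im t).
Proof.
  intros Heps Ht. destruct (half_plane_Cmod _ _ Heps Ht) as [Hm Hi]. pose proof (Cmod_sqr t) as Hs.
  set (m := Cmod t) in *. set (x := Re t) in *. set (y := Im t) in *.
  assert (Hy2 : 0 < y * y) by (destruct (Rdichotomy _ _ Hi); nra).
  assert (Hxm : -1 < x / m < 1).
  { split; [apply Rmult_lt_reg_r with m | apply Rmult_lt_reg_r with m]; auto;
      unfold Rdiv; rewrite Rmult_assoc, Rinv_l by lra; nra. }
  assert (K : acos (x / m) = PI / 2 - atan (x / Rabs y)).
  { rewrite acos_asin by lra. rewrite asin_atan by easy. f_equal. f_equal.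
    replace (1 - (x / m)²) with ((Rabs y / m) * (Rabs y / m)).
    - rewrite sqrt_square by (apply Rdiv_le_0_compat; [apply Rabs_pos | easy]).
      field. split; [now apply Rabs_no_R0 | lra].
    - replace (Rabs y / m * (Rabs y / m)) with (Rabs y * Rabs y / (m * m)) by (field; lra).
      rewrite <- Rabs_mult, (Rabs_right (y * y)) by lra.
      unfold Rsqr. replace (x / m * (x / m)) with (x * x / (m * m)) by (field; lra).
      rewrite Hs. field. nra. }
  unfold Carg. fold x y m. unfold half_plane in Ht. fold y in Ht.
  destruct Heps as [-> | ->].
  - destruct (Rle_dec 0 y); [|lra]. rewrite K, Rabs_right by lra. lra.
  - destruct (Rle_dec 0 y); [lra|]. rewrite K, Rabs_left by lra.
    replace (x / - y) with (- (x / y)) by (field; lra). rewrite atan_opp. lra.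
Qed.

Lemma Carg_bound t : - PI <= Carg t <= PI.
Proof.
  pose proof (acos_bound (Re t / Cmod t)). unfold Carg. destruct (Rle_dec 0 (Im t)); lra.
Qed.

Lemma is_derive_eq (f : R -> R) s l m : is_derive f s l -> l = m -> is_derive f s m.
Proof. now intros H <-. Qed.

Lemma cRder_Cexp (f : R -> C) s l : cRder f s l -> cRder (fun x => Cexp (f x)) s (l * Cexp (f s)).
Proof.
  intros [A B].
  assert (E1 : is_derive (fun x => exp (Re (f x))) s (Re l * exp (Re (f s)))).
  { apply (is_derive_comp exp (fun x => Re (f x))); [apply is_derive_exp | exact A]. }
  assert (C1 : is_derive (fun x => cos (Im (f x))) s (Im l * - sin (Im (f s)))).
  { apply (is_derive_comp cos (fun x => Im (f x))); [apply is_derive_cos | exact B]. }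
  assert (S1 : is_derive (fun x => sin (Im (f x))) s (Im l * cos (Im (f s)))).
  { apply (is_derive_comp sin (fun x => Im (f x))); [apply is_derive_sin | exact B]. }
  split.
  - eapply is_derive_eq; [apply (is_derive_Rmult _ _ _ _ _ E1 C1)|].
    unfold Cexp, Re, Im; simpl. ring.
  - eapply is_derive_eq; [apply (is_derive_Rmult _ _ _ _ _ E1 S1)|].
    unfold Cexp, Re, Im; simpl. ring.
Qed.

Lemma lder_Cexp (f : C -> C) t l : lder f t l -> lder (fun x => Cexp (f x)) t (l * Cexp (f t)).
Proof.
  intros H t0 d s E. eapply cRder_eq; [apply cRder_Cexp, (H t0 d s E)|]. subst t. ring.
Qed.

Lemma half_plane_near eps t : eps = 1 \/ eps = -1 -> half_plane eps t -> near t (half_plane eps).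
Proof.
  intros Heps H. exists (eps * Im t). split; [exact H|]. intros x Hx. unfold half_plane in *.
  pose proof (im_le_Cmod (x - t)) as K. replace (Im (x - t)) with (Im x - Im t) in K
    by (unfold Im; simpl; ring).
  assert (Rabs (Im x - Im t) < eps * Im t) by lra. apply Rabs_def2 in H0.
  destruct Heps as [-> | ->]; lra.
Qed.

Lemma lder_Cln eps t : eps = 1 \/ eps = -1 -> half_plane eps t -> lder Cln t (/ t).
Proof.
  intros Heps Ht. destruct (half_plane_Cmod _ _ Heps Ht) as [Hm Hi].
  apply lder_ext_near with (fun t => (ln (Re t * Re t + Im t * Im t) / 2,
      eps * PI / 2 - atan (Re t / Im t)) : C).
  - generalize (half_plane_near _ _ Heps Ht). apply near_mono. intros x Hx.
    destruct (half_plane_Cmod _ _ Heps Hx) as [Hmx _].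
    unfold Cln. rewrite (Carg_half_plane eps) by easy. f_equal.
    rewrite <- Cmod_sqr, ln_mult by easy. lra.
  - intros t0 d s E.
    assert (Er : forall x : R, Re (t0 + x * d)%C = Re t0 + x * Re d) by (intros; unfold Re; simpl; ring).
    assert (Ei : forall x : R, Im (t0 + x * d)%C = Im t0 + x * Im d) by (intros; unfold Im; simpl; ring).
    assert (Et : t = (Re t0 + s * Re d, Im t0 + s * Im d)).
    { rewrite E. unfold Cplus, Cmult, RtoC, Re, Im; simpl. f_equal; ring. }
    rewrite Et in Hi. change (Im t0 + s * Im d <> 0) in Hi.
    set (x0 := Re t0) in *. set (y0 := Im t0) in *. 
    assert (P : 0 < (x0 + s * Re d) * (x0 + s * Re d) + (y0 + s * Im d) * (y0 + s * Im d)).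
    { pose proof (Rle_0_sqr (x0 + s * Re d)) as Q1. pose proof (Rlt_0_sqr _ Hi) as Q2.
      unfold Rsqr in *. lra. }
    apply cRder_ext with (fun x : R =>
      (ln ((x0 + x * Re d) * (x0 + x * Re d) + (y0 + x * Im d) * (y0 + x * Im d)) / 2,
       eps * PI / 2 - atan ((x0 + x * Re d) / (y0 + x * Im d))) : C).
    { intros x. now rewrite Er, Ei. }
    rewrite Et. split; simpl.
    + auto_derive; [exact P|]. unfold Re, Im. simpl. field. 
      unfold x0, y0, Re, Im in *. simpl in *. nra.
    + auto_derive; [easy|]. unfold Re, Im, Rsqr. simpl. field.
      unfold x0, y0, Re, Im in *. simpl in *. repeat split; try easy; nra.
Qed.

Lemma lder_X2 eps th phi delta t : eps = 1 \/ eps = -1 -> half_plane eps t ->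
  lder (X2 th phi delta) t (X2 th phi delta t * (1 - nu2 th phi / t))%C.
Proof.
  intros Heps Ht. assert (Nt : t <> RtoC 0).
  { apply Cmod_pos_neq_0. apply (half_plane_Cmod _ _ Heps Ht). }
  unfold X2, cpow. eapply lder_eq.
  - apply lder_mult; [apply lder_mult; [apply lder_const|]|].
    + apply (lder_Cexp (fun t => - nu2 th phi * Cln t)%C). apply lder_mult; [apply lder_const|].
      now apply lder_Cln with eps.
    + apply (lder_Cexp (fun t => t)), lder_id.
  - simpl. field. exact Nt.
Qed.

Lemma Cmod_Cexp z : Cmod (Cexp z) = exp (Re z).
Proof.
  assert (H : Cmod (Cexp z) ^ 2 = exp (Re z) ^ 2).
  { rewrite Cmod2_alt. unfold Cexp, Re, Im; simpl.
    pose proof (sin2_cos2 (snd z)). unfold Rsqr in H. nra. }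
  apply Rsqr_inj; [apply Cmod_ge_0 | left; apply exp_pos|]. unfold Rsqr. simpl in H. lra.
Qed.

Lemma Cexp_plus z w : Cexp (z + w) = (Cexp z * Cexp w)%C.
Proof.
  unfold Cexp, Cmult, Re, Im; simpl. rewrite exp_plus, cos_plus, sin_plus. f_equal; ring.
Qed.

Lemma Cexp_conj z : Cconj (Cexp z) = Cexp (Cconj z).
Proof.
  unfold Cexp, Cconj, Re, Im; simpl. rewrite cos_neg, sin_neg. f_equal; ring.
Qed.

Lemma Cexp_real (x : R) : Cexp x = RtoC (exp x).
Proof. unfold Cexp, RtoC, Re, Im; simpl. rewrite cos_0, sin_0. f_equal; ring. Qed.

Lemma Cmod_cpow t (b c : R) : Cmod (cpow t (c + Ci * b)) = exp (c * ln (Cmod t) - b * Carg t).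
Proof. unfold cpow. rewrite Cmod_Cexp. f_equal. unfold Cln, Re; simpl. ring. Qed.

(** As nu_2 is imaginary, the power contributes to the modulus only through arg t. Hence |X| is
    bounded above and below on vertical strips, and it is constant on the ray. *)
Lemma Cmod_X2 th phi delta (om : R) t : (Ci * om)%C = nu2 th phi ->
  Cmod (X2 th phi delta t) = Cmod delta * exp (Re t + om * Carg t).
Proof.
  intros E. unfold X2. rewrite !Cmod_mult, <- E, Cmod_Cexp.
  replace (- (Ci * om))%C with (RtoC 0 + Ci * RtoC (- om))%C by (rewrite RtoC_opp; ring).
  rewrite Cmod_cpow, Rmult_assoc, <- exp_plus. do 2 f_equal. ring.
Qed.

Definition refl (t : C) : C := (- Cconj t)%C.

Lemma Re_refl t : Re (refl t) = - Re t.
Proof. reflexivity. Qed.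
Lemma Im_refl t : Im (refl t) = Im t.
Proof. unfold refl, Im; simpl. ring. Qed.
Lemma refl_refl t : refl (refl t) = t.
Proof. unfold refl. rewrite Copp_conj, Cconj_conj. ring. Qed.
Lemma Cmod_refl t : Cmod (refl t) = Cmod t.
Proof. unfold refl. now rewrite Cmod_opp, Cmod_conj. Qed.
Lemma refl_minus t s : (refl t - refl s)%C = refl (t - s)%C.
Proof. unfold refl. rewrite Cminus_conj. ring. Qed.

Lemma Carg_refl eps t : eps = 1 \/ eps = -1 -> half_plane eps t ->
  Carg (refl t) = eps * PI - Carg t.
Proof.
  intros Heps Ht. rewrite !(Carg_half_plane eps) by (auto; unfold half_plane; now rewrite Im_refl).
  rewrite Re_refl, Im_refl. replace (- Re t / Im t) with (- (Re t / Im t)) by (unfold Rdiv; ring).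
  rewrite atan_opp. lra.
Qed.

(** The exponentials cancel because - conj t has real part - Re t, and the powers combine to a
    constant because arg t + arg (- conj t) = eps PI. So reflection acts on X as inversion in a
    circle. *)
Lemma X2_refl eps th phi delta (om : R) t : eps = 1 \/ eps = -1 -> half_plane eps t ->
  (Ci * om)%C = nu2 th phi ->
  (Cconj (X2 th phi delta (refl t)) * X2 th phi delta t)%C
  = RtoC (Cmod delta ^ 2 * exp (eps * PI * om)).
Proof.
  intros Heps Ht E. unfold X2, cpow. rewrite !Cmult_conj, !Cexp_conj, <- E.
  replace (Cconj delta * Cexp (Cconj (- (Ci * om) * Cln (refl t))) * Cexp (Cconj (refl t)) *
    (delta * Cexp (- (Ci * om) * Cln t) * Cexp t))%C with
   ((delta * Cconj delta) * (Cexp (Cconj (- (Ci * om) * Cln (refl t)) + (- (Ci * om) * Cln t)) * Cexp (Cconj (refl t) + t)))%C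
   by (rewrite !Cexp_plus; ring).
  rewrite <- Cmod2_conj, RtoC_mult. f_equal.
  rewrite <- Cexp_plus, <- Cexp_real. f_equal.
  unfold Cln. rewrite Cmod_refl, (Carg_refl eps) by easy.
  unfold refl, Cconj, RtoC, Ci, Copp, Cmult; unfold Cplus; simpl. f_equal; ring.
Qed.

Lemma polar (z : C) : z <> RtoC 0 -> z = (RtoC (Cmod z) * Cexp (Ci * Carg z))%C.
Proof.
  intros Hz. assert (Hm : 0 < Cmod z) by now apply Cmod_pos.
  pose proof (Cmod_sqr z) as Hs. pose proof (re_le_Cmod z) as Hr. apply Rabs_le_between in Hr.
  assert (Hx : -1 <= Re z / Cmod z <= 1).
  { split; apply Rmult_le_reg_r with (Cmod z); auto; unfold Rdiv; rewrite Rmult_assoc, Rinv_l; lra. }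
  assert (Hc : cos (Carg z) = Re z / Cmod z).
  { unfold Carg. destruct (Rle_dec 0 (Im z)); [|rewrite cos_neg]; now apply cos_acos. }
  assert (Hsn : sin (Carg z) = Im z / Cmod z).
  { assert (Q : sqrt (1 - (Re z / Cmod z)²) = Rabs (Im z) / Cmod z).
    { replace (1 - (Re z / Cmod z)²) with ((Rabs (Im z) / Cmod z) * (Rabs (Im z) / Cmod z)).
      - apply sqrt_square. apply Rdiv_le_0_compat; [apply Rabs_pos | easy].
      - replace (Rabs (Im z) / Cmod z * (Rabs (Im z) / Cmod z)) with
          (Rabs (Im z) * Rabs (Im z) / (Cmod z * Cmod z)) by (field; lra).
        rewrite <- Rabs_mult, Rabs_right by nra.
        unfold Rsqr. replace (Re z / Cmod z * (Re z / Cmod z)) with (Re z * Re z / (Cmod z * Cmod z)) by (field; lra).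
        rewrite Hs. field. nra. }
    unfold Carg. destruct (Rle_dec 0 (Im z)); [|rewrite sin_neg]; rewrite sin_acos, Q by easy.
    - rewrite Rabs_right by lra. easy.
    - rewrite Rabs_left by lra. field. lra. }
  unfold Cexp. replace (Re (Ci * Carg z)) with 0 by (unfold Re; simpl; ring).
  replace (Im (Ci * Carg z)) with (Carg z) by (unfold Im; simpl; ring).
  rewrite Hc, Hsn, exp_0. destruct z as [x y]. unfold Cmult, RtoC, Re, Im in *; simpl.
  f_equal; field; lra.
Qed.

Lemma half_plane_ray eps (tau : R) : half_plane eps (Ci * tau)%C <-> 0 < eps * tau.
Proof. unfold half_plane. replace (Im (Ci * tau)) with tau by (unfold Im; simpl; ring). reflexivity. Qed.

Lemma X2_ray eps th phi delta (om tau : R) : eps = 1 \/ eps = -1 -> 0 < eps * tau -> delta <> RtoC 0 ->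
  (Ci * om)%C = nu2 th phi ->
  X2 th phi delta (Ci * tau)%C = (RtoC (Cmod delta * exp (eps * PI * om / 2))
     * Cexp (Ci * RtoC (tau - om * ln (Rabs tau) + Carg delta)))%C.
Proof.
  intros Heps Ht Hd E. unfold X2, cpow. rewrite (polar delta Hd) at 1. rewrite <- E, RtoC_mult, <- Cexp_real.
  rewrite <- !Cmult_assoc. f_equal. rewrite <- !Cexp_plus. f_equal. unfold Cln.
  rewrite (Carg_half_plane eps (Ci * tau)%C) by (auto; apply (proj2 (half_plane_ray eps tau)); exact Ht).
  replace (Re (Ci * tau)) with 0 by (unfold Re; simpl; ring).
  unfold Rdiv at 2. rewrite Rmult_0_l, atan_0, Cmod_mult, Cmod_Ci, Cmod_R, Rmult_1_l.
  unfold RtoC, Ci, Copp, Cmult; unfold Cplus; simpl. f_equal; field.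
Qed.

(** * The line Re t = x1 *)

Lemma strip_half_plane eps x0 T t : 0 <= T -> strip eps x0 T t -> half_plane eps t.
Proof. unfold half_plane. intros HT [_ H]. lra. Qed.

(** In a strip Re t / Im t tends to 0, hence arg t tends to eps PI / 2. From here on eps Im t
    replaces |t| as the large parameter. *)
Lemma near_infty_strip eps P x0 : eps = 1 \/ eps = -1 -> near_infty eps P ->
  exists T, forall t, strip eps x0 T t -> P t.
Proof.
  intros Heps [T [eta [He H]]].
  assert (Ca : continuous atan 0).
  { apply @ex_derive_continuous. eexists. apply is_derive_atan. }
  apply continuous_Rcontinuous in Ca. destruct (Ca eta He) as [d [Hd G]].
  rewrite atan_0 in G.
  set (T' := Rmax 0 (Rmax T (Rabs x0 / d))). exists T'. intros t Ht.
  assert (HT : 0 <= T' /\ T <= T' /\ Rabs x0 / d <= T').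
  { unfold T'. pose proof (Rmax_l 0 (Rmax T (Rabs x0 / d))). pose proof (Rmax_r 0 (Rmax T (Rabs x0 / d))).
    pose proof (Rmax_l T (Rabs x0 / d)). pose proof (Rmax_r T (Rabs x0 / d)). lra. }
  pose proof (strip_half_plane _ _ _ _ (proj1 HT) Ht) as Hh.
  pose proof (strip_Cmod _ _ _ _ Heps Ht) as Hc.
  destruct (half_plane_Cmod _ _ Heps Hh) as [_ Hi]. destruct Ht as [Hx Hy].
  apply H; [lra|]. rewrite (Carg_half_plane eps) by easy.
  replace (eps * PI / 2 - atan (Re t / Im t) - eps * PI / 2) with (- (atan (Re t / Im t) - 0)) by ring.
  rewrite Rabs_Ropp. apply G. rewrite Rminus_0_r.
  assert (Ei : Rabs (Im t) = eps * Im t).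
  { unfold half_plane in Hh. destruct Heps as [-> | ->]; [rewrite Rabs_right | rewrite Rabs_left]; lra. }
  unfold half_plane in Hh. unfold Rdiv. rewrite Rabs_mult, Rabs_inv, Ei.
  apply Rmult_lt_reg_r with (eps * Im t); [lra|]. rewrite Rmult_assoc, Rinv_l by lra.
  pose proof (Rle_abs x0).
  assert (Rabs x0 <= d * T').
  { destruct HT as [_ [_ HT]]. apply Rmult_le_compat_l with (r := d) in HT; [|lra].
    replace (d * (Rabs x0 / d)) with (Rabs x0) in HT by (field; lra). easy. }
  nra.
Qed.

(** With nu_2 imaginary, the error exponents - 3 nu - 1, nu - 1 and - 1 all have real part - 1, so
    each of the assumed error terms for t / y and z becomes O(ln tau / tau). The constant [E] bounds
    the factor produced by arg t. *)
Lemma cpow_bound eps x0 b : eps = 1 \/ eps = -1 -> exists K, 0 <= K /\ forall t, strip eps x0 3 t ->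
  Cmod (cpow t (RtoC (-1) + Ci * RtoC b)) <= K * lnq (eps * Im t) /\
  Cmod (cpow t (RtoC (-1) + Ci * RtoC b) * Cln t) <= K * lnq (eps * Im t).
Proof.
  intros Heps. set (E := exp (Rabs b * PI)). assert (HE : 0 < E) by apply exp_pos.
  pose proof PI_RGT_0 as HPI.
  set (L := 1 + ln (1 + Rabs x0) + PI).
  pose proof (Rabs_pos x0) as Hx0.
  assert (HL0 : 0 <= ln (1 + Rabs x0)) by (rewrite <- ln_1; apply ln_le; lra).
  exists (E * L + E). split; [unfold L; nra|]. intros t Ht.
  pose proof (strip_Cmod _ _ _ _ Heps Ht) as Hc. destruct Ht as [Hx Hy].
  set (tau := eps * Im t) in *.
  assert (Hi : 0 < / tau) by (apply Rinv_0_lt_compat; lra).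
  assert (H1 : Cmod (cpow t (RtoC (-1) + Ci * RtoC b)) <= E * / tau).
  { rewrite Cmod_cpow. unfold Rminus. rewrite exp_plus, Rmult_comm. apply Rmult_le_compat.
    - left; apply exp_pos.
    - left; apply exp_pos.
    - unfold E. assert (Q : - (b * Carg t) <= Rabs b * PI).
      { eapply Rle_trans; [apply Rle_abs|]. rewrite Rabs_Ropp, Rabs_mult.
        apply Rmult_le_compat_l; [apply Rabs_pos|]. apply Rabs_le, Carg_bound. }
      destruct (Rle_lt_or_eq_dec _ _ Q) as [Q'| ->]; [left; now apply exp_increasing | lra].
    - replace (-1 * ln (Cmod t)) with (- ln (Cmod t)) by ring. rewrite exp_Ropp, exp_ln by lra.
      apply Rinv_le_contravar; lra. }
  assert (H2 : Cmod (Cln t) <= L * ln tau).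
  { assert (Hl1 : 1 <= ln tau).
    { rewrite <- (ln_exp 1). apply ln_le; [apply exp_pos|]. pose proof exp_le_3. lra. }
    eapply Rle_trans; [apply Cmod_le_Rabs|]. unfold Cln, Re, Im; simpl.
    assert (Rabs (Carg t) <= PI) by apply Rabs_le, Carg_bound.
    assert (Rabs (ln (Cmod t)) <= ln tau + ln (1 + Rabs x0)).
    { rewrite Rabs_right.
      - rewrite <- ln_mult by lra. apply ln_le; [lra|].
        eapply Rle_trans; [apply Cmod_le_Rabs|].
        assert (Ei : Rabs (Im t) = tau).
        { unfold tau in *. destruct Heps as [-> | ->]; [rewrite Rabs_right | rewrite Rabs_left]; lra. }
        rewrite Ei. pose proof (Rle_abs x0). nra.
      - apply Rle_ge. rewrite <- ln_1. apply ln_le; lra. }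
    unfold L. nra. }
  pose proof (inv_le_lnq tau Hy) as Hl.
  assert (HL : 0 <= L) by (unfold L; lra).
  assert (Hq : 0 < lnq tau) by lra.
  split.
  - assert (E * / tau <= E * lnq tau) by (apply Rmult_le_compat_l; lra).
    assert (0 <= E * L * lnq tau) by (apply Rmult_le_pos; nra). lra.
  - rewrite Cmod_mult. apply Rle_trans with (E * / tau * (L * ln tau)).
    + apply Rmult_le_compat; auto using Cmod_ge_0.
    + unfold lnq, Rdiv. assert (0 <= E * (ln tau * / tau)) by (unfold lnq, Rdiv in Hq; nra).
      replace (E * / tau * (L * ln tau)) with (E * L * (ln tau * / tau)) by ring. lra.
Qed.

(* The leading terms of t / y and z. *)
Definition Wf (p q : C) (X : C -> C) (t : C) : C := ((1 - p * X t) * (1 - q * X t) / X t)%C.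
Definition Zf (p q : C) (X : C -> C) (t : C) : C := (- (p * (1 - q * X t)))%C.

Lemma exp_ge_1_plus x : 1 + x <= exp x.
Proof.
  destruct (Req_dec x 0) as [-> | N]; [rewrite exp_0; lra | left; now apply exp_ineq1].
Qed.

(** The margin 1 in X0 - 1 covers discs of radius 1 about points with Re t >= X0. The threshold c /
    k comes from exp x >= 1 + x. *)
Lemma X2_large th phi delta (om : R) : (Ci * om)%C = nu2 th phi -> delta <> RtoC 0 ->
  forall c, 0 < c -> exists X0, 0 < X0 /\ forall s, X0 - 1 < Re s -> c < Cmod (X2 th phi delta s).
Proof.
  intros E Hd c Hc. assert (Hm : 0 < Cmod delta) by now apply Cmod_pos.
  set (k := Cmod delta * exp (- 1 - Rabs om * PI)).
  assert (Hk : 0 < k) by (apply Rmult_lt_0_compat; [easy | apply exp_pos]).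
  exists (c / k). split; [now apply Rdiv_lt_0_compat|]. intros s Hs.
  rewrite (Cmod_X2 th phi delta om) by easy.
  assert (Q : - (Rabs om * PI) <= om * Carg s).
  { pose proof (Rle_abs (- (om * Carg s))). rewrite Rabs_Ropp, Rabs_mult in H.
    pose proof (Rmult_le_compat_l (Rabs om) (Rabs (Carg s)) PI (Rabs_pos om) (Rabs_le _ _ (Carg_bound s))).
    lra. }
  apply Rlt_le_trans with (k * exp (c / k)).
  - apply Rlt_le_trans with (k * (1 + c / k)).
    + replace (k * (1 + c / k)) with (k + c) by (field; lra). lra.
    + apply Rmult_le_compat_l; [lra | apply exp_ge_1_plus].
  - unfold k at 1. rewrite Rmult_assoc, <- exp_plus. apply Rmult_le_compat_l; [lra|].
    assert (Q0 : - 1 - Rabs om * PI + c / k <= Re s + om * Carg s) by lra.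
    destruct (Rle_lt_or_eq_dec _ _ Q0) as [Q'|Q']; [left; now apply exp_increasing | rewrite Q'; lra].
Qed.

Lemma R2_zero_Cmod th phi delta s (v : C) : R2 th phi delta s v = RtoC 0 ->
  Cmod (phi + v) * Cmod (X2 th phi delta s) = 1.
Proof.
  unfold R2. intros H. rewrite <- Cmod_mult.
  replace ((phi + v) * X2 th phi delta s)%C with (1 - (1 - (phi + v) * X2 th phi delta s))%C by ring.
  rewrite H. replace (1 - 0)%C with (RtoC 1) by ring. apply Cmod_1.
Qed.

(** [D2] is used with r2 = e = 1, so that the removed discs have radius 1. A zero of R_2 forces |p
    X| = 1 or |q X| = 1, while both exceed 2 for Re s > x1 - 1; the whole line is therefore
    admissible. *)
Lemma type2_start eps th phi delta uh y z u (om : R) (p q : C) :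
  eps = 1 \/ eps = -1 -> (Ci * om)%C = nu2 th phi -> delta <> RtoC 0 ->
  p = (phi + Th0 th / 2)%C -> q = (phi + (Th1 th - Thinf th) / 2)%C ->
  p <> RtoC 0 -> q <> RtoC 0 ->
  type2_asymptotics eps th phi delta uh y z u ->
  exists X0, 0 < X0 /\ forall x1, X0 <= x1 -> exists K T, 0 <= K /\
   forall t, T < eps * Im t -> Re t = x1 ->
    Cmod (t / y t - Wf p q (X2 th phi delta) t) <= K * lnq (eps * Im t) /\
    Cmod (z t - Zf p q (X2 th phi delta) t) <= K * lnq (eps * Im t) /\
    2 <= Cmod (p * X2 th phi delta t) /\ 2 <= Cmod (q * X2 th phi delta t).
Proof.
  intros Heps E Hd Ep Eq Hp Hq Has.
  assert (Mp : 0 < Cmod p) by now apply Cmod_pos.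
  assert (Mq : 0 < Cmod q) by now apply Cmod_pos.
  destruct (X2_large th phi delta om E Hd (2 / Cmod p + 2 / Cmod q)) as [X0 [HX0 HX]].
  { apply Rplus_lt_0_compat; apply Rdiv_lt_0_compat; lra. }
  exists X0. split; [easy|]. intros x1 Hx1.
  assert (Hbig : forall s, x1 - 1 < Re s -> 2 < Cmod p * Cmod (X2 th phi delta s) /\
        2 < Cmod q * Cmod (X2 th phi delta s)).
  { intros s Hs. specialize (HX s ltac:(lra)).
    assert (0 < 2 / Cmod p) by (apply Rdiv_lt_0_compat; lra).
    assert (0 < 2 / Cmod q) by (apply Rdiv_lt_0_compat; lra).
    split.
    - apply Rlt_trans with (Cmod p * (2 / Cmod p + 2 / Cmod q)); [|now apply Rmult_lt_compat_l].
      replace (Cmod p * (2 / Cmod p + 2 / Cmod q)) with (2 + Cmod p * (2 / Cmod q)) by (field; lra). nra.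
    - apply Rlt_trans with (Cmod q * (2 / Cmod p + 2 / Cmod q)); [|now apply Rmult_lt_compat_l].
      replace (Cmod q * (2 / Cmod p + 2 / Cmod q)) with (2 + Cmod q * (2 / Cmod p)) by (field; lra). nra. }
  assert (HD : forall t, half_plane eps t -> Re t = x1 -> D2 th phi delta x1 1 1 t).
  { intros t Ht Hre. destruct (half_plane_Cmod _ _ Heps Ht) as [Hm Hi]. split; [|split].
    - split; [apply Cmod_pos_neq_0; exact Hm|]. rewrite (Carg_half_plane eps) by easy.
      pose proof (atan_bound (Re t / Im t)). pose proof PI_RGT_0.
      destruct Heps as [-> | ->]; lra.
    - rewrite Hre, Rabs_right; lra.
    - intros s _ _ HR. rewrite Rminus_diag, Rpower_O by easy.
      rewrite Rmult_1_l. apply Rnot_lt_le. intros Hlt.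
      assert (Hs : x1 - 1 < Re s).
      { pose proof (re_le_Cmod (t - s)) as Q. replace (Re (t - s)) with (Re t - Re s) in Q
          by (unfold Re; simpl; ring). rewrite Hre in Q.
        assert (Rabs (x1 - Re s) < 1) by lra. apply Rabs_def2 in H. lra. }
      destruct (Hbig s Hs) as [B1 B2]. rewrite Ep in B1. rewrite Eq in B2.
      destruct HR as [HR|HR]; apply R2_zero_Cmod in HR; lra. }
  destruct (Has x1 1 1) as [A1 [A2 _]]; try lra.
  destruct A1 as [Ka A1]. destruct A2 as [Kb A2].
  destruct (near_infty_strip _ _ (x1 + 1) Heps A1) as [Ta Na].
  destruct (near_infty_strip _ _ (x1 + 1) Heps A2) as [Tb Nb].
  destruct (cpow_bound eps (x1 + 1) (- (3 * om)) Heps) as [C1 [HC1 G1]].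
  destruct (cpow_bound eps (x1 + 1) om Heps) as [C2 [HC2 G2]].
  destruct (cpow_bound eps (x1 + 1) 0 Heps) as [C3 [HC3 G3]].
  set (K := Rabs Ka * (C1 + C2) + Rabs Kb * (C3 + C1)).
  exists K, (Rmax 3 (Rmax Ta Tb)).
  assert (0 <= Rabs Ka * (C1 + C2)) by (apply Rmult_le_pos; [apply Rabs_pos | lra]).
  assert (0 <= Rabs Kb * (C3 + C1)) by (apply Rmult_le_pos; [apply Rabs_pos | lra]).
  split; [unfold K; lra|].
  intros t Ht Hre.
  pose proof (Rmax_l 3 (Rmax Ta Tb)). pose proof (Rmax_r 3 (Rmax Ta Tb)).
  pose proof (Rmax_l Ta Tb). pose proof (Rmax_r Ta Tb).
  assert (Hs : forall T, T <= 3 \/ T <= Ta \/ T <= Tb -> strip eps (x1 + 1) T t).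
  { intros T HT. split; [rewrite Hre, Rabs_right|]; lra. }
  assert (HDt : D2 th phi delta x1 1 1 t) by (apply HD; [unfold half_plane; lra | easy]).
  specialize (Na t (Hs Ta ltac:(lra)) HDt). specialize (Nb t (Hs Tb ltac:(lra)) HDt).
  destruct (G1 t (Hs 3 ltac:(lra))) as [_ B1]. destruct (G2 t (Hs 3 ltac:(lra))) as [_ B2].
  destruct (G3 t (Hs 3 ltac:(lra))) as [B3 _]. pose proof (lnq_pos (eps * Im t) ltac:(lra)) as Lp.
  assert (Em1 : RtoC (-1) = (- (1))%C) by (unfold RtoC, Copp; simpl; f_equal; ring).
  assert (E1 : (RtoC (-1) + Ci * RtoC (- (3 * om)))%C = (- (3 * nu2 th phi) - 1)%C).
  { rewrite <- E, Em1, RtoC_opp, RtoC_mult. ring. }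
  assert (E2 : (RtoC (-1) + Ci * om)%C = (nu2 th phi - 1)%C).
  { rewrite <- E, Em1. ring. }
  assert (E3 : (RtoC (-1) + Ci * 0)%C = RtoC (-1)) by ring.
  rewrite E1 in B1. rewrite E2 in B2. rewrite E3 in B3.
  destruct (Hbig t ltac:(lra)) as [P1 P2]. rewrite !Cmod_mult.
  set (l := lnq (eps * Im t)) in *.
  assert (Kl : forall k c1 c2 x x1 x2, 0 <= x1 + x2 -> x <= k * (x1 + x2) -> x1 <= c1 * l -> x2 <= c2 * l ->
     x <= Rabs k * (c1 + c2) * l).
  { intros k c1 c2 x x' x2 H5 H6 H7 H8. eapply Rle_trans; [exact H6|].
    apply Rle_trans with (Rabs k * (x' + x2)).
    - apply Rmult_le_compat_r; [easy | apply Rle_abs].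
    - rewrite Rmult_assoc. apply Rmult_le_compat_l; [apply Rabs_pos | lra]. }
  assert (F1 : Cmod (t / y t - Wf p q (X2 th phi delta) t) <= Rabs Ka * (C1 + C2) * l).
  { eapply Kl; [|rewrite Ep, Eq; exact Na| exact B1 | exact B2].
    apply Rplus_le_le_0_compat; apply Cmod_ge_0. }
  assert (F2 : Cmod (z t - Zf p q (X2 th phi delta) t) <= Rabs Kb * (C3 + C1) * l).
  { eapply Kl; [|rewrite Ep, Eq; exact Nb| exact B3 | exact B1].
    apply Rplus_le_le_0_compat; apply Cmod_ge_0. }
  unfold K. split; [|split; [|lra]].
  - eapply Rle_trans; [exact F1|]. apply Rmult_le_compat_r; lra.
  - eapply Rle_trans; [exact F2|]. apply Rmult_le_compat_r; lra.
Qed.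

Lemma Wf_expand p q X t : X t <> RtoC 0 -> Wf p q X t = (/ X t - (p + q) + p * q * X t)%C.
Proof. intros H. unfold Wf. field. auto. Qed.

(** Because p - q = a, one has Zf + a = - q (1 - p X), so that Zf (Zf + a) / Wf = p q X, and p q X -
    Zf = p. These identities turn the leading terms of t / y and z into those of v = z (z + a) / (t
    / y) and v - z. *)
Lemma start_vv_pp a (p q : C) (X : C -> C) eps x1 T0 (good : C -> Prop) (y z : C -> C) M K :
  eps = 1 \/ eps = -1 -> 0 <= T0 -> (p - q)%C = a -> p <> RtoC 0 -> q <> RtoC 0 ->
  (forall t, strip eps (x1 + 1) T0 t -> Cmod (X t) <= M) ->
  (forall t, strip eps (x1 + 1) T0 t -> good t -> Re t = x1 ->
    Cmod (t / y t - Wf p q X t) <= K * lnq (eps * Im t) /\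
    Cmod (z t - Zf p q X t) <= K * lnq (eps * Im t) /\
    2 <= Cmod (p * X t) /\ 2 <= Cmod (q * X t)) ->
  exists K0 T, T0 <= T /\ forall t, strip eps (x1 + 1) T t -> good t -> Re t = x1 ->
     Cmod (vv a y z t - p * q * X t) <= K0 * lnq (eps * Im t) /\
     Cmod (pp a y z t - p) <= K0 * lnq (eps * Im t).
Proof.
  intros Heps HT0 Ea Hp Hq HM Hst.
  assert (Mp : 0 < Cmod p) by now apply Cmod_pos.
  assert (Mq : 0 < Cmod q) by now apply Cmod_pos.
  (* Lower bound for |Wf|: |p X| >= 2 and |q X| >= 2 give |1 - p X| >= 1 and |1 - q X| >= |q X| /
     2. *)
  set (mw := Cmod q / 4 * 2). 
  assert (Hmw : 0 < mw) by (unfold mw; lra).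
  destruct (lnq_small K (mw / 2)) as [T1 HT1]; [lra|].
  set (T := Rmax T0 (Rmax 3 T1)).
  assert (HT : T0 <= T /\ 3 <= T /\ T1 <= T).
  { unfold T. pose proof (Rmax_l T0 (Rmax 3 T1)). pose proof (Rmax_r T0 (Rmax 3 T1)).
    pose proof (Rmax_l 3 T1). pose proof (Rmax_r 3 T1). lra. }
  set (S := fun t => strip eps (x1 + 1) T t /\ good t /\ Re t = x1).
  assert (HS : forall t, S t -> strip eps (x1 + 1) T0 t /\ good t /\ Re t = x1).
  { intros t [[A A'] G]. split; [split; lra | easy]. }
  set (N := fun t => lnq (eps * Im t)).
  assert (N0 : forall t, S t -> 0 <= N t).
  { intros t [[_ Ht] _]. left. apply lnq_pos. lra. }
  assert (HK : 0 <= Rabs K) by apply Rabs_pos.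
  assert (Hst' : forall t, S t -> Cmod (t / y t - Wf p q X t) <= Rabs K * N t /\
      Cmod (z t - Zf p q X t) <= Rabs K * N t /\ 2 <= Cmod (p * X t) /\ 2 <= Cmod (q * X t) /\
      K * lnq (eps * Im t) <= mw / 2 /\ Cmod (t / y t - Wf p q X t) <= K * lnq (eps * Im t)).
  { intros t Ht. destruct (HS t Ht) as [A [B C]]. destruct (Hst t A B C) as [D1 [D2 [D3 D4]]].
    pose proof (Rmult_le_compat_r (N t) K (Rabs K) (N0 t Ht) (Rle_abs K)). unfold N in *.
    destruct Ht as [[_ Ht] _]. specialize (HT1 (eps * Im t) ltac:(lra)).
    repeat split; try easy; lra. }
  assert (BX : bounded_on S X) by (exists M; intros t Ht; apply HM, HS, Ht).
  assert (Xn : forall t, S t -> X t <> RtoC 0 /\ 2 / Cmod p <= Cmod (X t)).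
  { intros t Ht. destruct (Hst' t Ht) as [_ [_ [D3 _]]]. rewrite Cmod_mult in D3.
    assert (2 / Cmod p <= Cmod (X t)).
    { apply Rmult_le_reg_l with (Cmod p); [easy|].
      replace (Cmod p * (2 / Cmod p)) with 2 by (field; lra). easy. }
    split; [|easy]. apply Cmod_pos_neq_0.
    assert (0 < 2 / Cmod p) by (apply Rdiv_lt_0_compat; lra). lra. }
  assert (BW : bounded_on S (Wf p q X)).
  { unfold Wf, Cdiv. apply bounded_mult.
    - repeat first [exact BX | apply bounded_const | apply bounded_minus | apply bounded_mult].
    - apply bounded_inv with (2 / Cmod p); [apply Rdiv_lt_0_compat; lra|]. apply Xn. }
  assert (BZ : bounded_on S (Zf p q X)).
  { unfold Zf. apply bounded_opp.
    repeat first [exact BX | apply bounded_const | apply bounded_minus | apply bounded_mult]. }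
  assert (LW : forall t, S t -> mw <= Cmod (Wf p q X t)).
  { intros t Ht. destruct (Hst' t Ht) as [_ [_ [D3 [D4 _]]]]. destruct (Xn t Ht) as [Xt _].
    unfold Wf. rewrite Cmod_div, Cmod_mult by easy.
    assert (Xp : 0 < Cmod (X t)) by now apply Cmod_pos.
    assert (Q : forall r, 2 <= Cmod (r * X t) -> Cmod (r * X t) / 2 <= Cmod (1 - r * X t)).
    { intros r Hr. pose proof (Cmod_minus_triangle 1 (1 - r * X t)) as Q.
      replace (1 - (1 - r * X t))%C with (r * X t)%C in Q by ring. rewrite Cmod_1 in Q. lra. }
    pose proof (Q p D3) as Q1. pose proof (Q q D4) as Q2. rewrite Cmod_mult in Q2.
    apply Rmult_le_reg_r with (Cmod (X t)); [easy|].
    unfold Rdiv at 1. rewrite Rmult_assoc, Rinv_l, Rmult_1_r by lra.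
    apply Rle_trans with (1 * (Cmod q * Cmod (X t) / 2)); [unfold mw; lra|].
    apply Rmult_le_compat; lra || (apply Rmult_le_pos; [apply Rmult_le_pos; lra | lra]). }
  assert (Lw : forall t, S t -> mw / 2 <= Cmod (t / y t)).
  { intros t Ht. specialize (LW t Ht). destruct (Hst' t Ht) as [_ [_ [_ [_ [D5 D6]]]]].
    pose proof (Cmod_minus_triangle (t / y t) (t / y t - Wf p q X t)) as Q.
    replace (t / y t - (t / y t - Wf p q X t))%C with (Wf p q X t) in Q by ring. lra. }
  assert (Cw : close_on S N (fun t => t / y t)%C (Wf p q X)).
  { split; [|split; [easy|]].
    - destruct BW as [MW HW]. exists (MW + mw / 2). intros t Ht.
      destruct (Hst' t Ht) as [_ [_ [_ [_ [D5 D6]]]]]. specialize (HW t Ht).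
      pose proof (Cmod_triangle (Wf p q X t) (t / y t - Wf p q X t)) as Q.
      replace (Wf p q X t + (t / y t - Wf p q X t))%C with (t / y t)%C in Q by ring. lra.
    - exists (Rabs K). split; [easy|]. intros t Ht. now apply Hst'. }
  assert (BN : forall t, S t -> N t <= 1).
  { intros t [[_ Ht] _]. unfold N, lnq. apply Rmult_le_reg_r with (eps * Im t); [lra|].
    unfold Rdiv. rewrite Rmult_assoc, Rinv_l by lra.
    pose proof (exp_ge_1_plus (ln (eps * Im t))). rewrite exp_ln in H by lra. lra. }
  assert (Cz : close_on S N z (Zf p q X)).
  { split; [|split; [easy|]].
    - destruct BZ as [MZ HZ]. exists (MZ + Rabs K). intros t Ht.
      destruct (Hst' t Ht) as [_ [D2 _]]. specialize (HZ t Ht). specialize (BN t Ht).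
      pose proof (Rmult_le_compat_l _ _ _ HK BN).
      pose proof (Cmod_triangle (Zf p q X t) (z t - Zf p q X t)) as Q.
      replace (Zf p q X t + (z t - Zf p q X t))%C with (z t)%C in Q by ring. lra.
    - exists (Rabs K). split; [easy|]. intros t Ht. now apply Hst'. }
  assert (Cc : forall c, close_on S N (fun _ => c) (fun _ => c)) by (intros; now apply close_const).
  assert (Cv : close_on S N (vv a y z) (fun t => p * q * X t)%C).
  { apply close_ext with (fun t => z t * (z t + a) / (t / y t))%C
      (fun t => Zf p q X t * (Zf p q X t + a) / Wf p q X t)%C.
    - intros t Ht. specialize (Lw t Ht). unfold vv.
      assert (Ny : y t <> RtoC 0).
      (* The inverse of 0 computes to 0, so y t = 0 would make t / y t vanish, against its lower
         bound. *)
      { intros Ey. rewrite Ey in Lw. unfold Cdiv in Lw.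
        replace (/ RtoC 0)%C with (RtoC 0) in Lw.
        - rewrite Cmult_0_r, Cmod_0 in Lw. lra.
        - unfold Cinv, RtoC; simpl. f_equal; unfold Rdiv; ring. }
      assert (Nt : t <> RtoC 0).
      { destruct Ht as [Ht _]. apply (strip_neq_0 eps (x1 + 1) T); [lra | easy]. }
      field. auto.
    - intros t Ht. specialize (LW t Ht). destruct (Xn t Ht) as [Nx _].
      assert (NW : ((1 - p * X t) * (1 - q * X t))%C <> RtoC 0).
      { intros E0. unfold Wf in LW. rewrite E0 in LW. unfold Cdiv in LW.
        rewrite Cmult_0_l, Cmod_0 in LW. lra. }
      assert (N1 : (1 - p * X t)%C <> RtoC 0) by (intros E0; apply NW; rewrite E0; ring).
      assert (N2 : (1 - q * X t)%C <> RtoC 0) by (intros E0; apply NW; rewrite E0; ring).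
      unfold Zf, Wf. rewrite <- Ea. field. auto.
    - apply close_div with (mw / 2); auto; [lra| |].
      + intros t Ht. specialize (LW t Ht). lra.
      + apply close_mult; [exact Cz|]. apply close_plus; [exact Cz | apply Cc]. }
  assert (Cp : close_on S N (pp a y z) (fun _ => p)).
  { apply close_ext with (fun t => vv a y z t - z t)%C (fun t => p * q * X t - Zf p q X t)%C.
    - reflexivity.
    - intros t Ht. unfold Zf. ring.
    - now apply close_minus. }
  destruct Cv as [_ [_ [K1 [HK1 E1]]]]. destruct Cp as [_ [_ [K2 [HK2 E2]]]].
  exists (K1 + K2), T. split; [easy|]. intros t Ht Gt Hre.
  assert (St : S t) by (split; auto). specialize (E1 t St). specialize (E2 t St). specialize (N0 t St).
  cbv beta in *. unfold N in *. split; nra.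
Qed.

(** * Reflection in the imaginary axis *)

(** Return to the original variables on the whole strip. The division is now by v, which is bounded
    below, in t / y = z (z + a) / v; it remains valid where Wf is small, that is, inside the discs
    removed from [D2]. *)
Lemma strip_conclusion_w a (p q : C) (X : C -> C) eps x1 (good : C -> Prop) (y z : C -> C) m M K T :
  (p - q)%C = a -> p <> RtoC 0 -> q <> RtoC 0 -> 0 < m -> 3 <= T -> 0 <= K ->
  (forall t, Rabs (Re t) <= x1 -> T < eps * Im t -> m <= Cmod (X t) <= M) ->
  strip_conclusion a p (p * q) X eps x1 good y z K T ->
  exists K' M' T', 0 <= K' /\ T <= T' /\ forall t, Rabs (Re t) <= x1 -> T' < eps * Im t -> good t ->
    y t <> RtoC 0 /\ Cmod (t / y t) <= M' /\
    Cmod (t / y t - Wf p q X t) <= K' * lnq (eps * Im t) /\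
    Cmod (z t - Zf p q X t) <= K' * lnq (eps * Im t).
Proof.
  intros Ea Hp Hq Hm HT HK HX Hcon.
  assert (Hpq : (p * q)%C <> RtoC 0) by now apply Cmult_neq_0.
  set (k0 := Cmod (p * q)). assert (Hk0 : 0 < k0) by now apply Cmod_pos.
  assert (Hkm : 0 < k0 * m / 2) by nra.
  destruct (lnq_small K (Rmin 1 (k0 * m / 2))) as [T1 HT1]; [apply Rmin_glb_lt; lra|].
  set (T' := Rmax T T1). assert (HTT : T <= T') by apply Rmax_l. assert (HT1' : T1 <= T') by apply Rmax_r.
  set (S := fun t => Rabs (Re t) <= x1 /\ T' < eps * Im t /\ good t).
  set (N := fun t => lnq (eps * Im t)).
  assert (N0 : forall t, S t -> 0 <= N t) by (intros t [_ [Ht _]]; left; apply lnq_pos; lra).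
  assert (Hc : forall t, S t -> Cmod (vv a y z t - p * q * X t) <= K * N t /\
     Cmod (pp a y z t - p) <= K * N t /\ K * N t <= 1 /\ K * N t <= k0 * m / 2 /\ m <= Cmod (X t) <= M).
  { intros t [Hx [Hy Gt]]. destruct (Hcon t Hx ltac:(lra) Gt) as [A1 A2].
    specialize (HT1 (eps * Im t) ltac:(lra)).
    pose proof (Rmin_l 1 (k0 * m / 2)). pose proof (Rmin_r 1 (k0 * m / 2)).
    unfold N. repeat split; try easy; try lra; apply (HX t Hx); lra. }
  assert (BX : bounded_on S X) by (exists M; intros t Ht; apply Hc, Ht).
  assert (LX : forall t, S t -> X t <> RtoC 0).
  { intros t Ht. apply Cmod_pos_neq_0. destruct (Hc t Ht) as [_ [_ [_ [_ ?]]]]. lra. }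
  assert (LkX : forall t, S t -> k0 * m <= Cmod (p * q * X t)).
  { intros t Ht. rewrite Cmod_mult. fold k0. apply Rmult_le_compat_l; [lra|]. apply Hc, Ht. }
  assert (LV : forall t, S t -> k0 * m / 2 <= Cmod (vv a y z t)).
  { intros t Ht. specialize (LkX t Ht). destruct (Hc t Ht) as [A1 [_ [_ [A2 _]]]].
    pose proof (Cmod_minus_triangle (vv a y z t) (vv a y z t - p * q * X t)) as Q.
    replace (vv a y z t - (vv a y z t - p * q * X t))%C with (p * q * X t)%C in Q by ring. lra. }
  assert (BkX : bounded_on S (fun t => p * q * X t)%C).
  { apply bounded_mult; [apply bounded_const | exact BX]. }
  assert (Cv : close_on S N (vv a y z) (fun t => p * q * X t)%C).
  { split; [|split; [easy|]].
    - destruct BkX as [M1 H1]. exists (M1 + 1). intros t Ht. specialize (H1 t Ht).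
      destruct (Hc t Ht) as [A1 [_ [A2 _]]].
      pose proof (Cmod_triangle (p * q * X t) (vv a y z t - p * q * X t)) as Q.
      replace (p * q * X t + (vv a y z t - p * q * X t))%C with (vv a y z t) in Q by ring. lra.
    - exists K. split; [easy|]. intros t Ht. apply Hc, Ht. }
  assert (Cc : forall c, close_on S N (fun _ => c) (fun _ => c)) by (intros; now apply close_const).
  assert (Cp : close_on S N (pp a y z) (fun _ => p)).
  { split; [|split; [apply bounded_const|]].
    - exists (Cmod p + 1). intros t Ht. destruct (Hc t Ht) as [_ [A1 [A2 _]]].
      pose proof (Cmod_triangle p (pp a y z t - p)) as Q.
      replace (p + (pp a y z t - p))%C with (pp a y z t) in Q by ring. lra.
    - exists K. split; [easy|]. intros t Ht. apply Hc, Ht. }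
  assert (Cz : close_on S N z (Zf p q X)).
  { apply close_ext with (fun t => vv a y z t - pp a y z t)%C (fun t => p * q * X t - p)%C.
    - intros t _. unfold pp. ring.
    - intros t _. unfold Zf. ring.
    - now apply close_minus. }
  assert (Ny : forall t, S t -> t <> RtoC 0 /\ y t <> RtoC 0 /\ z t <> RtoC 0 /\ (z t + a)%C <> RtoC 0).
  { intros t Ht. assert (Nt : t <> RtoC 0).
    { intros E. destruct Ht as [_ [Ht _]]. rewrite E in Ht. unfold Im in Ht; simpl in Ht. lra. }
    split; [easy|]. apply (vv_neq_0 a y z t Nt). apply Cmod_pos_neq_0.
    specialize (LV t Ht). lra. }
  assert (Cw : close_on S N (fun t => t / y t)%C (Wf p q X)).
  { apply close_ext with (fun t => z t * (z t + a) / vv a y z t)%C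
      (fun t => Zf p q X t * (Zf p q X t + a) / (p * q * X t))%C.
    - intros t Ht. destruct (Ny t Ht) as [N1 [N2 [N3 N4]]]. unfold vv. field. auto.
    - intros t Ht. specialize (LX t Ht). unfold Zf, Wf. rewrite <- Ea. field. auto.
    - apply close_div with (k0 * m / 2); auto.
      + intros t Ht. specialize (LkX t Ht). lra.
      + apply close_mult; [exact Cz|]. apply close_plus; [exact Cz | apply Cc]. }
  destruct Cw as [[M' HM'] [_ [K1 [HK1 E1]]]]. destruct Cz as [_ [_ [K2 [HK2 E2]]]].
  exists (K1 + K2), M', T'. split; [lra|]. split; [easy|]. intros t Hx Hy Gt.
  assert (St : S t) by (split; auto). specialize (E1 t St). specialize (E2 t St). specialize (N0 t St).
  split; [apply Ny, St|]. split; [apply HM', St|].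
  unfold N in *. split; nra.
Qed.

Lemma Cconj_RtoC (x : R) : Cconj x = RtoC x.
Proof. unfold Cconj, RtoC; simpl. now rewrite Ropp_0. Qed.

Lemma Cconj_Ci : Cconj Ci = (- Ci)%C.
Proof. unfold Cconj, Ci, Copp; simpl. f_equal; ring. Qed.

Definition yhat (y : C -> C) (t : C) : C := Cconj (y (refl t)).
Definition zhat (a : C) (g : R) (y z : C -> C) (t : C) : C :=
  (Cconj (z (refl t)) + t * yhat y t / ((yhat y t - 1) * (yhat y t - 1)) + (Cconj a - a) / 2
   - Ci * g / (yhat y t - 1))%C.

(* Only a^2 and b^2 enter the fifth Painleve equation, which is invariant under
   t -> - conj t when they are real and gamma is imaginary; zhat is obtained by
   solving the first equation of the system for z. *)
Lemma reflected_ode (a B : C) (g : R) (y z : C -> C) (t yd zd : C) :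
  Cconj a = a \/ Cconj a = (- a)%C -> Cconj B = B -> t <> RtoC 0 ->
  lder y (refl t) yd -> lder z (refl t) zd ->
  ode_y a g (refl t) (y (refl t)) (z (refl t)) yd ->
  ode_z a B g (refl t) (y (refl t)) (z (refl t)) zd ->
  y (refl t) <> RtoC 0 -> yhat y t <> RtoC 1 ->
  exists yd' zd', lder (yhat y) t yd' /\ lder (zhat a g y z) t zd' /\
    ode_y a g t (yhat y t) (zhat a g y z t) yd' /\ ode_z a B g t (yhat y t) (zhat a g y z t) zd'.
Proof.
  intros Ha HB Ht Ly Lz Ey Ez Hy0 Hy1.
  assert (Lyh : lder (yhat y) t (- Cconj yd)) by now apply lder_reflect.
  assert (Lzb : lder (fun t => Cconj (z (refl t))) t (- Cconj zd)) by now apply lder_reflect.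
  assert (N1 : (yhat y t - 1)%C <> RtoC 0) by now apply Cminus_neq_0.
  assert (N0 : yhat y t <> RtoC 0).
  { unfold yhat. intros E. apply Hy0. rewrite <- (Cconj_conj (y (refl t))), E. apply Cconj_RtoC. }
  assert (Crefl : Cconj (refl t) = (- t)%C) by (unfold refl; rewrite Copp_conj, Cconj_conj; ring).
  apply (f_equal Cconj) in Ey. apply (f_equal Cconj) in Ez.
  unfold ode_y in Ey. unfold ode_z, Qz in Ez.
  assert (R2n : RtoC 2 <> RtoC 0) by (intros E; apply RtoC_eq_0 in E; lra).
  assert (R4n : RtoC 4 <> RtoC 0) by (intros E; apply RtoC_eq_0 in E; lra).
  repeat rewrite ?Cplus_conj, ?Cminus_conj, ?Cmult_conj in Ez.
  rewrite (Cdiv_conj _ _ Hy0), (Cdiv_conj _ _ R2n), (Cdiv_conj _ _ R4n) in Ez.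
  repeat rewrite ?Cplus_conj, ?Cminus_conj, ?Cmult_conj, ?Cpow_conj, ?Cconj_RtoC, ?Cconj_Ci, ?Crefl in Ey.
  repeat rewrite ?Cplus_conj, ?Cminus_conj, ?Cmult_conj, ?Cpow_conj, ?Cconj_RtoC, ?Cconj_Ci, ?Crefl in Ez.
  fold (yhat y t) in Ey, Ez. rewrite ?HB in Ez.
  set (w := yhat y t) in *. set (zb := Cconj (z (refl t))) in *.
  eexists. eexists. split; [exact Lyh|]. split.
  - unfold zhat. apply lder_minus; [apply lder_plus; [apply lder_plus; [exact Lzb|]|apply lder_const]|].
    + apply lder_div; [fold w; now apply Cmult_neq_0| |].
      * apply lder_mult; [apply lder_id | exact Lyh].
      * apply lder_mult; apply lder_minus; try exact Lyh; apply lder_const.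
    + apply lder_div; [exact N1 | apply lder_const |]. apply lder_minus; [exact Lyh | apply lder_const].
  - fold w. unfold zhat. fold w. fold zb.
    set (ydb := Cconj yd) in *. set (zdb := Cconj zd) in *.
    match type of Ey with _ = ?r => assert (Ey' : ydb = (r / - t)%C) end.
    { rewrite <- Ey. field. auto. }
    match type of Ez with _ = ?r => assert (Ez' : zdb = (r / - t)%C) end.
    { rewrite <- Ez. field. auto. }
    rewrite Ez', Ey'. unfold ode_y, ode_z, Qz. clearbody w zb ydb zdb. clear - Ha N0 N1 Ht.
    (* The derivatives have been eliminated by the conjugated system; for a real and for a
       imaginary, both equations are now rational identities in t, w, zb, a, B and g. *)
    destruct Ha as [-> | ->]; split; field; repeat split; auto.
Qed.

(** * Propagation along the ray *)

Lemma locally_near (s : C) (P : C -> Prop) : locally s P <-> near s P.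
Proof.
  split.
  - intros [e He]. exists e. split; [apply cond_pos|]. intros x Hx. apply He.
    split; (eapply Rle_lt_trans; [|exact Hx]).
    + apply (re_le_Cmod (x - s)).
    + apply (im_le_Cmod (x - s)).
  - intros [d [Hd H]]. assert (Hd2 : 0 < d / 2) by lra. exists (mkposreal _ Hd2).
    intros x [H1 H2]. apply H. eapply Rle_lt_trans; [apply Cmod_le_Rabs|].
    change (Rabs (fst x - fst s) < d / 2) in H1. change (Rabs (snd x - snd s) < d / 2) in H2.
    unfold Re, Im; simpl. unfold Rminus in *. lra.
Qed.

Lemma cder_is_derive (f : C -> C) (s l : C) :
  cder f s l -> @is_derive C_AbsRing C_NormedModule f s l.
Proof.
  intros H. split; [apply (@is_linear_scal_l C_AbsRing C_NormedModule l)|].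
  intros x Hx e.
  assert (Ex : s = x) by (apply (@is_filter_lim_locally_unique C_AbsRing (AbsRing_NormedModule C_AbsRing)); exact Hx).
  subst x.
  destruct (cder_affine_bound f s l e H (cond_pos e)) as [d [Hd G]].
  exists (mkposreal d Hd). intros z Hz.
  change (Cmod (f z - f s - (z - s) * l) <= e * Cmod (z - s)).
  specialize (G z Hz). now replace (f z - f s - (z - s) * l)%C with (f z - (f s + l * (z - s)))%C by ring.
Qed.

Definition cdiff (f : C -> C) (s : C) : Prop := exists l, cder f s l.

Lemma holomorphic_at_near f s : holomorphic_at f s <-> near s (cdiff f).
Proof.
  unfold holomorphic_at. rewrite locally_near. split; apply near_mono; intros x [l Hl]; exists l.
  - now apply is_derive_cder.
  - now apply cder_is_derive.
Qed.

Lemma holomorphic_at_lder f s : holomorphic_at f s -> lder f s (C_derive f s).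
Proof.
  intros H. apply cder_lder, is_derive_cder, C_derive_correct; [exact (RtoC 0)|].
  apply holomorphic_at_near, near_self in H. destruct H as [l Hl]. exists l. now apply cder_is_derive.
Qed.

Lemma near_ball (s q : C) d : Cmod (q - s) < d -> near q (fun x => Cmod (x - s) < d).
Proof.
  intros H. exists (d - Cmod (q - s)). split; [lra|]. intros x Hx.
  replace (x - s)%C with ((x - q) + (q - s))%C by ring.
  pose proof (Cmod_triangle (x - q) (q - s)). lra.
Qed.

Lemma near_punctured_open (P : C -> Prop) t : punctured P t -> punctured (fun s => near s P) t.
Proof.
  intros H. apply near_open in H. revert H. apply near_mono. intros s Hs Hst.
  generalize (near_and _ _ _ Hs (near_neq s t Hst)). apply near_mono. tauto.
Qed.

Lemma meromorphic_at_punctured f t : meromorphic_at f t -> punctured (holomorphic_at f) t.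
Proof.
  intros [n [g [Hg Hf]]]. apply holomorphic_at_near in Hg. apply locally_near in Hf.
  apply near_punctured_open in Hf. apply near_open in Hg.
  generalize (near_and _ _ _ Hg Hf). apply near_mono. intros s [H1 H2] Hst. specialize (H2 Hst).
  apply holomorphic_at_near.
  generalize (near_and _ _ _ (near_and _ _ _ H1 (near_open _ _ H2)) (near_neq s t Hst)).
  apply near_mono. intros x [[[l Hl] Hx] Hxt].
  destruct (cder_pow (fun z => / (z - t))%C x _ n
    (cder_inv (fun z => z - t)%C x 1 (Cminus_neq_0 _ _ Hxt) (cder_shift t x))) as [m Hm].
  eexists. eapply cder_ext; [|apply cder_mult; [exact Hl | exact Hm]].
  generalize (near_and _ _ _ Hx (near_neq x t Hxt)). apply near_mono. intros w [-> Hwt].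
  unfold Cdiv. f_equal. apply Cpow_inv. now apply Cminus_neq_0.
Qed.

Lemma punctured_and (P Q : C -> Prop) t : punctured P t -> punctured Q t ->
  punctured (fun s => P s /\ Q s) t.
Proof.
  intros H K. generalize (near_and _ _ _ H K). apply near_mono. intuition.
Qed.

Lemma punctured_refl (P : C -> Prop) t : punctured P (refl t) -> punctured (fun s => P (refl s)) t.
Proof.
  intros [d [Hd H]]. exists d. split; [easy|]. intros x Hx Hxt. apply H.
  - now rewrite refl_minus, Cmod_refl.
  - intros E. apply Hxt. rewrite <- (refl_refl x), E. apply refl_refl.
Qed.

Lemma near_refl (P : C -> Prop) t : near (refl t) P -> near t (fun s => P (refl s)).
Proof.
  intros [d [Hd H]]. exists d. split; [easy|]. intros x Hx. apply H.
  now rewrite refl_minus, Cmod_refl.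
Qed.

Lemma ccont_reflect f t : ccont f (refl t) -> ccont (yhat f) t.
Proof.
  intros H e He. destruct (H e He) as [d [Hd G]]. exists d. split; [easy|]. intros x Hx.
  unfold yhat. rewrite <- Cminus_conj, Cmod_conj. apply G. now rewrite refl_minus, Cmod_refl.
Qed.

Lemma cdiff_reflect f t : cdiff f (refl t) -> cdiff (yhat f) t.
Proof.
  intros [l [phi [El [Hc Hn]]]]. exists (- (1) * yhat phi t)%C.
  exists (fun x => - (1) * yhat phi x)%C. split; [easy|]. split.
  - apply ccont_mult; [apply ccont_const | now apply ccont_reflect].
  - apply near_refl in Hn. revert Hn. apply near_mono. intros x Hx. unfold yhat.
    rewrite Hx, refl_minus, Cplus_conj, Cmult_conj. unfold refl at 3.
    rewrite Copp_conj, Cconj_conj. ring.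
Qed.

Definition ray (eps tau : R) : C := (Ci * RtoC (eps * tau))%C.

Lemma refl_ray eps tau : refl (ray eps tau) = ray eps tau.
Proof. unfold refl, ray. rewrite Cmult_conj, Cconj_Ci, Cconj_RtoC. ring. Qed.

Lemma ray_dist eps s t : eps = 1 \/ eps = -1 -> Cmod (ray eps s - ray eps t) = Rabs (s - t).
Proof.
  intros Heps. unfold ray. replace (Ci * RtoC (eps * s) - Ci * RtoC (eps * t))%C
    with (Ci * RtoC (eps * (s - t)))%C by (rewrite !RtoC_mult, RtoC_minus; ring).
  rewrite Cmod_mult, Cmod_Ci, Cmod_R, Rmult_1_l, Rabs_mult.
  destruct Heps as [-> | ->]; [rewrite Rabs_R1; ring|].
  rewrite (Rabs_left (-1)) by lra. ring.
Qed.

Lemma half_plane_ray_pos eps tau : eps = 1 \/ eps = -1 -> 0 < tau -> half_plane eps (ray eps tau).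
Proof.
  intros Heps H. unfold ray. apply half_plane_ray. rewrite <- Rmult_assoc, (sign_sq _ Heps). lra.
Qed.

Lemma cdiff_scal c f t : cdiff f t -> cdiff (fun x => c * f x)%C t.
Proof. intros [l Hl]. eexists. apply cder_mult; [apply cder_const | exact Hl]. Qed.

(* At a point of the ray both y and its reflection are g / (s - t0)^n with the
   same n, up to sign; compare the two numerators. *)
Lemma reflection_local (y : C -> C) (t0 : C) : refl t0 = t0 -> meromorphic_at y t0 ->
  exists r, 0 < r /\ forall q, q <> t0 -> Cmod (q - t0) < r -> punctured (fun s => y s = yhat y s) q ->
    forall s, s <> t0 -> Cmod (s - t0) < r -> y s = yhat y s.
Proof.
  intros Et [n [g [Hg Hf]]]. apply holomorphic_at_near in Hg. apply locally_near in Hf.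
  (* The conjugate of refl s - t0 is - (s - t0), so the reflected denominator is (-1)^n (s - t0)^n,
     and y = yhat y near t0 amounts to the vanishing of G. *)
  set (G := fun s => ((- (1)) ^ n * g s + - (1) * yhat g s)%C).
  assert (Hg' : near t0 (fun s => cdiff g (refl s))) by (apply near_refl; now rewrite Et).
  assert (HG : near t0 (cdiff G)).
  { generalize (near_and _ _ _ Hg Hg'). apply near_mono. intros s [H1 H2].
    apply (cdiff_scal ((- (1)) ^ n)%C) in H1. apply cdiff_reflect in H2. apply (cdiff_scal (- (1))%C) in H2.
    destruct H1 as [l1 H1]. destruct H2 as [l2 H2]. eexists. apply cder_plus; eauto. }
  assert (Hf' : near t0 (fun s => refl s <> t0 -> y (refl s) = (g (refl s) / (refl s - t0) ^ n)%C)).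
  { apply (near_refl (fun s => s <> t0 -> y s = (g s / (s - t0) ^ n)%C)). now rewrite Et. }
  assert (HGy : near t0 (fun s => s <> t0 -> (y s = yhat y s <-> G s = RtoC 0))).
  { generalize (near_and _ _ _ Hf Hf'). apply near_mono. intros s [H1 H2] Hs. specialize (H1 Hs).
    assert (Hrs : refl s <> t0).
    { intros E. apply Hs. rewrite <- (refl_refl s), E. exact Et. }
    specialize (H2 Hrs). unfold G, yhat. rewrite H1, H2.
    pose proof (Cminus_neq_0 _ _ Hs) as N.
    assert (E1 : Cconj (refl s - t0) = (- (1) * (s - t0))%C).
    { replace (refl s - t0)%C with (refl (s - t0))%C by (rewrite <- refl_minus, Et; reflexivity).
      unfold refl. rewrite Copp_conj, Cconj_conj. ring. }
    assert (Nr : (refl s - t0)%C <> RtoC 0) by now apply Cminus_neq_0.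
    rewrite Cdiv_conj, Cpow_conj, E1 by now apply Cpow_nz.
    rewrite Cpow_mult_l.
    assert (Nn : ((s - t0) ^ n)%C <> RtoC 0) by now apply Cpow_nz.
    assert (M1 : ((- (1)) ^ n)%C <> RtoC 0).
    { apply Cpow_nz. intros E. apply (f_equal Re) in E. unfold Re in E; simpl in E. lra. }
    set (A := ((s - t0) ^ n)%C) in *. set (e := ((- (1)) ^ n)%C) in *. split; intros E.
    - assert (E2 : g s = (A * (Cconj (g (refl s)) / (e * A)))%C) by (rewrite <- E; field; auto).
      rewrite E2. field. auto.
    - assert (E2 : g s = (Cconj (g (refl s)) / e)%C).
      { replace (Cconj (g (refl s))) with (e * g s - (e * g s + - (1) * Cconj (g (refl s))))%C by ring.
        rewrite E. field. auto. }
      rewrite E2. field. auto. }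
  assert (HGb : near t0 (fun s => Cmod (G s) <= Cmod (G t0) + 1)).
  { destruct (near_self _ _ HG) as [l Hl]. apply cder_ccont in Hl.
    destruct (Hl 1 Rlt_0_1) as [d [Hd Q]]. exists d. split; [easy|]. intros s Hs. specialize (Q s Hs).
    pose proof (Cmod_triangle (G t0) (G s - G t0)) as K.
    replace (G t0 + (G s - G t0))%C with (G s) in K by ring. lra. }
  destruct (near_and _ _ _ (near_and _ _ _ HG HGb) HGy) as [d [Hd H]].
  (* Inside radius d / 30 one has |s - q| < d / 15 < (d / 4) / 3, as [identity_local] requires, and
     the square of half-side d / 4 about s stays in the disc of radius d. *)
  exists (d / 30). split; [lra|]. intros q Hq Hqd Hpq s Hs Hsd.
  assert (HGq : punctured (fun s => G s = RtoC 0) q).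
  { assert (Hnq : near q (fun x => Cmod (x - t0) < d)) by (apply near_ball; lra).
    generalize (near_and _ _ _ (near_and _ _ _ Hpq Hnq) (near_neq q t0 Hq)).
    apply near_mono. intros x [[H1 H2] H3] Hxq. apply (H x H2); auto. }
  assert (HGq0 : G q = RtoC 0).
  { destruct (H q ltac:(lra)) as [[[l Hl] _] _]. apply cder_ccont in Hl.
    apply Cmod_eq_0. apply Rle_antisym; [|apply Cmod_ge_0]. apply Rnot_lt_le. intros Hp.
    destruct (Hl (Cmod (G q)) Hp) as [e [He Q]]. destruct HGq as [e' [He' Q']].
    pose proof (Rmin_glb_lt _ _ _ He He') as Hm. pose proof (Rmin_l e e'). pose proof (Rmin_r e e').
    set (x := (q + RtoC (Rmin e e' / 2))%C).
    assert (Ex : (x - q)%C = RtoC (Rmin e e' / 2)) by (unfold x; ring).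
    assert (Dx : Cmod (x - q) = Rmin e e' / 2) by (rewrite Ex, Cmod_R, Rabs_right; lra).
    specialize (Q x ltac:(lra)). rewrite Q' in Q.
    - replace (0 - G q)%C with (- G q)%C in Q by ring. rewrite Cmod_opp in Q. lra.
    - lra.
    - intros E. rewrite E, Cmod_self in Dx. lra. }
  apply (H s ltac:(lra)); auto.
  apply (identity_local G s q (d / 4) (Cmod (G t0) + 1)); [lra| | | |].
  - intros z Hz. apply (H z). pose proof (in_square_near _ _ _ Hz).
    pose proof (Cmod_triangle (z - s) (s - t0)) as K.
    replace (z - s + (s - t0))%C with (z - t0)%C in K by ring. lra.
  - intros z Hz. apply (H z). pose proof (in_square_near _ _ _ Hz).
    pose proof (Cmod_triangle (z - s) (s - t0)) as K.
    replace (z - s + (s - t0))%C with (z - t0)%C in K by ring. lra.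
  - destruct HGq as [e [He Q]]. exists e. split; [easy|]. intros x Hx.
    destruct (classic (x = q)) as [->|N]; [easy | now apply Q].
  - pose proof (Cmod_minus_triangle (s - t0) (q - t0)) as K.
    replace (s - t0 - (q - t0))%C with (s - q)%C in K by ring. lra.
Qed.

(** At the supremum m of the heights where the symmetry fails, [reflection_local] applies whether or
    not y has a pole. The symmetry just above m spreads to a full punctured disc about m, hence to
    heights below m, a contradiction. *)
Lemma real_propagates eps (y : C -> C) T : eps = 1 \/ eps = -1 ->
  (forall t, half_plane eps t -> meromorphic_at y t) ->
  (forall tau, T < tau -> 0 < tau -> punctured (fun s => y s = yhat y s) (ray eps tau)) ->
  forall tau, 0 < tau -> punctured (fun s => y s = yhat y s) (ray eps tau).
Proof.
  intros Heps Hm Hbase tau Htau. apply NNPP. intros Hbad.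
  set (A := fun x => 0 < x /\ ~ punctured (fun s => y s = yhat y s) (ray eps x)).
  destruct (completeness A) as [m [U L]].
  - exists (Rmax T 0). intros x [Hx Nx]. apply Rnot_lt_le. intros Hlt. apply Nx.
    pose proof (Rmax_l T 0). apply Hbase; lra.
  - now exists tau.
  - assert (Hm0 : 0 < m) by (eapply Rlt_le_trans; [exact Htau | now apply U]).
    destruct (reflection_local y (ray eps m) (refl_ray eps m)) as [r [Hr H]].
    { now apply Hm, half_plane_ray_pos. }
    assert (Hall : forall s, s <> ray eps m -> Cmod (s - ray eps m) < r -> y s = yhat y s).
    { apply (H (ray eps (m + r / 2))).
      - intros E. pose proof (ray_dist eps (m + r / 2) m Heps) as D. rewrite E, Cmod_self in D.
        rewrite Rabs_right in D; lra.
      - rewrite ray_dist by easy. rewrite Rabs_right; lra.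
      - apply NNPP. intros N. assert (A (m + r / 2)) by (split; [lra | easy]).
        specialize (U _ H0). lra. }
    assert (m <= m - r / 2); [|lra]. apply L. intros x [Hx Nx]. apply Rnot_lt_le. intros Hlt.
    apply Nx. assert (Hxm : x <= m) by (apply U; split; easy).
    assert (Hn : near (ray eps x) (fun s => Cmod (s - ray eps m) < r)).
    { apply near_ball.
      rewrite ray_dist by easy. apply Rabs_def1; lra. }
    destruct (Req_dec x m) as [->|Hne].
    + revert Hn. apply near_mono. intros s Hs Hsm. now apply Hall.
    + assert (Hne' : ray eps x <> ray eps m).
      { intros E. pose proof (ray_dist eps x m Heps) as D. rewrite E, Cmod_self in D.
        symmetry in D. apply Rabs_eq_0 in D. lra. }
      generalize (near_and _ _ _ Hn (near_neq _ _ Hne')). apply near_mono. intros s [H1 H2] _.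
      now apply Hall.
Qed.

Lemma punctured_eq_continuous (f g : C -> C) t : ccont f t -> ccont g t ->
  punctured (fun s => f s = g s) t -> f t = g t.
Proof.
  intros Hf Hg Hp. pose proof (ccont_minus _ _ _ Hf Hg) as Hc.
  assert (E : (f t - g t)%C = RtoC 0).
  { apply Cmod_eq_0. apply Rle_antisym; [|apply Cmod_ge_0]. apply Rnot_lt_le. intros Hpos.
    destruct (Hc _ Hpos) as [e [He Q]]. destruct Hp as [e' [He' Q']].
    pose proof (Rmin_glb_lt _ _ _ He He') as Hm. pose proof (Rmin_l e e'). pose proof (Rmin_r e e').
    set (x := (t + RtoC (Rmin e e' / 2))%C).
    assert (Ex : (x - t)%C = RtoC (Rmin e e' / 2)) by (unfold x; ring).
    assert (Dx : Cmod (x - t) = Rmin e e' / 2) by (rewrite Ex, Cmod_R, Rabs_right; lra).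
    specialize (Q x ltac:(lra)). rewrite Q' in Q.
    - replace (g x - g x - (f t - g t))%C with (- (f t - g t))%C in Q by ring. rewrite Cmod_opp in Q. lra.
    - lra.
    - intros E. rewrite E, Cmod_self in Dx. lra. }
  replace (f t) with ((f t - g t) + g t)%C by ring. rewrite E. ring.
Qed.

(** * Type-2 solutions *)

Lemma strip_open eps x0 T t : eps = 1 \/ eps = -1 -> strip eps x0 T t -> near t (strip eps x0 T).
Proof.
  intros Heps [Hx Hy]. exists (Rmin (x0 - Rabs (Re t)) (eps * Im t - T)).
  split; [apply Rmin_glb_lt; lra|]. intros s Hs.
  pose proof (Rmin_l (x0 - Rabs (Re t)) (eps * Im t - T)).
  pose proof (Rmin_r (x0 - Rabs (Re t)) (eps * Im t - T)).
  pose proof (re_le_Cmod (s - t)) as R1. pose proof (im_le_Cmod (s - t)) as I1.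
  replace (Re (s - t)) with (Re s - Re t) in R1 by (unfold Re; simpl; ring).
  replace (Im (s - t)) with (Im s - Im t) in I1 by (unfold Im; simpl; ring).
  split.
  - pose proof (Rabs_triang (Re t) (Re s - Re t)) as Q.
    replace (Re t + (Re s - Re t)) with (Re s) in Q by ring. lra.
  - assert (Q : Rabs (Im s - Im t) < eps * Im t - T) by lra. apply Rabs_def2 in Q.
    destruct Heps as [-> | ->]; lra.
Qed.

(** Here g and om stand for the real numbers Theta_01 and omega_2. Since a^2 = 2 ah may have either
    sign, a stays complex, real or imaginary; the reality of beta-hat is recorded as that of B. *)
Record params (th : theta) (phi : C) (g om ah : R) (a B p q : C) : Prop := {
  par_a : a = ((Th0 th - Th1 th + Thinf th) / 2)%C;
  par_B : B = (((Th0 th - Th1 th - Thinf th) / 2) * ((Th0 th - Th1 th - Thinf th) / 2))%C;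
  par_p : p = (phi + Th0 th / 2)%C;
  par_q : q = (phi + (Th1 th - Thinf th) / 2)%C;
  par_g : (Ci * g)%C = gamma5 th;
  par_om : (Ci * om)%C = nu2 th phi;
  par_ah : RtoC ah = alpha5 th;
  par_conj : Cconj B = B }.
Arguments par_a {th phi g om ah a B p q} _.
Arguments par_B {th phi g om ah a B p q} _.
Arguments par_p {th phi g om ah a B p q} _.
Arguments par_q {th phi g om ah a B p q} _.
Arguments par_g {th phi g om ah a B p q} _.
Arguments par_om {th phi g om ah a B p q} _.
Arguments par_ah {th phi g om ah a B p q} _.
Arguments par_conj {th phi g om ah a B p q} _.

Lemma par_sum {th phi g om ah a B p q} : params th phi g om ah a B p q ->
  Th1 th = (1 - Ci * g - Th0 th)%C.
Proof. intros H. rewrite (par_g H). unfold gamma5. ring. Qed.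

Lemma par_phi {th phi g om ah a B p q} : params th phi g om ah a B p q ->
  phi = ((Ci * om - 1 + Thinf th) / 4)%C.
Proof. intros H. rewrite (par_om H). unfold nu2. field. Qed.

Lemma par_diff {th phi g om ah a B p q} : params th phi g om ah a B p q -> (p - q)%C = a.
Proof. intros [-> _ -> -> _ _ _ _]. field. Qed.

Lemma Ci_sq : (Ci * Ci)%C = (- (1))%C.
Proof. unfold Ci, Cmult, Copp, RtoC; simpl. f_equal; ring. Qed.

Lemma par_plus {th phi g om ah a B p q} : params th phi g om ah a B p q ->
  (p + q)%C = (Ci * RtoC ((om - g) / 2))%C.
Proof.
  intros H. rewrite (par_p H), (par_q H), (par_sum H),
    (par_phi H).
  rewrite RtoC_div, RtoC_minus by lra. field.
Qed.

Lemma par_a_sq {th phi g om ah a B p q} : params th phi g om ah a B p q -> (a * a)%C = RtoC (2 * ah).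
Proof.
  intros H. rewrite RtoC_mult, (par_ah H), (par_a H).
  unfold alpha5. field.
Qed.

(** From p + q = i r and p - q = a. The inequality assumed in the theorem thus says that p q is a
    negative real number, and the amplitude of the sine is 2 sqrt (- p q). *)
Lemma par_mult {th phi g om ah a B p q} : params th phi g om ah a B p q ->
  (p * q)%C = RtoC (- ((((om - g) / 2) ^ 2 + 2 * ah) / 4)).
Proof.
  intros H. replace (p * q)%C with (((p + q) * (p + q) - (p - q) * (p - q)) / 4)%C by field.
  rewrite (par_plus H), (par_diff H), (par_a_sq H).
  set (r := (om - g) / 2).
  replace (Ci * r * (Ci * r))%C with ((Ci * Ci) * RtoC (r * r))%C by (rewrite RtoC_mult; ring).
  rewrite Ci_sq. unfold Cdiv. unfold RtoC, Copp, Cminus, Cmult, Cinv; unfold Cplus, Copp; simpl.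
  f_equal; field.
Qed.

Lemma par_conj_a {th phi g om ah a B p q} : params th phi g om ah a B p q ->
  Cconj a = a \/ Cconj a = (- a)%C.
Proof.
  intros H. pose proof (par_a_sq H) as E.
  assert (E2 : ((Cconj a - a) * (Cconj a + a))%C = RtoC 0).
  { replace ((Cconj a - a) * (Cconj a + a))%C with (Cconj a * Cconj a - a * a)%C by ring.
    rewrite <- Cmult_conj, E, Cconj_RtoC. ring. }
  destruct (classic ((Cconj a - a)%C = RtoC 0)) as [N|N].
  - left. replace (Cconj a) with ((Cconj a - a) + a)%C by ring. rewrite N. ring.
  - right. destruct (classic ((Cconj a + a)%C = RtoC 0)) as [N'|N'].
    + replace (Cconj a) with ((Cconj a + a) - a)%C by ring. rewrite N'. ring.
    + exfalso. now apply (Cmult_neq_0 _ _ N N').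
Qed.

(** The constant (conj a - a) / 2 is the one occurring in [zhat]; it accounts for reflection
    exchanging p with - q when a is real and fixing the imaginary p when a is imaginary. *)
Lemma par_conj_p {th phi g om ah a B p q} : params th phi g om ah a B p q ->
  (Cconj p + q)%C = ((Cconj a - a) / 2)%C.
Proof.
  intros H. pose proof (par_plus H) as E1. pose proof (par_diff H) as E2.
  set (w := (Ci * RtoC ((om - g) / 2))%C) in *.
  assert (Ew : Cconj w = (- w)%C) by (unfold w; rewrite Cmult_conj, Cconj_RtoC, Cconj_Ci; ring).
  assert (Ep : p = ((w + a) / 2)%C) by (rewrite <- E1, <- E2; field).
  assert (Eq : q = ((w - a) / 2)%C) by (rewrite <- E1, <- E2; field).
  rewrite Ep, Eq, Cdiv_conj by (intros E; apply RtoC_eq_0 in E; lra).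
  rewrite Cplus_conj, Ew, Cconj_RtoC. field.
Qed.

Definition good_at (y z : C -> C) (t : C) : Prop := holomorphic_at y t /\ holomorphic_at z t.

Lemma solution_solves eps th phi g om ah a B p q y z u : params th phi g om ah a B p q ->
  is_solution eps th y z u -> solves a B g (fun t => half_plane eps t /\ good_at y z t) y z.
Proof.
  intros H Hs t [Ht [Hy Hz]]. destruct (Hs t Ht) as [_ [Ey [Ez _]]].
  exists (C_derive y t), (C_derive z t). split; [now apply holomorphic_at_lder|].
  split; [now apply holomorphic_at_lder|]. split.
  - unfold ode_y. rewrite (Ey Hy Hz).
    rewrite (par_a H), (par_sum H). field.
  - intros Ny. unfold ode_z, Qz. rewrite (Ez Hy Hz Ny).
    rewrite (par_a H), (par_B H), (par_sum H). field. auto.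
Qed.

Lemma good_at_punctured eps th y z u t : is_solution eps th y z u -> half_plane eps t ->
  punctured (good_at y z) t.
Proof.
  intros Hs Ht. destruct (Hs t Ht) as [[My [Mz _]] _].
  apply punctured_and; now apply meromorphic_at_punctured.
Qed.

Lemma X2_strip_bounds eps th phi delta (om x0 : R) : eps = 1 \/ eps = -1 ->
  (Ci * om)%C = nu2 th phi -> delta <> RtoC 0 ->
  exists m M, 0 < m /\ forall t, Rabs (Re t) <= x0 -> m <= Cmod (X2 th phi delta t) <= M.
Proof.
  intros Heps E Hd. assert (Hm : 0 < Cmod delta) by now apply Cmod_pos.
  set (r := x0 + Rabs om * PI).
  exists (Cmod delta * exp (- r)), (Cmod delta * exp r).
  split; [apply Rmult_lt_0_compat; [easy | apply exp_pos]|]. intros t Ht.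
  rewrite (Cmod_X2 th phi delta om) by easy.
  assert (Q : Rabs (Re t + om * Carg t) <= r).
  { eapply Rle_trans; [apply Rabs_triang|]. unfold r. apply Rplus_le_compat; [easy|].
    rewrite Rabs_mult. apply Rmult_le_compat_l; [apply Rabs_pos | apply Rabs_le, Carg_bound]. }
  apply Rabs_le_between in Q.
  assert (Me : forall u v, u <= v -> exp u <= exp v).
  { intros u v Huv. destruct (Rle_lt_or_eq_dec _ _ Huv) as [L| ->]; [left; now apply exp_increasing | lra]. }
  split; apply Rmult_le_compat_l; try lra; apply Me; lra.
Qed.

Section Type2.
Context (eps : R) (th : theta) (phi delta uh : C) (y z u : C -> C) (g om ah : R) (a B p q : C).
Context (Heps : eps = 1 \/ eps = -1) (Hpar : params th phi g om ah a B p q) (Hdelta : delta <> RtoC 0)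
  (Hamp : 0 < ((om - g) / 2) ^ 2 + 2 * ah) (Hsol : is_solution eps th y z u)
  (Has : type2_asymptotics eps th phi delta uh y z u).

Notation X := (X2 th phi delta).

Lemma pq_neq_0 : (p * q)%C <> RtoC 0.
Proof.
  rewrite (par_mult Hpar). intros E. apply RtoC_eq_0 in E. lra.
Qed.

Lemma p_neq_0 : p <> RtoC 0.
Proof. intros E. apply pq_neq_0. rewrite E. ring. Qed.
Lemma q_neq_0 : q <> RtoC 0.
Proof. intros E. apply pq_neq_0. rewrite E. ring. Qed.

Lemma start_line : exists X0, 0 < X0 /\ forall x1, X0 <= x1 -> exists K T, 0 <= K /\
   forall t, T < eps * Im t -> Re t = x1 ->
    Cmod (t / y t - Wf p q X t) <= K * lnq (eps * Im t) /\
    Cmod (z t - Zf p q X t) <= K * lnq (eps * Im t) /\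
    2 <= Cmod (p * X t) /\ 2 <= Cmod (q * X t).
Proof.
  apply (type2_start eps th phi delta uh y z u om p q); auto.
  - apply Hpar.
  - apply Hpar.
  - apply Hpar.
  - apply p_neq_0.
  - apply q_neq_0.
Qed.

(* Both (y, z) and its reflection fall under this lemma. *)
Lemma start_to_strip (good : C -> Prop) (y1 z1 : C -> C) x1 T0 K : 0 < x1 -> 0 <= T0 ->
  (forall t, strip eps (x1 + 1) T0 t -> punctured good t) ->
  solves a B g (fun t => strip eps (x1 + 1) T0 t /\ good t) y1 z1 ->
  (forall t, strip eps (x1 + 1) T0 t -> good t -> Re t = x1 ->
    Cmod (t / y1 t - Wf p q X t) <= K * lnq (eps * Im t) /\
    Cmod (z1 t - Zf p q X t) <= K * lnq (eps * Im t) /\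
    2 <= Cmod (p * X t) /\ 2 <= Cmod (q * X t)) ->
  exists K' T, 0 <= K' /\ T0 <= T /\ 3 <= T /\ strip_conclusion a p (p * q) X eps x1 good y1 z1 K' T.
Proof.
  intros Hx1 HT0 Hgood Hs Hst.
  destruct (X2_strip_bounds eps th phi delta om (x1 + 1) Heps (par_om Hpar) Hdelta)
    as [m [M [Hm HX]]].
  destruct (start_vv_pp a p q X eps x1 T0 good y1 z1 M K) as [K0 [T1 [HT1 Hst']]]; auto.
  { apply (par_diff Hpar). }
  { apply p_neq_0. }
  { apply q_neq_0. }
  { intros t [Ht _]. apply HX. lra. }
  assert (Sub : forall t, strip eps (x1 + 1) T1 t -> strip eps (x1 + 1) T0 t).
  { intros t [A A']. split; lra. }
  destruct (strip_estimate a B g p (p * q) (nu2 th phi) X eps x1 T1 good y1 z1 m M K0)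
    as [K' [T [HK' [HT [HT3 Hcon]]]]]; auto.
  { apply pq_neq_0. }
  { intros t Ht. split; [|apply HX; destruct Ht; lra].
    apply lder_X2 with eps; auto. apply (strip_half_plane eps (x1 + 1) T1); auto. lra. }
  { intros t [Ht Gt]. apply Hs. auto. }
  exists K', T. split; [easy|]. split; [lra|]. split; [lra | easy].
Qed.

Lemma type2_strip x1 : exists K T, 0 <= K /\ 3 <= T /\
  strip_conclusion a p (p * q) X eps x1 (good_at y z) y z K T.
Proof.
  destruct start_line as [X0 [HX0 Hl]].
  set (x2 := Rmax x1 X0). assert (H1 : x1 <= x2) by apply Rmax_l. assert (H2 : X0 <= x2) by apply Rmax_r.
  destruct (Hl x2 H2) as [K [T [HK Hst]]].
  assert (HT : 0 <= Rmax 0 T) by apply Rmax_l. assert (HT' : T <= Rmax 0 T) by apply Rmax_r.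
  destruct (start_to_strip (good_at y z) y z x2 (Rmax 0 T) K) as [K' [T' [HK' [_ [HT3 Hc]]]]];
    [lra | easy | | | |].
  - intros t Ht. apply good_at_punctured with eps th u; [easy|].
    now apply (strip_half_plane eps (x2 + 1) (Rmax 0 T)).
  - intros t [Ht Gt]. apply (solution_solves eps th phi g om ah a B p q y z u Hpar Hsol).
    split; [now apply (strip_half_plane eps (x2 + 1) (Rmax 0 T)) | easy].
  - intros t [_ Ht] _ Hre. apply Hst; [lra | easy].
  - exists K', T'. split; [easy|]. split; [easy|]. intros t Hx. apply Hc. lra.
Qed.

Lemma strip_w x1 : exists K M T, 0 <= K /\ 3 <= T /\ forall t, Rabs (Re t) <= x1 -> T < eps * Im t ->
  good_at y z t -> y t <> RtoC 0 /\ Cmod (t / y t) <= M /\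
    Cmod (t / y t - Wf p q X t) <= K * lnq (eps * Im t) /\
    Cmod (z t - Zf p q X t) <= K * lnq (eps * Im t).
Proof.
  destruct (type2_strip x1) as [K [T [HK [HT Hc]]]].
  destruct (X2_strip_bounds eps th phi delta om x1 Heps (par_om Hpar) Hdelta) as [m [M [Hm HX]]].
  destruct (strip_conclusion_w a p q X eps x1 (good_at y z) y z m M K T) as [K' [M' [T' [HK' [HT' H]]]]]; auto.
  - apply (par_diff Hpar).
  - apply p_neq_0.
  - apply q_neq_0.
  - exists K', M', T'. split; [easy|]. split; [lra | easy].
Qed.

Lemma X2_neq_0 t : X t <> RtoC 0.
Proof.
  apply Cmod_pos_neq_0. rewrite (Cmod_X2 th phi delta om) by apply Hpar.
  apply Rmult_lt_0_compat; [now apply Cmod_pos | apply exp_pos].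
Qed.

Lemma lder_Wf t : half_plane eps t -> exists l, lder (Wf p q X) t l.
Proof.
  intros Ht. pose proof (lder_X2 eps th phi delta t Heps Ht) as L.
  eexists. unfold Wf. apply lder_div; [apply X2_neq_0 | | exact L].
  apply lder_mult; (apply lder_minus; [apply lder_const | apply lder_mult; [apply lder_const | exact L]]).
Qed.

(* z need not be holomorphic here: the estimate passes to the limit from nearby points. *)
Lemma ray_asymptotics : exists K T, 0 <= K /\ 3 <= T /\ forall tau : R, T < eps * tau ->
  holomorphic_at y (Ci * tau)%C -> y (Ci * tau)%C <> RtoC 0 /\
  Cmod (Ci * tau / y (Ci * tau) - Wf p q X (Ci * tau))%C <= K * lnq (eps * tau).
Proof.
  destruct (strip_w 1) as [K [M [T [HK [HT H]]]]].
  exists K, T. split; [easy|]. split; [easy|]. intros tau Htau Hy. set (t0 := (Ci * tau)%C) in *.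
  assert (Hh : half_plane eps t0) by (apply half_plane_ray; lra).
  assert (Hm0 : 0 <= Rabs M) by apply Rabs_pos.
  pose proof (holomorphic_at_lder _ _ Hy) as Ly. destruct (lder_Wf t0 Hh) as [lW LW].
  assert (E0 : (t0 + RtoC 0 * RtoC 1)%C = t0) by ring.
  assert (It : forall x : R, Im (t0 + x * RtoC 1)%C = tau /\ Re (t0 + x * RtoC 1)%C = x).
  { intros x. unfold t0, Re, Im; simpl. split; ring. }
  (* The estimates are multiplied by y before taking the limit, since y t0 = 0 is not yet excluded;
     the limit of the first one, |t| <= |M| |y|, then excludes it. The approach is horizontal so
     that Im t, and with it [lnq], stays fixed. *)
  assert (Hex : forall eta, 0 < eta -> exists h, Rabs (h - 0) < eta /\
     Cmod (t0 + h * RtoC 1)%C <= Rabs M * Cmod (y (t0 + h * RtoC 1)%C) /\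
     Cmod (t0 + h * RtoC 1 - Wf p q X (t0 + h * RtoC 1) * y (t0 + h * RtoC 1))%C
       <= K * lnq (eps * tau) * Cmod (y (t0 + h * RtoC 1)%C)).
  { intros eta Heta.
    destruct (good_at_punctured eps th y z u t0 Hsol Hh) as [d [Hd G]].
    set (h := Rmin (Rmin d eta) 1 / 2).
    assert (Hh0 : 0 < h /\ h < d /\ h < eta /\ h < 1).
    { unfold h. pose proof (Rmin_l (Rmin d eta) 1). pose proof (Rmin_r (Rmin d eta) 1).
      pose proof (Rmin_l d eta). pose proof (Rmin_r d eta).
      assert (0 < Rmin (Rmin d eta) 1) by (repeat apply Rmin_glb_lt; lra). lra. }
    set (t := (t0 + h * RtoC 1)%C). exists h. fold t.
    split; [rewrite Rminus_0_r, Rabs_right; lra|].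
    assert (Et : (t - t0)%C = RtoC h) by (unfold t; ring).
    destruct (It h) as [I1 I2]. fold t in I1, I2.
    destruct (H t) as [Ny [H1 [H2 _]]].
    - rewrite I2, Rabs_right; lra.
    - rewrite I1. lra.
    - apply G; [rewrite Et, Cmod_R, Rabs_right; lra|]. intros E. rewrite E in Et.
      replace (t0 - t0)%C with (RtoC 0) in Et by ring. symmetry in Et. apply RtoC_eq_0 in Et. lra.
    - rewrite I1 in H2. assert (Py : 0 < Cmod (y t)) by now apply Cmod_pos. split.
      + replace t with (t / y t * y t)%C at 1 by (field; easy). rewrite Cmod_mult.
        apply Rmult_le_compat_r; [lra|]. pose proof (Rle_abs M). lra.
      + replace (t - Wf p q X t * y t)%C with ((t / y t - Wf p q X t) * y t)%C by (field; easy).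
        rewrite Cmod_mult. apply Rmult_le_compat_r; lra. }
  assert (Cc : forall f l, lder f t0 l -> continuous (fun x : R => Cmod (f (t0 + x * RtoC 1)%C)) 0).
  { intros f l Lf. apply continuous_ext with (fun x : R => Cmod (f (t0 + x * RtoC 1)%C - RtoC 0)).
    - intros x. f_equal. ring.
    - apply (continuous_Cmod_minus (fun x : R => f (t0 + x * RtoC 1)%C)). apply lder_Rcont with l. now rewrite E0. }
  assert (F : forall c (f : C -> C) l, lder f t0 l ->
     (forall eta, 0 < eta -> exists h, Rabs (h - 0) < eta /\
        Cmod (f (t0 + h * RtoC 1)%C) <= c * Cmod (y (t0 + h * RtoC 1)%C)) ->
     Cmod (f t0) <= c * Cmod (y t0)).
  { intros c f l Lf Hl.
    assert (Q : Cmod (f (t0 + RtoC 0 * RtoC 1)%C) - c * Cmod (y (t0 + RtoC 0 * RtoC 1)%C) <= 0).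
    { apply (continuous_le_limit (fun x : R => Cmod (f (t0 + x * RtoC 1)%C) - c * Cmod (y (t0 + x * RtoC 1)%C))).
      - apply @continuous_minus; [now apply Cc with l|].
        apply (continuous_scal (fun _ => c) (fun x : R => Cmod (y (t0 + x * RtoC 1)%C)));
          [apply continuous_const | eapply Cc; eauto].
      - intros eta Heta. destruct (Hl eta Heta) as [h [H1 H2]]. exists h. split; [easy | lra]. }
    rewrite E0 in Q. lra. }
  assert (Q1 : Cmod t0 <= Rabs M * Cmod (y t0)).
  { apply (F _ (fun t => t) _ (lder_id t0)). intros eta Heta.
    destruct (Hex eta Heta) as [h [A1 [A2 A3]]]. now exists h. }
  assert (Q2 : Cmod (t0 - Wf p q X t0 * y t0) <= K * lnq (eps * tau) * Cmod (y t0)).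
  { apply (F _ (fun t => t - Wf p q X t * y t)%C _ (lder_minus _ _ _ _ _ (lder_id t0) (lder_mult _ _ _ _ _ LW Ly))).
    intros eta Heta. destruct (Hex eta Heta) as [h [A1 [A2 A3]]]. now exists h. }
  assert (Ny : y t0 <> RtoC 0).
  { intros E. rewrite E, Cmod_0, Rmult_0_r in Q1. destruct (half_plane_Cmod _ _ Heps Hh). lra. }
  split; [easy|].
  assert (Py : 0 < Cmod (y t0)) by now apply Cmod_pos.
  replace (t0 / y t0 - Wf p q X t0)%C with ((t0 - Wf p q X t0 * y t0) / y t0)%C by (field; easy).
  rewrite Cmod_div by easy. apply Rmult_le_reg_r with (Cmod (y t0)); [easy|].
  unfold Rdiv. rewrite Rmult_assoc, Rinv_l, Rmult_1_r by lra. exact Q2.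
Qed.

(** * Reflection symmetry under the condition |X|^2 = - 1 / (p q) on the ray *)

Context (Hrefl : (p * q * RtoC (Cmod delta ^ 2 * exp (eps * PI * om)))%C = (- (1))%C).

Lemma conj_X2_refl t : half_plane eps t -> Cconj (X (refl t)) = (- (1) / (p * q * X t))%C.
Proof.
  intros Ht. pose proof (X2_refl eps th phi delta om t Heps Ht (par_om Hpar)) as E.
  pose proof (X2_neq_0 t) as N. pose proof pq_neq_0 as Npq.
  rewrite <- Hrefl, <- E. field. split; [exact N|]. split; [apply q_neq_0 | apply p_neq_0].
Qed.

Lemma conj_pq : Cconj (p * q) = (p * q)%C.
Proof. rewrite (par_mult Hpar). apply Cconj_RtoC. Qed.

(** In 1 / X - (p + q) + p q X, reflection exchanges the two outer terms, and p + q is imaginary. *)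
Lemma Wf_refl t : half_plane eps t -> (- Cconj (Wf p q X (refl t)))%C = Wf p q X t.
Proof.
  intros Ht. rewrite !Wf_expand by apply X2_neq_0.
  rewrite Cplus_conj, Cminus_conj, (Cmult_conj (p * q)), conj_pq, Cinv_conj by apply X2_neq_0.
  rewrite (conj_X2_refl t Ht), (par_plus Hpar), Cmult_conj, Cconj_RtoC, Cconj_Ci.
  pose proof (X2_neq_0 t). pose proof p_neq_0. pose proof q_neq_0.
  field. repeat split; auto.
Qed.

(** Leading-order form of [zhat]: as t / y is bounded, y is large, so t y / (y - 1)^2 reduces to t /
    y, that is, to Wf, and the term with g disappears. *)
Lemma Zf_refl t : half_plane eps t ->
  (Cconj (Zf p q X (refl t)) + Wf p q X t + (Cconj a - a) / 2)%C = Zf p q X t.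
Proof.
  intros Ht. rewrite Wf_expand by apply X2_neq_0. rewrite <- (par_conj_p Hpar). unfold Zf.
  replace (- (p * (1 - q * X (refl t))))%C with (p * q * X (refl t) - p)%C by ring.
  rewrite Cminus_conj, (Cmult_conj (p * q)), conj_pq, (conj_X2_refl t Ht).
  pose proof (X2_neq_0 t). pose proof p_neq_0. pose proof q_neq_0.
  field. repeat split; auto.
Qed.

Definition good2 (t : C) : Prop := good_at y z t /\ good_at y z (refl t).

Lemma good2_punctured t : half_plane eps t -> punctured good2 t.
Proof.
  intros Ht. apply punctured_and.
  - now apply good_at_punctured with eps th u.
  - apply punctured_refl. apply good_at_punctured with eps th u; [easy|].
    unfold half_plane. now rewrite Im_refl.
Qed.

(** The formula for [zhat] is singular where yhat y = 1. There the bound |t / y| <= M would give |t|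
    <= M, which is impossible once eps Im t exceeds M. *)
Lemma hat_solves x1 : exists T, 3 <= T /\
  solves a B g (fun t => strip eps x1 T t /\ good2 t) (yhat y) (zhat a g y z).
Proof.
  destruct (strip_w x1) as [K [M [T [HK [HT H]]]]].
  exists (Rmax T M). pose proof (Rmax_l T M). pose proof (Rmax_r T M). split; [lra|].
  intros t [Ht [_ Gt]]. assert (Hr : strip eps x1 (Rmax T M) (refl t)).
  { destruct Ht. split; [now rewrite Re_refl, Rabs_Ropp | now rewrite Im_refl]. }
  destruct (H (refl t)) as [Ny [Hw _]]; [destruct Hr; lra | destruct Hr; lra | easy|].
  assert (Hh : half_plane eps t) by (apply (strip_half_plane eps x1 (Rmax T M)); [lra | easy]).
  assert (Hh' : half_plane eps (refl t)) by (unfold half_plane; now rewrite Im_refl).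
  destruct (solution_solves eps th phi g om ah a B p q y z u Hpar Hsol (refl t) (conj Hh' Gt))
    as [yd [zd [Ly [Lz [Ey Ez]]]]].
  assert (N1 : yhat y t <> RtoC 1).
  { intros E. apply (f_equal Cmod) in E. unfold yhat in E. rewrite Cmod_conj, Cmod_1 in E.
    rewrite Cmod_div, E, Cmod_refl in Hw by easy.
    pose proof (strip_Cmod _ _ _ _ Heps Ht). destruct Ht. lra. }
  destruct (reflected_ode a B g y z t yd zd) as [yd' [zd' [L1 [L2 [E1 E2]]]]]; auto.
  - apply (par_conj_a Hpar).
  - apply (par_conj Hpar).
  - apply Cmod_pos_neq_0, (half_plane_Cmod _ _ Heps Hh).
  - exists yd', zd'. auto.
Qed.

(** Written with w = t / yhat y, the correction in [zhat] is w / (1 - w / t)^2 + (conj a - a) / 2 -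
    i g (w / t) / (1 - w / t). It depends regularly on w and 1 / t, and 1 / t is O(lnq), so it may
    be replaced by 0. *)
Lemma hat_start x1 : exists K T, 3 <= T /\ forall t, T < eps * Im t -> Rabs (Re t) <= x1 -> good2 t ->
    Cmod (t / yhat y t - Wf p q X t) <= K * lnq (eps * Im t) /\
    Cmod (zhat a g y z t - Zf p q X t) <= K * lnq (eps * Im t).
Proof.
  destruct (strip_w x1) as [K [M [T [HK [HT H]]]]].
  set (T' := Rmax T (2 * M)). assert (HT1 : T <= T') by apply Rmax_l. assert (HT2 : 2 * M <= T') by apply Rmax_r.
  set (S := fun t => T' < eps * Im t /\ Rabs (Re t) <= x1 /\ good2 t).
  set (N := fun t => lnq (eps * Im t)).
  assert (N0 : forall t, S t -> 0 <= N t) by (intros t [Ht _]; left; apply lnq_pos; lra).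
  assert (HS : forall t, S t -> half_plane eps t /\ eps * Im t <= Cmod t /\ t <> RtoC 0 /\
     y (refl t) <> RtoC 0 /\ Cmod (refl t / y (refl t)) <= M /\
     Cmod (refl t / y (refl t) - Wf p q X (refl t)) <= K * N t /\
     Cmod (z (refl t) - Zf p q X (refl t)) <= K * N t).
  { intros t [Ht [Hx [_ Gt]]].
    assert (Hh : half_plane eps t) by (unfold half_plane; lra). split; [easy|].
    split. { apply (strip_Cmod eps (Rabs (Re t) + 1) 0); auto. split; lra. }
    split. { apply Cmod_pos_neq_0, (half_plane_Cmod _ _ Heps Hh). }
    unfold N. rewrite <- (Im_refl t). apply H; auto.
    - now rewrite Re_refl, Rabs_Ropp.
    - rewrite Im_refl. lra. }
  assert (Ew : forall t, S t -> (t / yhat y t)%C = (- Cconj (refl t / y (refl t)))%C).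
  { intros t Ht. destruct (HS t Ht) as [_ [_ [_ [Ny _]]]]. unfold yhat.
    rewrite Cdiv_conj by easy. unfold refl at 2. rewrite Copp_conj, Cconj_conj. field.
    intros E. apply Ny. rewrite <- (Cconj_conj (y (refl t))), E. apply Cconj_RtoC. }
  assert (BX : bounded_on S X).
  { destruct (X2_strip_bounds eps th phi delta om x1 Heps (par_om Hpar) Hdelta) as [m [MX [Hm HX]]].
    exists MX. intros t [_ [Hx _]]. now apply HX. }
  assert (LX : exists m, 0 < m /\ forall t, S t -> m <= Cmod (X t)).
  { destruct (X2_strip_bounds eps th phi delta om x1 Heps (par_om Hpar) Hdelta) as [m [MX [Hm HX]]].
    exists m. split; [easy|]. intros t [_ [Hx _]]. now apply HX. }
  destruct LX as [m [Hm LX]].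
  assert (Cc : forall c, close_on S N (fun _ => c) (fun _ => c)) by (intros; now apply close_const).
  set (w := fun t => (t / yhat y t)%C).
  assert (Cw : close_on S N w (Wf p q X)).
  { split; [|split].
    - exists M. intros t Ht. unfold w. rewrite Ew, Cmod_opp, Cmod_conj by easy. apply HS, Ht.
    - unfold Wf, Cdiv. apply bounded_mult; [|now apply bounded_inv with m].
      repeat first [exact BX | apply bounded_const | apply bounded_minus | apply bounded_mult].
    - exists K. split; [easy|]. intros t Ht. unfold w.
      rewrite Ew, <- Wf_refl by (try apply HS; easy).
      replace (- Cconj (refl t / y (refl t)) - - Cconj (Wf p q X (refl t)))%C
        with (- Cconj (refl t / y (refl t) - Wf p q X (refl t)))%C by (rewrite Cminus_conj; ring).
      rewrite Cmod_opp, Cmod_conj. apply HS, Ht. }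
  assert (BN : forall t, S t -> N t <= 1).
  { intros t [Ht _]. unfold N, lnq. apply Rmult_le_reg_r with (eps * Im t); [lra|].
    unfold Rdiv. rewrite Rmult_assoc, Rinv_l by lra.
    pose proof (exp_ge_1_plus (ln (eps * Im t))) as Q. rewrite exp_ln in Q by lra. lra. }
  assert (BZ : bounded_on S (fun t => Cconj (Zf p q X (refl t)))).
  { destruct (X2_strip_bounds eps th phi delta om x1 Heps (par_om Hpar) Hdelta) as [m' [MX [Hm' HX]]].
    exists (Cmod p * (1 + Cmod q * MX)). intros t [_ [Hx _]]. rewrite Cmod_conj. unfold Zf.
    rewrite Cmod_opp, Cmod_mult. apply Rmult_le_compat_l; [apply Cmod_ge_0|].
    eapply Rle_trans; [apply Cmod_minus_triangle|]. rewrite Cmod_1, Cmod_mult.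
    apply Rplus_le_compat_l, Rmult_le_compat_l; [apply Cmod_ge_0|]. apply HX.
    now rewrite Re_refl, Rabs_Ropp. }
  assert (Cz : close_on S N (fun t => Cconj (z (refl t))) (fun t => Cconj (Zf p q X (refl t)))).
  { assert (D : forall t, S t -> Cmod (Cconj (z (refl t)) - Cconj (Zf p q X (refl t))) <= K * N t).
    { intros t Ht. rewrite <- Cminus_conj, Cmod_conj. apply HS, Ht. }
    split; [|split; [easy|]].
    - destruct BZ as [MZ HZ]. exists (MZ + K). intros t Ht. specialize (HZ t Ht). specialize (D t Ht).
      pose proof (Rmult_le_compat_l _ _ _ HK (BN t Ht)).
      pose proof (Cmod_triangle (Cconj (Zf p q X (refl t))) (Cconj (z (refl t)) - Cconj (Zf p q X (refl t)))) as Q.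
      replace (Cconj (Zf p q X (refl t)) + (Cconj (z (refl t)) - Cconj (Zf p q X (refl t))))%C
        with (Cconj (z (refl t))) in Q by ring. lra.
    - now exists K. }
  assert (Cu : close_on S N (fun t => / t)%C (fun _ => RtoC 0)).
  { assert (D : forall t, S t -> Cmod (/ t) <= N t).
    { intros t Ht. destruct (HS t Ht) as [_ [Q [Nt _]]]. rewrite Cmod_inv by easy.
      destruct Ht as [Ht _]. unfold N. pose proof (inv_le_lnq (eps * Im t) ltac:(lra)).
      assert (/ Cmod t <= / (eps * Im t)) by (apply Rinv_le_contravar; lra). lra. }
    split; [|split; [apply bounded_const|]].
    - exists 1. intros t Ht. specialize (D t Ht). specialize (BN t Ht). lra.
    - exists 1. split; [lra|]. intros t Ht. replace (/ t - 0)%C with (/ t)%C by ring.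
      specialize (D t Ht). lra. }
  (* The threshold 2 M in T' makes |w / t| at most 1/2. *)
  assert (Lq : forall t, S t -> 1 / 2 <= Cmod (1 - w t * / t)).
  { intros t Ht. destruct (HS t Ht) as [_ [Q [Nt [_ [Q2 _]]]]].
    assert (D : Cmod (w t * / t) <= 1 / 2).
    { rewrite Cmod_mult, Cmod_inv by easy. unfold w. rewrite Ew, Cmod_opp, Cmod_conj by easy.
      destruct Ht as [Ht _]. apply Rmult_le_reg_r with (Cmod t); [lra|].
      rewrite Rmult_assoc, Rinv_l by lra. lra. }
    pose proof (Cmod_minus_triangle (1 - w t * / t) (- (w t * / t))) as Q3.
    replace (1 - w t * / t - - (w t * / t))%C with (RtoC 1) in Q3 by ring.
    rewrite Cmod_opp, Cmod_1 in Q3. lra. }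
  assert (L1 : forall t : C, S t -> 1 / 2 <= Cmod (1 - Wf p q X t * 0)).
  { intros t _. replace (1 - Wf p q X t * 0)%C with (RtoC 1) by ring. rewrite Cmod_1. lra. }
  assert (Cd : close_on S N (fun t => 1 - w t * / t)%C (fun t => 1 - Wf p q X t * 0)%C).
  { apply close_minus; [apply Cc|]. now apply close_mult. }
  assert (Cr : close_on S N
    (fun t => Cconj (z (refl t)) + w t / (1 - w t * / t) / (1 - w t * / t) + (Cconj a - a) / 2
              - Ci * g * (w t * / t / (1 - w t * / t)))%C
    (fun t => Cconj (Zf p q X (refl t)) + Wf p q X t / (1 - Wf p q X t * 0) / (1 - Wf p q X t * 0)
              + (Cconj a - a) / 2 - Ci * g * (Wf p q X t * 0 / (1 - Wf p q X t * 0)))%C).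
  { apply close_minus; [apply close_plus; [apply close_plus; [exact Cz|]|apply Cc]|].
    - apply close_div with (1 / 2); auto; [lra|]. apply close_div with (1 / 2); auto. lra.
    - apply close_mult; [apply Cc|]. apply close_div with (1 / 2); auto; [lra|]. now apply close_mult. }
  assert (Czh : close_on S N (zhat a g y z) (Zf p q X)).
  { eapply close_ext; [| |exact Cr].
    - intros t Ht. cbv beta. destruct (HS t Ht) as [_ [_ [Nt [Ny _]]]]. specialize (Lq t Ht).
      assert (Nyh : yhat y t <> RtoC 0).
      { intros E. apply Ny. rewrite <- (Cconj_conj (y (refl t))). unfold yhat in E. rewrite E.
        apply Cconj_RtoC. }
      assert (E1 : (1 - w t * / t)%C = ((yhat y t - 1) / yhat y t)%C) by (unfold w; field; auto).
      assert (N1 : (yhat y t - 1)%C <> RtoC 0).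
      { intros E. rewrite E1, E in Lq. unfold Cdiv in Lq. rewrite Cmult_0_l, Cmod_0 in Lq. lra. }
      rewrite E1. unfold zhat, w. field. auto.
    - intros t Ht. cbv beta. destruct (HS t Ht) as [Hh _].
      rewrite <- (Zf_refl t Hh). field. }
  destruct Cw as [_ [_ [K1 [HK1 E1]]]]. destruct Czh as [_ [_ [K2 [HK2 E2]]]].
  exists (K1 + K2), T'. split; [lra|]. intros t Ht Hx Gt.
  assert (St : S t) by (split; auto). specialize (E1 t St). specialize (E2 t St). specialize (N0 t St).
  fold (w t). unfold N in *. split; nra.
Qed.

Lemma solves_mono (S S' : C -> Prop) (y1 z1 : C -> C) : (forall t, S' t -> S t) ->
  solves a B g S y1 z1 -> solves a B g S' y1 z1.
Proof. intros H K t Ht. apply K, H, Ht. Qed.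

Lemma strip_conclusion_mono x1 (G G' : C -> Prop) (y1 z1 : C -> C) K K' T T' : 3 <= T' ->
  (forall t, G' t -> G t) -> K <= K' -> T <= T' ->
  strip_conclusion a p (p * q) X eps x1 G y1 z1 K T ->
  strip_conclusion a p (p * q) X eps x1 G' y1 z1 K' T'.
Proof.
  intros H3 HG HK HT H t Hx Hy Gt. destruct (H t Hx ltac:(lra) (HG t Gt)) as [H1 H2].
  pose proof (lnq_pos (eps * Im t) ltac:(lra)).
  assert (K * lnq (eps * Im t) <= K' * lnq (eps * Im t)) by (apply Rmult_le_compat_r; lra). lra.
Qed.

Lemma symmetric_near_infinity : exists T, forall tau, T < tau -> 0 < tau ->
  punctured (fun s => y s = yhat y s) (ray eps tau).
Proof.
  destruct start_line as [X0 [HX0 Hl]].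
  destruct (Hl X0 (Rle_refl _)) as [K2 [T3 [HK2 Hst]]].
  destruct (hat_solves (X0 + 1)) as [T1 [HT1 Hsv]].
  destruct (hat_start X0) as [K1 [T2 [HT2 Hhs]]].
  set (T0 := Rmax T1 (Rmax T2 T3)).
  pose proof (Rmax_l T1 (Rmax T2 T3)) as M1. pose proof (Rmax_r T1 (Rmax T2 T3)) as M2.
  pose proof (Rmax_l T2 T3) as M3. pose proof (Rmax_r T2 T3) as M4. fold T0 in M1, M2.
  assert (P0 : forall x T t, 0 <= T -> strip eps x T t -> punctured good2 t).
  { intros x T t HT Ht. now apply good2_punctured, (strip_half_plane eps x T). }
  destruct (start_to_strip good2 (yhat y) (zhat a g y z) X0 T0 K1) as [K' [T4 [HK' [HT4 [HT43 Hc1]]]]];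
    [lra | lra | | | |].
  - intros t Ht. apply (P0 (X0 + 1) T0); [lra | easy].
  - revert Hsv. apply solves_mono. intros t [[Hx Hy] Gt]. repeat split; try easy; try apply Gt; lra.
  - intros t [Hx Hy] Gt Hre. destruct (Hhs t) as [A1 A2]; [lra | rewrite Hre, Rabs_right; lra | easy|].
    destruct (Hst t) as [_ [_ A3]]; [lra | easy|]. auto.
  - destruct (type2_strip X0) as [K5 [T5 [HK5 [HT5 Hc2]]]].
    set (T6 := Rmax T4 T5). pose proof (Rmax_l T4 T5) as M5. pose proof (Rmax_r T4 T5) as M6. fold T6 in M5, M6.
    set (K6 := Rmax K' K5). pose proof (Rmax_l K' K5) as M7. pose proof (Rmax_r K' K5) as M8. fold K6 in M7, M8.
    destruct (X2_strip_bounds eps th phi delta om X0 Heps (par_om Hpar) Hdelta) as [m [M [Hm HX]]].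
    destruct (infinity_unique a B g p (p * q) X eps X0 T6 good2 y z (yhat y) (zhat a g y z) m M K6)
      as [T7 [HT7 [HT73 Hu]]]; auto.
    + apply pq_neq_0.
    + intros t [Hx _]. apply HX. lra.
    + intros t Ht. apply (P0 X0 T6); [lra | easy].
    + intros t [Ht [Gt _]]. apply (solution_solves eps th phi g om ah a B p q y z u Hpar Hsol).
      split; [apply (strip_half_plane eps X0 T6); [lra | easy] | easy].
    + revert Hsv. apply solves_mono. intros t [[Hx Hy] Gt]. repeat split; try easy; try apply Gt; lra.
    + apply strip_conclusion_mono with (good_at y z) K5 T5; auto; try lra. intros t Ht. apply Ht.
    + apply strip_conclusion_mono with good2 K' T4; auto; lra.
    + exists T7. intros tau Htau Ht0.
      assert (Hs : strip eps X0 T7 (ray eps tau)).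
      { split.
        - replace (Re (ray eps tau)) with 0 by (unfold ray, Re; simpl; ring). rewrite Rabs_R0. lra.
        - replace (Im (ray eps tau)) with (eps * tau) by (unfold ray, Im; simpl; ring).
          rewrite <- Rmult_assoc, (sign_sq _ Heps). lra. }
      pose proof (P0 X0 T7 _ ltac:(lra) Hs) as Hp. pose proof (strip_open _ _ _ _ Heps Hs) as Hn.
      generalize (near_and _ _ _ Hn Hp). apply near_mono. intros s [H1 H2] Hsr.
      destruct (Hu s H1 (H2 Hsr)) as [E1 [E2 E3]].
      assert (Ns : s <> RtoC 0) by (apply (strip_neq_0 eps X0 T7); [lra | easy]).
      destruct (vv_neq_0 _ _ _ _ Ns E3) as [N1 [N2 N3]].
      (* Uniqueness is known for v and z; y is recovered as t v / (z (z + a)), the denominator being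
         nonzero because v is. *)
      replace (y s) with (s * vv a y z s / (z s * (z s + a)))%C by (unfold vv; field; auto).
      rewrite E1. unfold vv. rewrite <- E2. field. auto.
Qed.

Lemma real_valued_on_ray (tau : R) : 0 < eps * tau -> holomorphic_at y (Ci * tau)%C ->
  y (Ci * tau)%C = RtoC (Re (y (Ci * tau)%C)).
Proof.
  intros Ht Hy. destruct symmetric_near_infinity as [T HT].
  assert (Er : (Ci * tau)%C = ray eps (eps * tau)).
  { unfold ray. rewrite <- Rmult_assoc, (sign_sq _ Heps), Rmult_1_l. easy. }
  pose proof (real_propagates eps y T Heps (fun t Ht => proj1 (proj1 (Hsol t Ht))) HT (eps * tau) Ht) as Hp.
  rewrite Er in *. set (t0 := ray eps (eps * tau)) in *.
  assert (Hc : ccont y t0).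
  { apply holomorphic_at_near, near_self in Hy. destruct Hy as [l Hl]. eapply cder_ccont; eauto. }
  assert (Et : refl t0 = t0) by apply refl_ray.
  assert (E : y t0 = yhat y t0).
  { apply punctured_eq_continuous; auto. apply ccont_reflect. now rewrite Et. }
  unfold yhat in E. rewrite Et in E. apply (f_equal Im) in E. rewrite im_conj in E.
  destruct (y t0) as [x0 y0]. unfold Im in E; simpl in E. unfold RtoC, Re; simpl. f_equal. lra.
Qed.
End Type2.

(** * The asymptotic formula on the imaginary axis *)

(** On the ray X = rho e^(i psi), and p q X = - c e^(i psi) with c > 0. Against 1 / X the cosines
    subtract and the sines add; at rho = 2 / amp both 1 / rho and c equal amp / 2, which kills the
    real part and produces the amplitude. *)
Lemma Wf_ray eps th phi delta (g om ah tau : R) (a B p q : C) : eps = 1 \/ eps = -1 ->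
  params th phi g om ah a B p q -> delta <> RtoC 0 -> 0 < eps * tau ->
  let rho := Cmod delta * exp (eps * PI * om / 2) in
  let c := (((om - g) / 2) ^ 2 + 2 * ah) / 4 * rho in
  let psi := tau - om * ln (Rabs tau) + Carg delta in
  Re (Wf p q (X2 th phi delta) (Ci * tau)%C) = (/ rho - c) * cos psi /\
  Im (Wf p q (X2 th phi delta) (Ci * tau)%C) = - ((/ rho + c) * sin psi + (om - g) / 2).
Proof.
  intros Heps Hpar Hd Ht rho c psi.
  assert (Hrho : 0 < rho).
  { apply Rmult_lt_0_compat; [now apply Cmod_pos | apply exp_pos]. }
  rewrite Wf_expand by now apply (X2_neq_0 th phi delta g om ah a B p q).
  rewrite (par_plus Hpar), (par_mult Hpar), (X2_ray eps th phi delta om tau Heps Ht Hd (par_om Hpar)).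
  fold rho psi.
  assert (E1 : (/ (RtoC rho * Cexp (Ci * psi)))%C = ((/ rho * cos psi, - (/ rho * sin psi)) : C)).
  { assert (Ee : (Cexp (Ci * psi) * Cexp (- (Ci * psi)))%C = RtoC 1).
    { rewrite <- Cexp_plus. replace (Ci * psi + - (Ci * psi))%C with (RtoC 0) by ring.
      rewrite Cexp_real, exp_0. easy. }
    assert (N : Cexp (Ci * psi) <> RtoC 0).
    { intros E. rewrite E, Cmult_0_l in Ee. symmetry in Ee. apply RtoC_eq_0 in Ee. lra. }
    assert (Nr : RtoC rho <> RtoC 0) by (intros E; apply RtoC_eq_0 in E; lra).
    replace (/ (RtoC rho * Cexp (Ci * psi)))%C with (RtoC (/ rho) * Cexp (- (Ci * psi)))%C.
    - unfold Cexp. replace (Re (- (Ci * psi))) with 0 by (unfold Re; simpl; ring).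
      replace (Im (- (Ci * psi))) with (- psi) by (unfold Im; simpl; ring).
      rewrite exp_0, cos_neg, sin_neg. unfold RtoC, Cmult; simpl. f_equal; ring.
    - rewrite RtoC_inv by lra.
      replace (Cexp (- (Ci * psi))) with (/ Cexp (Ci * psi))%C; [field; auto|].
      transitivity (/ Cexp (Ci * psi) * (Cexp (Ci * psi) * Cexp (- (Ci * psi))))%C;
        [rewrite Ee; ring | field; auto]. }
  assert (E2 : Cexp (Ci * psi) = ((cos psi, sin psi) : C)).
  { unfold Cexp. replace (Re (Ci * psi)) with 0 by (unfold Re; simpl; ring).
    replace (Im (Ci * psi)) with psi by (unfold Im; simpl; ring).
    rewrite exp_0. f_equal; ring. }
  rewrite E1, E2. unfold c. unfold Re, Im; simpl. split; field; lra.
Qed.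

Lemma Rabs_sign eps tau : eps = 1 \/ eps = -1 -> 0 < eps * tau -> Rabs tau = eps * tau.
Proof. intros [-> | ->] H; [rewrite Rabs_right | rewrite Rabs_left]; lra. Qed.

Lemma cos_2PI_INR n : cos (2 * PI * INR n) = 1.
Proof. replace (2 * PI * INR n) with (0 + 2 * INR n * PI) by ring. rewrite cos_period. apply cos_0. Qed.

(* The intermediate value theorem is applied in the variable ln |tau|. *)
Lemma phase_hits_maximum eps om c T : eps = 1 \/ eps = -1 -> 0 < T ->
  exists x, T < x /\ cos (eps * x - om * ln x + c) = 1.
Proof.
  intros Heps HT.
  (* eps G(s) is the phase at x = exp s; the factor eps makes G tend to + infinity in both cases, so
     that it reaches a multiple of 2 PI. *)
  set (G := fun s => exp s - eps * om * s + eps * c).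
  set (s0 := Rmax 1 (ln T + 1)). pose proof (Rmax_l 1 (ln T + 1)) as L1. pose proof (Rmax_r 1 (ln T + 1)) as L2.
  fold s0 in L1, L2.
  destruct (INR_unbounded (Rabs (G s0))) as [n Hn].
  assert (Hpi : 1 < 2 * PI) by (pose proof PI2_3_2; lra).
  assert (Hn0 : G s0 < 2 * PI * INR n).
  { pose proof (Rle_abs (G s0)). pose proof (Rabs_pos (G s0)). nra. }
  set (v := 2 * PI * INR n) in *.
  set (k := Rabs v + Rabs c + Rabs om).
  assert (Hk : 0 <= k) by (unfold k; pose proof (Rabs_pos v); pose proof (Rabs_pos c); pose proof (Rabs_pos om); lra).
  (* Chosen so that exp s1 >= s1^2 / 4 >= s1 (k + 1), which dominates the linear term, the constant
     and the target value v. *)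
  set (s1 := s0 + 4 * k + 4).
  assert (Heo : Rabs (eps * om) = Rabs om /\ Rabs (eps * c) = Rabs c).
  { destruct Heps as [-> | ->]; [now rewrite !Rmult_1_l|].
    replace (-1 * om) with (- om) by ring. replace (-1 * c) with (- c) by ring. now rewrite !Rabs_Ropp. }
  assert (Hs1 : v <= G s1).
  { unfold G. assert (Hs1p : 1 <= s1) by (unfold s1; lra).
    assert (He : s1 * s1 / 4 <= exp s1).
    { replace s1 with (s1 / 2 + s1 / 2) at 3 by field. rewrite exp_plus.
      pose proof (exp_ge_1_plus (s1 / 2)). nra. }
    pose proof (Rle_abs (eps * om)) as A1. rewrite (proj1 Heo) in A1.
    pose proof (Rle_abs (- (eps * c))) as A2. rewrite Rabs_Ropp, (proj2 Heo) in A2.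
    pose proof (Rle_abs v).
    assert (eps * om * s1 <= Rabs om * s1) by (apply Rmult_le_compat_r; lra).
    assert (s1 * (k + 1) <= s1 * s1 / 4) by (unfold s1 in *; nra).
    unfold k in *. pose proof (Rabs_pos v). pose proof (Rabs_pos c). pose proof (Rabs_pos om). nra. }
  destruct (IVT_gen G s0 s1 v) as [s [Hs Es]].
  - intros s. apply derivable_continuous_pt. apply ex_derive_Reals_0. unfold G. auto_derive. easy.
  - rewrite Rmin_left, Rmax_right by lra. lra.
  - rewrite Rmin_left, Rmax_right in Hs by (unfold s1; lra).
    exists (exp s). split.
    + rewrite <- (exp_ln T) by easy. apply exp_increasing. lra.
    + rewrite ln_exp. replace (eps * exp s - om * s + c) with (eps * G s).
      * rewrite Es. pose proof (cos_2PI_INR n) as Hc. fold v in Hc.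
        destruct Heps as [-> | ->]; [now rewrite Rmult_1_l|].
        replace (-1 * v) with (- v) by ring. now rewrite cos_neg.
      * unfold G. destruct Heps as [-> | ->]; ring.
Qed.

Theorem corollary3p3 :
  forall (eps : R) (th : theta) (phi delta uh : C) (y z u : C -> C)
         (Th01 om2 ah bh : R),
  eps = 1 \/ eps = -1 ->
  type2_parameters th phi delta uh ->
  type2_solution eps th phi delta uh y z u ->
  (Ci * Th01)%C = gamma5 th ->
  (Ci * om2)%C = nu2 th phi ->
  RtoC ah = alpha5 th ->
  RtoC bh = beta5 th ->
  ((om2 - Th01) / 2) ^ 2 > - (2 * ah) ->
  let amp := sqrt (((om2 - Th01) / 2) ^ 2 + 2 * ah) in
  amp > 0 /\
  (2 * exp (- (eps * PI * om2 / 2)) / Cmod delta = amp ->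
   exists yt : R -> R,
     real_on_ray eps y yt /\
     exists (E : R -> R) (K T : R), forall tau : R, T < eps * tau ->
       holomorphic_at y (Ci * tau)%C ->
       / yt tau =
         - (1 / tau) * ((om2 - Th01) / 2
                        + amp * sin (tau - om2 * ln (Rabs tau) + Carg delta)
                        + E tau) /\
       Rabs (E tau) <= K * (ln (Rabs tau) / Rabs tau)) /\
  ((exists yt : R -> R, real_on_ray eps y yt) ->
   2 * exp (- (eps * PI * om2 / 2)) / Cmod delta = amp).
Proof.
  intros eps th phi delta uh y z u g om ah bh Heps [_ [Hd _]] [Hsol [Has _]] Hg Hom Hah Hbh Hgt amp.
  set (A := ((om - g) / 2) ^ 2 + 2 * ah) in *.
  assert (HA : 0 < A) by (unfold A; lra).
  assert (Hamp : 0 < amp) by (unfold amp; now apply sqrt_lt_R0).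
  assert (Hsq : amp * amp = A) by (unfold amp; apply sqrt_sqrt; lra).
  set (b := ((Th0 th - Th1 th - Thinf th) / 2)%C).
  set (a := ((Th0 th - Th1 th + Thinf th) / 2)%C).
  set (p := (phi + Th0 th / 2)%C). set (q := (phi + (Th1 th - Thinf th) / 2)%C).
  assert (Hpar : params th phi g om ah a (b * b)%C p q).
  { constructor; auto.
    assert (Eb : (b * b)%C = RtoC (- (2 * bh))).
    { rewrite RtoC_opp, RtoC_mult, Hbh. unfold beta5. fold b. field. }
    rewrite Eb. apply Cconj_RtoC. }
  (* rho is |X| on the ray; the relation for |delta| reads rho = 2 / amp, that is, rho^2 = - 1 / (p
     q). *)
  set (rho := Cmod delta * exp (eps * PI * om / 2)).
  assert (Md : 0 < Cmod delta) by now apply Cmod_pos.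
  assert (Hrho : 0 < rho) by (apply Rmult_lt_0_compat; [easy | apply exp_pos]).
  assert (Ecrit : 2 * exp (- (eps * PI * om / 2)) / Cmod delta = 2 / rho).
  { unfold rho. rewrite exp_Ropp. pose proof (exp_pos (eps * PI * om / 2)). field. split; lra. }
  destruct (ray_asymptotics eps th phi delta uh y z u g om ah a (b * b)%C p q Heps Hpar Hd HA Hsol Has)
    as [K [T [HK [HT Hray]]]].
  split; [easy|]. split.
  - rewrite Ecrit. intros Hcrit.
    assert (Er : rho = 2 / amp) by (rewrite <- Hcrit; field; lra).
    assert (Hrefl : (p * q * RtoC (Cmod delta ^ 2 * exp (eps * PI * om)))%C = (- (1))%C).
    { replace (Cmod delta ^ 2 * exp (eps * PI * om)) with (rho * rho).
      - rewrite (par_mult Hpar). fold A. rewrite <- RtoC_mult, Er, <- Hsq, <- RtoC_opp. f_equal. field. lra.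
      - unfold rho. replace (eps * PI * om) with (eps * PI * om / 2 + eps * PI * om / 2) at 3 by field.
        rewrite exp_plus. ring. }
    exists (fun tau => Re (y (Ci * tau)%C)). split.
    + intros tau Ht Hy.
      apply (real_valued_on_ray eps th phi delta uh y z u g om ah a (b * b)%C p q); auto.
    (* E is the exact remainder, so the formula itself is an identity. The content is the bound: up
       to sign, E is the imaginary part of t / y - Wf at t = i tau. *)
    + exists (fun tau => - (tau * / Re (y (Ci * tau)%C))
        - ((om - g) / 2 + amp * sin (tau - om * ln (Rabs tau) + Carg delta))), K, T.
      intros tau Ht Hy. assert (Ht0 : 0 < eps * tau) by lra.
      assert (Nt : tau <> 0) by (intros E; rewrite E in Ht0; lra).
      destruct (Hray tau Ht Hy) as [Ny Hw].
      pose proof (real_valued_on_ray eps th phi delta uh y z u g om ah a (b * b)%C p q Heps Hpar Hd HA Hsol Has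
        Hrefl tau Ht0 Hy) as Ey.
      destruct (Wf_ray eps th phi delta g om ah tau a (b * b)%C p q Heps Hpar Hd Ht0) as [_ Ei].
      fold A rho in Ei.
      assert (Ea : / rho + A / 4 * rho = amp) by (rewrite Er, <- Hsq; field; lra).
      rewrite Ea in Ei.
      set (r := Re (y (Ci * tau)%C)) in *.
      assert (Nr : r <> 0) by (intros E; apply Ny; rewrite Ey, E; easy).
      split; [field; auto|].
      rewrite (Rabs_sign eps tau Heps Ht0). fold (lnq (eps * tau)). rewrite <- (Rabs_sign eps tau Heps Ht0) at 1.
      eapply Rle_trans; [|exact Hw]. eapply Rle_trans; [|apply im_le_Cmod].
      rewrite Ey. right.
      replace (Im (Ci * tau / RtoC r - Wf p q (X2 th phi delta) (Ci * tau))%C)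
        with (tau * / r - Im (Wf p q (X2 th phi delta) (Ci * tau)%C)).
      * rewrite Ei, <- (Rabs_Ropp (tau * / r - _)). f_equal.
        ring.
      * unfold Cdiv. rewrite <- RtoC_inv by easy. unfold Im; simpl. ring.
  - rewrite Ecrit. intros [yt Hyt].
    assert (Eq : / rho = A / 4 * rho).
    (* For real y the quotient i tau / y is imaginary, so Re Wf = D cos (phase) is itself O(ln tau /
       tau). Arbitrarily far out the cosine equals 1, which forces D = 0. *)
    { apply Rminus_diag_uniq. apply NNPP. intros Hne.
      set (D := / rho - A / 4 * rho) in *.
      assert (HD : 0 < Rabs D) by now apply Rabs_pos_lt.
      destruct (lnq_small K (Rabs D / 2)) as [T1 HT1]; [lra|].
      set (T2 := Rmax T T1). pose proof (Rmax_l T T1) as M1. pose proof (Rmax_r T T1) as M2. fold T2 in M1, M2.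
      destruct (phase_hits_maximum eps om (Carg delta) T2 Heps) as [x [Hx Hc]]; [lra|].
      (* y may have a pole at the point where the cosine is 1; the bound is obtained at nearby
         regular points x + h of the ray and passes to the limit, both of its sides being
         continuous. *)
      assert (Q : Rabs (D * cos (eps * x - om * ln x + Carg delta)) - K * lnq x <= 0).
      { apply (continuous_le_limit (fun x => Rabs (D * cos (eps * x - om * ln x + Carg delta)) - K * lnq x)).
        - apply @continuous_minus.
          + apply (continuous_comp (fun x => D * cos (eps * x - om * ln x + Carg delta)) Rabs);
              [|apply continuous_Rabs].
            apply @ex_derive_continuous. auto_derive. lra.
          + apply @ex_derive_continuous. unfold lnq. auto_derive. lra.
        - intros eta Heta.
          assert (Hh : half_plane eps (ray eps x)) by (apply half_plane_ray_pos; [easy | lra]).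
          destruct (meromorphic_at_punctured y (ray eps x)) as [d [Hd' G]].
          { apply (Hsol _ Hh). }
          set (h := Rmin d eta / 2).
          assert (Hh0 : 0 < h /\ h < d /\ h < eta).
          { unfold h. pose proof (Rmin_l d eta). pose proof (Rmin_r d eta).
            assert (0 < Rmin d eta) by now apply Rmin_glb_lt. lra. }
          exists (x + h). split; [replace (x + h - x) with h by ring; rewrite Rabs_right; lra|].
          set (tau := eps * (x + h)).
          assert (Et : eps * tau = x + h) by (unfold tau; rewrite <- Rmult_assoc, (sign_sq _ Heps); ring).
          assert (Hy : holomorphic_at y (Ci * tau)%C).
          { change (Ci * tau)%C with (ray eps (x + h)).
            apply G.
            - rewrite ray_dist by easy. replace (x + h - x) with h by ring. rewrite Rabs_right; lra.
            - intros E. pose proof (ray_dist eps (x + h) x Heps) as Dd. rewrite E, Cmod_self in Dd.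
              replace (x + h - x) with h in Dd by ring. rewrite Rabs_right in Dd; lra. }
          assert (Ht0 : 0 < eps * tau) by lra.
          destruct (Hray tau ltac:(lra) Hy) as [Ny Hw]. rewrite Et in Hw.
          pose proof (Hyt tau Ht0 Hy) as Ey.
          destruct (Wf_ray eps th phi delta g om ah tau a (b * b)%C p q Heps Hpar Hd Ht0) as [Ei _].
          fold A rho D in Ei. rewrite (Rabs_sign eps tau Heps Ht0), Et in Ei. fold tau.
          assert (Nr : yt tau <> 0) by (intros E; apply Ny; rewrite Ey, E; easy).
          pose proof (re_le_Cmod (Ci * tau / y (Ci * tau) - Wf p q (X2 th phi delta) (Ci * tau))%C) as Hre.
          rewrite Ey in Hre, Hw.
          replace (Re (Ci * tau / RtoC (yt tau) - Wf p q (X2 th phi delta) (Ci * tau))%C)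
            with (- Re (Wf p q (X2 th phi delta) (Ci * tau)%C)) in Hre.
          + rewrite Rabs_Ropp, Ei in Hre. lra.
          + unfold Cdiv. rewrite <- RtoC_inv by easy. unfold Re; simpl. ring. }
      rewrite Hc, Rmult_1_r in Q. specialize (HT1 x ltac:(lra)). lra. }
    (* 1 / rho = A rho / 4 gives (2 / rho)^2 = A, and positivity selects the root. *)
    assert (E4 : (2 / rho) * (2 / rho) = amp * amp).
    { rewrite Hsq. transitivity (4 * / rho * (A / 4 * rho)); [rewrite <- Eq|]; field; lra. }
    assert (0 < 2 / rho) by (apply Rdiv_lt_0_compat; lra). nra.
Qed.
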